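(* Let $\Sigma$ be a closed immersed oriented spacelike codimension-two submanifold in an $(n+1)$-dimensional Riemannian or Lorentzian manifold $V$ that possesses a conformal Killing-Yano two-form $Q$. For any null normal vector field $\underline L$ of $\Sigma$, $$\frac{n-1}{n}\int_\Sigma\langle\xi,\underline L\rangle\,d\mu+\int_\Sigma Q(\vec H,\underline L)\,d\mu+\int_\Sigma Q\big(\partial_a,(D^a\underline L)^\perp\big)\,d\mu=0,$$ where $\xi=\mathrm{div}_VQ$.
   Context: $V$ is oriented with metric $\langle\cdot,\cdot\rangle$ and Levi-Civita connection $D$; the normal bundle of $\Sigma$ is assumed orientable. A two-form $Q$ on an $(n+1)$-dimensional pseudo-Riemannian manifold $V$ is a conformal Killing-Yano two-form if $$(D_XQ)(Y,Z)+(D_YQ)(X,Z)=\frac2n\Big(\langle X,Y\rangle\langle\xi,Z\rangle-\frac12\langle X,Z\rangle\langle\xi,Y\rangle-\frac12\langle Y,Z\rangle\langle\xi,X\rangle\Big)$$ for all tangent vectors $X,Y,Z$, where $\xi=\mathrm{div}_VQ$, i.e. $\xi_\beta=D^\alpha Q_{\alpha\beta}$. $\partial_a$ ($a=1,\dots,n-1$) are the coordinate tangent vectors of local coordinates on $\Sigma$, $D_a=D_{\partial_a}$, indices are raised with the induced metric and repeated indices are summed. $(\cdot)^\perp$ is the normal component, $\vec H$ is the mean curvature vector (trace of $(D_XY)^\perp$ over $T\Sigma$), $d\mu$ the induced volume form. *)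

(* Defs.v *)
From mathcomp Require Import all_boot all_order all_algebra.
From mathcomp Require Import all_classical all_reals all_analysis.
From mathcomp Require Import measurable_realfun.
From mathcomp Require Import ring.

Set Implicit Arguments.
Unset Strict Implicit.
Unset Printing Implicit Defensive.

Import Order.TTheory GRing.Theory Num.Theory.
Import numFieldNormedType.Exports.

Local Open Scope classical_set_scope.
Local Open Scope ring_scope.

(* Tangent vectors are row vectors.  A linear map is right multiplication by a
   matrix (the library's Jacobian 'J follows this convention), and a bilinear
   form with matrix G is (u, v) |-> u *m G *m v^T. *)

Section euclidean.
Variable R : realType.

Definition basis_vec m (i : 'I_m) : 'rV[R]_m := delta_mx 0 i.

Fixpoint class_C (k m : nat) (W : normedModType R) (U : set 'rV[R]_m)
    (f : 'rV[R]_m -> W) : Prop :=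
  match k with
  | 0 => forall x, U x -> {for x, continuous f}
  | k'.+1 => (forall x, U x -> differentiable f x) /\
             forall i : 'I_m, class_C k' U ('D_(basis_vec i) f)
  end.

(* C^infinity on the open set U; values of f outside U are irrelevant. *)
Definition smooth m (W : normedModType R) (U : set 'rV[R]_m)
    (f : 'rV[R]_m -> W) : Prop := forall k, class_C k U f.

(* Lebesgue integral over R^k of a nonnegative Borel function, as an iterated
   integral (Tonelli). *)
Fixpoint integral_rV (k : nat) : ('rV[R]_k -> \bar R) -> \bar R :=
  match k with
  | 0 => fun f => f 0
  | k'.+1 => fun f => (\int[lebesgue_measure]_(t in [set: R])
               integral_rV (fun v : 'rV[R]_k' =>
                 f (row_mx (t%:M : 'rV[R]_1) v)))%E
  end.

Definition bil m (G : 'M[R]_m) (u v : 'rV[R]_m) : R := (u *m G *m v^T) 0 0.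

Definition posdef m (G : 'M[R]_m) : Prop :=
  forall v : 'rV[R]_m, v != 0 -> 0 < bil G v v.

(* Signature (-, +, ..., +). *)
Definition minkowski m : 'M[R]_m.+1 :=
  diag_mx (\row_(i < m.+1) if i == ord0 then -1 else 1).

Definition lorentz_form m (G : 'M[R]_m.+1) : Prop :=
  exists2 P : 'M[R]_m.+1, P \in unitmx & P *m G *m P^T = minkowski m.

End euclidean.

(* A smooth manifold without boundary, given by a smooth atlas which need not
   be maximal.  [coord a] is only meaningful on [dom a] and its inverse
   [param a] only on the image of [dom a].  [chart_at] selects a chart around
   each point; it witnesses that the charts cover, and chart-independent
   quantities are evaluated in the chart that it selects. *)
Record manifold (R : realType) (m : nat) := Manifold {
  carrier :> ptopologicalType ;
  manifold_hausdorff : hausdorff_space carrier ;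
  manifold_second_countable : @second_countable carrier ;
  chart : Type ;
  dom : chart -> set carrier ;
  coord : chart -> carrier -> 'rV[R]_m ;
  param : chart -> 'rV[R]_m -> carrier ;
  chart_at : carrier -> chart ;
  chart_atP : forall p, dom (chart_at p) p ;
  dom_open : forall a, open (dom a) ;
  img_open : forall a, open (coord a @` dom a) ;
  coordK : forall a p, dom a p -> param a (coord a p) = p ;
  coord_cont : forall a p, dom a p -> {for p, continuous (coord a)} ;
  param_cont : forall a x, (coord a @` dom a) x -> {for x, continuous (param a)} ;
  transition_smooth : forall a b,
    smooth (coord a @` (dom a `&` dom b)) (coord b \o param a)
}.

Section manifold_defs.
Variables (R : realType) (m : nat) (M : manifold R m).
Implicit Types (a b : chart M) (x : 'rV[R]_m).

Definition img a : set 'rV[R]_m := coord a @` dom a.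

Definition transition a b : 'rV[R]_m -> 'rV[R]_m := coord b \o param a.

(* An orientation is encoded by an atlas of positively oriented charts. *)
Definition oriented : Prop := forall a b x,
  (coord a @` (dom a `&` dom b)) x -> 0 < \det ('J (transition a b) x).

(* A field of bilinear forms on M: component matrices in every chart, as
   functions of the coordinates. *)
Definition tensor_field (T : chart M -> 'rV[R]_m -> 'M[R]_m) : Prop :=
  (forall a, smooth (img a) (T a)) /\
  (forall a b x, (coord a @` (dom a `&` dom b)) x ->
     let J := 'J (transition a b) x in
     T a x = J *m T b (transition a b x) *m J^T).

Definition two_form (Q : chart M -> 'rV[R]_m -> 'M[R]_m) : Prop :=
  tensor_field Q /\ forall a x, img a x -> (Q a x)^T = - Q a x.

Definition pseudo_riemannian (g : chart M -> 'rV[R]_m -> 'M[R]_m) : Prop :=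
  tensor_field g /\
  forall a x, img a x -> (g a x)^T = g a x /\ g a x \in unitmx.

Definition riemannian (g : chart M -> 'rV[R]_m -> 'M[R]_m) : Prop :=
  pseudo_riemannian g /\ forall a x, img a x -> posdef (g a x).

End manifold_defs.

Definition lorentzian (R : realType) (m : nat) (M : manifold R m.+1)
    (g : chart M -> 'rV[R]_m.+1 -> 'M[R]_m.+1) : Prop :=
  pseudo_riemannian g /\ forall a x, img a x -> lorentz_form (g a x).

Section levi_civita.
Variables (R : realType) (m : nat).
Implicit Types (G Q : 'rV[R]_m -> 'M[R]_m) (x u v X Y Z : 'rV[R]_m).

Definition partial (i : 'I_m) (f : 'rV[R]_m -> R) x : R :=
  'D_(basis_vec R i) f x.

Definition christoffel G x (l j k : 'I_m) : R :=
  2^-1 * \sum_(s < m) invmx (G x) l s *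
    (partial j (fun y => G y s k) x + partial k (fun y => G y s j) x
     - partial s (fun y => G y j k) x).

Definition gamma G x u v : 'rV[R]_m :=
  \row_l \sum_(j < m) \sum_(k < m) christoffel G x l j k * u 0 j * v 0 k.

(* (D_X Q)(Y, Z) *)
Definition nabla G Q x X Y Z : R :=
  bil ('D_X Q x) Y Z - bil (Q x) (gamma G x X Y) Z - bil (Q x) Y (gamma G x X Z).

(* xi_b = g^{ac} (D_c Q)_{ab} *)
Definition div_form G Q x : 'rV[R]_m :=
  \row_b \sum_(a < m) \sum_(c < m) invmx (G x) a c *
    nabla G Q x (basis_vec R c) (basis_vec R a) (basis_vec R b).

(* xi with its index raised *)
Definition div_vec G Q x : 'rV[R]_m := div_form G Q x *m invmx (G x).

(* The connection with these symbols is torsion-free (gamma_sym) and metric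
   (nabla_metric), i.e. it is the Levi-Civita connection of G. *)

Lemma partial_sym G x s j k : (\near x, (G x)^T = G x) ->
  partial s (fun y => G y j k) x = partial s (fun y => G y k j) x.
Proof.
move=> sG; apply: near_eq_derive; apply: filterS sG => y sGy.
by rewrite -{1}sGy mxE.
Qed.

Lemma gamma_sym G x u v : (\near x, (G x)^T = G x) ->
  gamma G x u v = gamma G x v u.
Proof.
move=> sG; apply/rowP => l; rewrite !mxE exchange_big /=.
apply: eq_bigr => k _; apply: eq_bigr => j _.
rewrite mulrAC; congr (_ * _ * _); rewrite /christoffel; congr (_ * _).
apply: eq_bigr => s _; congr (_ * _).
by rewrite (partial_sym s j k sG) [X in X - _]addrC.
Qed.

Lemma bilE (A : 'M[R]_m) u v :
  bil A u v = \sum_(j < m) \sum_(k < m) A j k * u 0 j * v 0 k.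
Proof.
rewrite /bil mxE; under eq_bigr => k _ do rewrite !mxE big_distrl /=.
rewrite exchange_big /=; apply: eq_bigr => j _; apply: eq_bigr => k _.
by rewrite [u _ _ * _]mulrC.
Qed.

Lemma bil_sym (A : 'M[R]_m) u v : A^T = A -> bil A u v = bil A v u.
Proof.
move=> sA; rewrite !bilE exchange_big /=.
apply: eq_bigr => k _; apply: eq_bigr => j _.
by rewrite -{1}sA mxE mulrAC.
Qed.

Lemma bil_gamma G x u v w : (\near x, (G x)^T = G x) -> G x \in unitmx ->
  bil (G x) (gamma G x u v) w =
  2^-1 * \sum_(s < m) \sum_(j < m) \sum_(k < m)
    (partial j (fun y => G y s k) x + partial k (fun y => G y s j) x
     - partial s (fun y => G y j k) x) * u 0 j * v 0 k * w 0 s.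
Proof.
move=> sG uG; have sGx := nbhs_singleton sG.
pose B j k s := partial j (fun y => G y s k) x + partial k (fun y => G y s j) x
  - partial s (fun y => G y j k) x.
pose c : 'rV[R]_m :=
  \row_s (2^-1 * \sum_(j < m) \sum_(k < m) B j k s * u 0 j * v 0 k).
have -> : gamma G x u v = c *m invmx (G x).
  apply/rowP => l; rewrite !mxE.
  have iC s : invmx (G x) l s = invmx (G x) s l.
    by rewrite -{1}sGx -trmx_inv mxE.
  transitivity (\sum_(j < m) \sum_(s < m) \sum_(k < m)
      2^-1 * (B j k s * u 0 j * v 0 k) * invmx (G x) s l).
    apply: eq_bigr => j _; rewrite exchange_big; apply: eq_bigr => k _.
    rewrite /christoffel mulr_sumr !big_distrl; apply: eq_bigr => s _ /=.
    by rewrite iC -!mulrA; congr (_ * _); rewrite mulrC -!mulrA.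
  rewrite exchange_big; apply: eq_bigr => s _.
  rewrite mxE mulr_sumr big_distrl; apply: eq_bigr => j _ /=.
  by rewrite mulr_sumr big_distrl.
rewrite /bil mulmxKV // mxE.
under eq_bigr => s _ do rewrite !mxE -mulrA.
rewrite -mulr_sumr; congr (_ * _); apply: eq_bigr => s _.
rewrite big_distrl /=; apply: eq_bigr => j _.
by rewrite big_distrl.
Qed.

Lemma nabla_metric G x X Y Z : differentiable G x ->
  (\near x, (G x)^T = G x) -> G x \in unitmx -> nabla G G x X Y Z = 0.
Proof.
move=> dG sG uG; have sGx := nbhs_singleton sG.
have dGij j k : differentiable (fun y => G y j k) x.
  exact: (differentiable_comp dG (differentiable_coord _ _ _)).
have DE j k : ('D_X G x) j k = \sum_(s < m) X 0 s * partial s (fun y => G y j k) x.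
  rewrite derive_mx; last exact: diff_derivable.
  rewrite mxE deriveE // [X in 'd _ _ X]row_sum_delta linear_sum /=.
  by apply: eq_bigr => s _; rewrite linearZ /= /partial deriveE.
rewrite /nabla (bil_sym Y _ sGx) !bil_gamma //.
apply/eqP; rewrite -addrA -opprD subr_eq0; apply/eqP.
rewrite -mulrDr bilE; apply/esym.
pose f (s j k : 'I_m) := partial s (fun y => G y j k) x.
pose T (h : 'I_m -> 'I_m -> 'I_m -> R) :=
  \sum_(s < m) \sum_(j < m) \sum_(k < m) h s j k * (X 0 s * Y 0 j * Z 0 k).
have fC s j k : f s j k = f s k j by exact: partial_sym.
have -> : \sum_(s < m) \sum_(j < m) \sum_(k < m)
    (f j s k + f k s j - f s j k) * X 0 j * Y 0 k * Z 0 s =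
    T (fun s j k => f s k j + f j k s - f k s j).
  rewrite exchange_big; apply: eq_bigr => j _; rewrite exchange_big.
  by apply: eq_bigr => k _; apply: eq_bigr => s _; rewrite !mulrA.
have -> : \sum_(s < m) \sum_(j < m) \sum_(k < m)
    (f j s k + f k s j - f s j k) * X 0 j * Z 0 k * Y 0 s =
    T (fun s j k => f s j k + f k j s - f j s k).
  rewrite exchange_big; apply: eq_bigr => j _.
  apply: eq_bigr => k _; apply: eq_bigr => s _.
  by rewrite -!mulrA [Z _ _ * _]mulrC.
have -> : \sum_(j < m) \sum_(k < m) ('D_X G x) j k * Y 0 j * Z 0 k = T f.
  rewrite [RHS]exchange_big; apply: eq_bigr => j _; rewrite [RHS]exchange_big.
  apply: eq_bigr => k _; rewrite DE !big_distrl; apply: eq_bigr => s _ /=.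
  by rewrite [X _ _ * _]mulrC !mulrA.
rewrite /T -big_split mulr_sumr; apply: eq_bigr => s _.
rewrite -big_split mulr_sumr; apply: eq_bigr => j _.
rewrite -big_split mulr_sumr; apply: eq_bigr => k _ /=.
by rewrite -mulrDl mulrA; congr (_ * _); rewrite (fC s k j) (fC j k s) (fC k j s); field.
Qed.

End levi_civita.

Definition conformal_killing_yano (R : realType) (n : nat) (V : manifold R n.+1)
    (g Q : chart V -> 'rV[R]_n.+1 -> 'M[R]_n.+1) : Prop :=
  two_form Q /\
  forall i y, img i y -> forall X Y Z : 'rV[R]_n.+1,
    let inner := bil (g i y) in
    let xi := div_vec (g i) (Q i) y in
    nabla (g i) (Q i) y X Y Z + nabla (g i) (Q i) y Y X Z =
    2 / n%:R * (inner X Y * inner xi Z - 2^-1 * (inner X Z * inner xi Y)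
                - 2^-1 * (inner Y Z * inner xi X)).

Definition borel (T : ptopologicalType) := g_sigma_algebraType (@open T).

Section submanifold.
Variables (R : realType) (k m : nat).
Variables (S : manifold R k) (V : manifold R m).
Variable (g : chart V -> 'rV[R]_m -> 'M[R]_m) (F : S -> V).
Implicit Types (a : chart S) (i j : chart V) (p : S).

Definition local_dom a i : set 'rV[R]_k := coord a @` (dom a `&` F @^-1` dom i).

Definition local_map a i : 'rV[R]_k -> 'rV[R]_m := coord i \o F \o param a.

Definition immersion : Prop :=
  continuous F /\
  forall a i, smooth (local_dom a i) (local_map a i) /\
    forall x, local_dom a i x -> row_free ('J (local_map a i) x).

(* Component vectors (in every chart of V, at points of S) of a vector field of
   V along F. *)
Definition field_along (L : chart V -> S -> 'rV[R]_m) : Prop :=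
  (forall a i, smooth (local_dom a i) (L i \o param a)) /\
  (forall i j p, dom i (F p) -> dom j (F p) ->
     L j p = L i p *m 'J (transition i j) (coord i (F p))).

Definition form_along (w : chart V -> S -> 'M[R]_m) : Prop :=
  (forall a i, smooth (local_dom a i) (w i \o param a)) /\
  (forall i j p, dom i (F p) -> dom j (F p) ->
     let J := 'J (transition i j) (coord i (F p)) in
     w i p = J *m w j p *m J^T).

Section at_point.
Variables (a : chart S) (i : chart V) (p : S).

Definition metric_at : 'M[R]_m := g i (coord i (F p)).

(* Row b is the coordinate tangent vector d_b, as a vector of V at F p. *)
Definition frame : 'M[R]_(k, m) := 'J (local_map a i) (coord a p).

Definition induced_metric : 'M[R]_k := frame *m metric_at *m frame^T.

Definition is_normal (v : 'rV[R]_m) : Prop :=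
  forall b : 'I_k, bil metric_at v (row b frame) = 0.

(* v - h^{bc} <v, d_b> d_c *)
Definition normal_part (v : 'rV[R]_m) : 'rV[R]_m :=
  v - \sum_(b < k) \sum_(c < k)
        (invmx induced_metric b c * bil metric_at v (row b frame)) *: row c frame.

(* D_b w, for a field w along F with components given in the coordinates of
   the chart a. *)
Definition cov_along (w : 'rV[R]_k -> 'rV[R]_m) (b : 'I_k) : 'rV[R]_m :=
  'D_(basis_vec R b) w (coord a p) +
  gamma (g i) (coord i (F p)) (row b frame) (w (coord a p)).

Definition mean_curvature : 'rV[R]_m :=
  \sum_(b < k) \sum_(c < k) invmx induced_metric b c *:
    normal_part (cov_along (fun x => row c ('J (local_map a i) x)) b).

(* (D_b L)^perp *)
Definition normal_derivative (L : chart V -> S -> 'rV[R]_m) (b : 'I_k) : 'rV[R]_m :=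
  normal_part (cov_along (L i \o param a) b).

End at_point.

Definition spacelike : Prop := forall a i p,
  dom a p -> dom i (F p) -> posdef (induced_metric a i p).

Definition normal_field (L : chart V -> S -> 'rV[R]_m) : Prop :=
  field_along L /\
  forall a i p, dom a p -> dom i (F p) -> is_normal a i p (L i p).

Definition null_field (L : chart V -> S -> 'rV[R]_m) : Prop :=
  forall i p, dom i (F p) -> bil (metric_at i p) (L i p) (L i p) = 0.

(* For a normal bundle of rank two: there is a two-form along F that does not
   vanish on any normal plane. *)
Definition normal_bundle_orientable : Prop :=
  exists2 w : chart V -> S -> 'M[R]_m, form_along w &
  forall a i p, dom a p -> dom i (F p) ->
    (w i p)^T = - w i p /\
    forall u v : 'rV[R]_m, is_normal a i p u -> is_normal a i p v ->
      row_free (col_mx u v) -> bil (w i p) u v != 0.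

(* mu is the Riemannian measure of the induced metric h: in each chart,
   d mu = sqrt (det h) dx^1 ... dx^k.  Since the charts cover and S is second
   countable, this determines mu. *)
Definition induced_volume (mu : {measure set (borel S) -> \bar R}) : Prop :=
  forall a (f : borel S -> \bar R),
    measurable_fun (dom a : set (borel S)) f ->
    (forall p, (0 <= f p)%E) ->
    (\int[mu]_(p in (dom a : set (borel S))) f p)%E =
    integral_rV ((fun x : 'rV[R]_k =>
      let p := param a x in
      f p * (Num.sqrt (\det (induced_metric a (chart_at (F p)) p)))%:E)%E
      \_ (img a)).

Section integrands.
Variables (Q : chart V -> 'rV[R]_m -> 'M[R]_m) (L : chart V -> S -> 'rV[R]_m).

(* <xi, L> *)
Definition xi_dot (p : S) : R :=
  let i := chart_at (F p) in
  bil (metric_at i p) (div_vec (g i) (Q i) (coord i (F p))) (L i p).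

(* Q(H, L) *)
Definition Q_mean_curvature (p : S) : R :=
  let a := chart_at p in let i := chart_at (F p) in
  bil (Q i (coord i (F p))) (mean_curvature a i p) (L i p).

(* Q(d_a, (D^a L)^perp) *)
Definition Q_normal_derivative (p : S) : R :=
  let a := chart_at p in let i := chart_at (F p) in
  \sum_(b < k) \sum_(c < k) invmx (induced_metric a i p) b c *
    bil (Q i (coord i (F p))) (row b (frame a i p)) (normal_derivative a i p L c).

End integrands.

End submanifold.

(* Main.v *)
From mathcomp Require Import all_boot all_order all_fingroup all_algebra.
From mathcomp Require Import all_classical all_reals all_analysis.
From mathcomp Require Import measurable_realfun.
From mathcomp Require Import ring lra.
From mathcomp Require finmap.
Require Import Defs.

(** The integrand is a divergence.  Let h be the induced metric, e_b the
    coordinate tangent vectors and consider the tangent one-form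
    X_c = Q(e_c, L).  Covariant differentiation gives
    d_b X_c = (D_b Q)(e_c, L) + Q(D_b e_c, L) + Q(e_c, D_b L).
    In div X = h^{bc} (d_b X_c - Gamma^p_{bc} X_p), where Gamma denotes the
    Christoffel symbols of h, the last term removes the tangential part of
    D_b e_c, because Gamma^p_{bc} e_p is that tangential part.  The tangential
    part of D_b L is - S_b^p e_p with S the (symmetric) shape operator of L, and
    h^{bc} S_b^p Q(e_c, e_p) vanishes since Q is skew.  Hence
    div X = h^{bc} (D_b Q)(e_c, L) + Q(H, L) + h^{bc} Q(e_b, (D_c L)^perp).
    Symmetrizing the first term, the conformal Killing-Yano equation and
    <e_b, L> = 0 turn it into (n-1)/n <xi, L>.  This is [divergence_identity]
    together with [nabla_trace].

    It remains to see that a divergence integrates to zero over a closed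
    manifold.  Each of the three terms is the h-trace of a matrix that changes
    by congruence with the Jacobian when the charts change
    ([curvature_mx_change] and its companions), so each is a well-defined
    continuous function on the compact manifold, hence integrable.  That the
    matrices transform in this way rests on the transformation law of the
    Levi-Civita connection ([gamma_change]), which is deduced from the
    uniqueness of a symmetric metric connection rather than by differentiating
    Christoffel symbols.

    With a C^1 partition of unity chi_q supported in coordinate balls, div X is
    the sum of the functions div (chi_q X) = chi_q div X + <grad chi_q, X>, the
    gradient terms adding up to zero.  In a chart each of them is
    rho^{-1} sum_b d_b w^b, with rho = sqrt (det h) and w of class C^1 with
    compact support.  Integrals over the manifold are only known through
    iterated Lebesgue integrals of nonnegative functions; these are invariant
    under translations, so difference quotients of w^b integrate to zero, and
    dominated convergence passes to the derivative ([integral_derive0]).  The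
    same charts show that the total volume is finite. *)

Set Implicit Arguments.
Unset Strict Implicit.
Unset Printing Implicit Defensive.

Import Order.TTheory GRing.Theory Num.Theory.
Import numFieldNormedType.Exports.

Local Open Scope classical_set_scope.
Local Open Scope ring_scope.

(** * Maps of class C^k between coordinate spaces *)

Section calculus.
Variable R : realType.

Lemma near_eq_differentiable (V W : normedModType R) (f g : V -> W) x :
  (\near x, f x = g x) -> differentiable f x -> differentiable g x.
Proof.
move=> fg /diff_locallyP[cf /eqaddoP fE].
have dg : g \o shift x = cst (g x) + 'd f x +o_ (0 : V) id.
  apply/eqaddoP => e e0; have := fE e e0.
  have fgx := nbhs_singleton fg.
  have fg0 : \forall h \near (0 : V), f (h + x) = g (h + x).
    by move: fg; rewrite (near_shift 0) subr0.
  by apply: filterS2 fg0 => h /= fgh; rewrite /= !fctE /= fgh fgx.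
have dE := diff_unique cf dg.
by apply/diff_locallyP; rewrite dE.
Qed.

Lemma open_near (T : topologicalType) (U : set T) (P : T -> Prop) x :
  open U -> U x -> (forall y, U y -> P y) -> \near x, P x.
Proof. by move=> oU Ux UP; apply: filterS UP _; exact: open_nbhs_nbhs. Qed.

Lemma derive_entry (V : normedModType R) p q (A : V -> 'M[R]_(p, q)) x v i j :
  derivable A x v -> 'D_v (fun y => A y i j) x = ('D_v A x) i j.
Proof. by move=> dA; rewrite derive_mx // mxE. Qed.

Lemma differentiable_entry (V : normedModType R) p q (A : V -> 'M[R]_(p, q)) x i j :
  differentiable A x -> differentiable (fun y => A y i j) x.
Proof.
by move=> dA; exact: (differentiable_comp dA (differentiable_coord _ _ _)).
Qed.

Section class_C.
Variable m : nat.
Implicit Types U : set 'rV[R]_m.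

(** Regularity on an open set only sees the values there.  This lets a
    function be replaced by a formula for it that is valid on the set only. *)
Lemma class_C_eq (W : normedModType R) k U (f g : 'rV[R]_m -> W) :
  open U -> (forall x, U x -> f x = g x) -> class_C k U f -> class_C k U g.
Proof.
move=> oU; elim: k f g => [|k IH] f g fg /=.
  move=> cf x Ux; have fgx := open_near oU Ux fg.
  have := cf x Ux; rewrite /prop_for /continuous_at fg //; apply: cvg_trans.
  exact: near_eq_cvg fgx.
case=> df cf; split=> [x Ux|i].
  exact: near_eq_differentiable (open_near oU Ux fg) (df x Ux).
apply: IH (cf i) => x Ux.
exact: near_eq_derive (open_near oU Ux fg).
Qed.

Lemma class_C_sub (W : normedModType R) k U U' (f : 'rV[R]_m -> W) :
  U' `<=` U -> class_C k U f -> class_C k U' f.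
Proof.
move=> UU; elim: k f => [|k IH] f /=; first by move=> cf x /UU /cf.
by case=> df cf; split=> [x /UU /df //|i]; exact: IH.
Qed.

Lemma class_CW (W : normedModType R) k U (f : 'rV[R]_m -> W) :
  class_C k.+1 U f -> class_C k U f.
Proof.
elim: k f => [|k IH] f [df cf]; last by split=> // i; exact/IH/cf.
by move=> x /df; exact: differentiable_continuous.
Qed.

Lemma class_CU (W : normedModType R) k U U' (f : 'rV[R]_m -> W) :
  class_C k U f -> class_C k U' f -> class_C k (U `|` U') f.
Proof.
elim: k f => [|k IH] f /=; first by move=> cf cf' x [/cf|/cf'].
by case=> df cf [df' cf']; split=> [x [/df|/df']//|i]; exact: IH.
Qed.

Lemma class_C_cst (W : normedModType R) k U (c : W) :
  class_C k U (fun=> c : W).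
Proof.
elim: k c => [|k IH] c /=; first by move=> x _; exact: cst_continuous.
split=> [x _|i]; first exact: differentiable_cst.
rewrite (_ : 'D_(basis_vec R i) (fun=> c) = (fun=> 0)) //.
by apply/funext => x; exact: derive_cst.
Qed.

Lemma class_CD (W : normedModType R) k U (f g : 'rV[R]_m -> W) : open U ->
  class_C k U f -> class_C k U g -> class_C k U (fun x => f x + g x).
Proof.
move=> oU; elim: k f g => [|k IH] f g /=.
  by move=> cf cg x Ux; exact: cvgD (cf x Ux) (cg x Ux).
case=> df cf [dg cg]; split=> [x Ux|i].
  by apply: differentiableD; [exact: df|exact: dg].
apply: class_C_eq (IH _ _ (cf i) (cg i)) => // x Ux.
rewrite -deriveD //; [exact/diff_derivable/df|exact/diff_derivable/dg].
Qed.

Lemma class_CM k U (f g : 'rV[R]_m -> R) : open U ->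
  class_C k U f -> class_C k U g -> class_C k U (fun x => f x * g x).
Proof.
move=> oU; elim: k f g => [|k IH] f g /=.
  by move=> cf cg x Ux; exact: cvgM (cf x Ux) (cg x Ux).
move=> [df cf] [dg cg]; split=> [x Ux|i].
  by apply: differentiableM; [exact: df|exact: dg].
have cf0 : class_C k U f by apply: class_CW.
have cg0 : class_C k U g by apply: class_CW.
apply: class_C_eq (class_CD oU (IH _ _ cf0 (cg i)) (IH _ _ cg0 (cf i))) => // x Ux.
rewrite -[RHS]/('D_(basis_vec R i) (f * g) x) deriveM //.
  exact/diff_derivable/df.
exact/diff_derivable/dg.
Qed.

Lemma class_CN k U (f : 'rV[R]_m -> R) : open U ->
  class_C k U f -> class_C k U (fun x => - f x).
Proof.
move=> oU cf; apply: (@class_C_eq _ _ _ (fun x => -1 * f x)) => //.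
  by move=> x _; rewrite mulN1r.
by apply: class_CM => //; exact: class_C_cst.
Qed.

Lemma class_CB k U (f g : 'rV[R]_m -> R) : open U ->
  class_C k U f -> class_C k U g -> class_C k U (fun x => f x - g x).
Proof. by move=> oU cf cg; apply: class_CD => //; exact: class_CN. Qed.

Lemma class_C_sum (W : normedModType R) k U (I : Type) (r : seq I) (P : pred I)
    (f : I -> 'rV[R]_m -> W) : open U -> (forall i, P i -> class_C k U (f i)) ->
  class_C k U (fun x => \sum_(i <- r | P i) f i x).
Proof.
move=> oU cf; elim: r => [|i r IH].
  apply: class_C_eq (class_C_cst k U (0 : W)) => // x _; by rewrite big_nil.
have [Pi|nPi] := boolP (P i).
  apply: class_C_eq (class_CD oU (cf i Pi) IH) => // x _.
  by rewrite big_cons Pi.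
by apply: class_C_eq IH => // x _; rewrite big_cons (negbTE nPi).
Qed.

Lemma class_CZ (W : normedModType R) k U (c : R) (f : 'rV[R]_m -> W) : open U ->
  class_C k U f -> class_C k U (fun x => c *: f x).
Proof.
move=> oU; elim: k f => [|k IH] f /=.
  by move=> cf x Ux; exact: cvgZr (cf x Ux).
case=> df cf; split=> [x Ux|i]; first exact: differentiableZ (df x Ux).
apply: class_C_eq (IH _ (cf i)) => // x Ux.
by rewrite -[RHS]/('D_(basis_vec R i) (c \*: f) x) deriveZ //; exact/diff_derivable/df.
Qed.

Lemma class_C_prod k U (I : Type) (r : seq I) (P : pred I) (f : I -> 'rV[R]_m -> R) :
  open U -> (forall i, P i -> class_C k U (f i)) ->
  class_C k U (fun x => \prod_(i <- r | P i) f i x).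
Proof.
move=> oU cf; elim: r => [|i r IH].
  apply: class_C_eq (class_C_cst k U (1 : R)) => // x _; by rewrite big_nil.
have [Pi|nPi] := boolP (P i).
  apply: class_C_eq (class_CM oU (cf i Pi) IH) => // x _.
  by rewrite big_cons Pi.
by apply: class_C_eq IH => // x _; rewrite big_cons (negbTE nPi).
Qed.

Lemma class_CV k U (f : 'rV[R]_m -> R) : open U ->
  (forall x, U x -> f x != 0) -> class_C k U f ->
  class_C k U (fun x => (f x)^-1).
Proof.
move=> oU f0; elim: k => [|k IH] /=.
  by move=> cf x Ux; exact: cvgV (f0 x Ux) (cf x Ux).
move=> [df cf]; split=> [x Ux|i].
  by apply: differentiableV; [exact: df|exact: f0].
have iC : class_C k U (fun x => (f x)^-1) by apply/IH/class_CW.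
apply: class_C_eq (class_CN oU (class_CM oU (class_CM oU iC iC) (cf i))) => // x Ux.
rewrite -[RHS]/('D_(basis_vec R i) (fun y => (f y)^-1) x) deriveV; last 2 first.
- exact: f0.
- exact/diff_derivable/df.
by rewrite -expr2 exprVn -mulNr.
Qed.

Lemma derive_basis (W : normedModType R) (f : 'rV[R]_m -> W) x v :
  differentiable f x -> 'D_v f x = \sum_l v 0 l *: 'D_(basis_vec R l) f x.
Proof.
move=> df; rewrite deriveE // [X in 'd _ _ X]row_sum_delta linear_sum /=.
by apply: eq_bigr => l _; rewrite linearZ /= deriveE.
Qed.

Lemma class_C_entry p q k U (A : 'rV[R]_m -> 'M[R]_(p, q)) i j :
  open U -> class_C k U A -> class_C k U (fun x => A x i j).
Proof.
move=> oU; elim: k A => [|k IH] A /=.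
  move=> cA x Ux.
  exact: (@continuous_comp _ _ _ A (fun M : 'M[R]_(p, q) => M i j) x (cA x Ux)
           (@coord_continuous _ _ _ i j _)).
case=> dA cA; split=> [x Ux|l]; first exact/differentiable_entry/dA.
apply: class_C_eq (IH _ (cA l)) => // x Ux.
by rewrite derive_entry //; exact/diff_derivable/dA.
Qed.

Lemma class_C_derive (W : normedModType R) k U (f : 'rV[R]_m -> W) v : open U ->
  class_C k.+1 U f -> class_C k U ('D_v f).
Proof.
move=> oU [df cf].
have cs : class_C k U (fun x => \sum_l v 0 l *: 'D_(basis_vec R l) f x).
  by apply: class_C_sum => // l _; apply: class_CZ => //; exact: cf.
by apply: class_C_eq cs => // x Ux; rewrite derive_basis //; exact: df.
Qed.

End class_C.

Lemma derive_chain (U V W : normedModType R) (f : U -> V) (g : V -> W) x v :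
  differentiable f x -> differentiable g (f x) ->
  'D_v (g \o f) x = 'D_('D_v f x) g (f x).
Proof.
move=> df dg; rewrite deriveE; last exact: differentiable_comp.
by rewrite diff_comp // (deriveE _ df) (deriveE _ dg).
Qed.

(** By induction on k: the partial derivatives of the composite are, by the
    chain rule, sums of products of functions to which the induction hypothesis
    applies. *)
Lemma class_C_comp p q k (U : set 'rV[R]_p) (V : set 'rV[R]_q)
    (f : 'rV[R]_p -> 'rV[R]_q) (g : 'rV[R]_q -> R) :
  open U -> (forall x, U x -> V (f x)) ->
  class_C k U f -> class_C k V g -> class_C k U (fun x => g (f x)).
Proof.
move=> oU fUV; elim: k g => [|k IH] g.
  move=> cf cg x Ux; apply: (continuous_comp (cf x Ux)).
  exact: cg (fUV x Ux).
move=> cf [dg cg]; have [df cf'] := cf; split=> [x Ux|i].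
  exact: differentiable_comp (df x Ux) (dg _ (fUV x Ux)).
have cs : class_C k U (fun x => \sum_l ('D_(basis_vec R i) f x) 0 l *
    'D_(basis_vec R l) g (f x)).
  apply: class_C_sum => // l _; apply: class_CM => //.
    exact: (class_C_entry 0 l oU (cf' i)).
  apply: IH (cg l); exact: class_CW.
apply: class_C_eq cs => // x Ux.
have dfx := df x Ux; have dgx := dg _ (fUV x Ux).
transitivity ('D_('D_(basis_vec R i) f x) g (f x)); last by rewrite -derive_chain.
by rewrite [RHS]derive_basis.
Qed.

Lemma class_C_sqrt m k (U : set 'rV[R]_m) (f : 'rV[R]_m -> R) : open U ->
  (forall x, U x -> 0 < f x) -> class_C k U f ->
  class_C k U (fun x => Num.sqrt (f x)).
Proof.
move=> oU f0; elim: k => [|k IH] /=.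
  move=> cf x Ux; apply: (continuous_comp (cf x Ux)); exact: sqrt_continuous.
move=> [df cf].
have ds (y : R) : 0 < y -> differentiable (@Num.sqrt R) y.
  by move=> y0; apply/derivable1_diffP; case: (is_derive1_sqrt y0).
split=> [x Ux|i].
  exact: differentiable_comp (df x Ux) (ds _ (f0 x Ux)).
have sC : class_C k U (fun x => Num.sqrt (f x)) by apply/IH/class_CW.
have iC : class_C k U (fun x => (2 * Num.sqrt (f x))^-1).
  apply: class_CV => //.
    by move=> x Ux; rewrite mulf_neq0 ?pnatr_eq0 // gt_eqF // sqrtr_gt0 f0.
  by apply: class_CM => //; exact: (class_C_cst k U (2 : R)).
apply: class_C_eq (class_CM oU (cf i) iC) => // x Ux.
have dfx := df x Ux; have dsx := ds _ (f0 x Ux).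
transitivity ('D_('D_(basis_vec R i) f x) (@Num.sqrt R) (f x)); last first.
  by rewrite -derive_chain.
rewrite (deriveE _ dsx) -[X in 'd _ _ X]mulr1 -[X in 'd _ _ X]/(_ *: (1 : R)).
rewrite linearZ /= -deriveE //; congr (_ * _).
by case: (is_derive1_sqrt (f0 x Ux)) => _ ->.
Qed.

Lemma derivable_line (m : nat) (f : 'rV[R]_m -> R) y u s :
  differentiable f (y + s *: u) ->
  is_derive s 1 (fun t : R => f (y + t *: u)) ('D_u f (y + s *: u)).
Proof.
move=> /(@diff_derivable _ _ _ _ _ u) df.
have E : (fun h : R => h^-1 *: (f (y + (h *: (1 : R) + s) *: u) - f (y + s *: u)))
  = (fun h : R => h^-1 *: (f (h *: u + (y + s *: u)) - f (y + s *: u))).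
  apply/funext => h; congr (_ *: (f _ - _)).
  by rewrite scalerDl [h *: 1]mulr1 addrCA.
by split; rewrite /derivable /derive /= E.
Qed.

Lemma MVT_line (m : nat) (f : 'rV[R]_m -> R) y u (t : R) : 0 < t ->
  (forall s : R, 0 <= s <= t -> differentiable f (y + s *: u)) ->
  exists2 s, 0 < s < t & f (y + t *: u) - f y = t * 'D_u f (y + s *: u).
Proof.
move=> t0 df.
have dl s : 0 <= s <= t -> is_derive s 1 (fun t : R => f (y + t *: u)) ('D_u f (y + s *: u)).
  by move=> /df; exact: derivable_line.
have [s|| s /[!in_itv] /= st E] := MVT t0 (f := fun t : R => f (y + t *: u))
    (df := fun s => 'D_u f (y + s *: u)).
- by rewrite in_itv /= => /andP[s0 st]; apply: dl; rewrite !ltW.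
- apply: derivable_within_continuous => s; rewrite in_itv /= => st.
  by case: (dl s st).
by exists s => //; move: E; rewrite scale0r addr0 subr0 mulrC.
Qed.

(** The mean value theorem is used twice: along u for the difference
    s |-> f (x + t v + s u) - f (x + s u), then along v for the derivative. *)
Lemma second_difference (m : nat) (f : 'rV[R]_m -> R) x u v (t : R) : 0 < t ->
  (forall a b : R, 0 <= a <= t -> 0 <= b <= t ->
     differentiable f (x + a *: u + b *: v) /\
     differentiable ('D_u f) (x + a *: u + b *: v)) ->
  exists a b, [/\ 0 < a < t, 0 < b < t &
    f (x + t *: u + t *: v) - f (x + t *: u) - (f (x + t *: v) - f x) =
    t * (t * 'D_v ('D_u f) (x + a *: u + b *: v))].
Proof.
move=> t0 df.
pose phi s : R := f (x + t *: v + s *: u) - f (x + s *: u).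
have tt : 0 <= t <= t by rewrite lexx ltW.
have zt : 0 <= (0 : R) <= t by rewrite lexx ltW.
have dphi s : 0 <= s <= t -> is_derive s 1 phi
    ('D_u f (x + s *: u + t *: v) - 'D_u f (x + s *: u)).
  move=> st; rewrite [x + s *: u + _]addrAC.
  have h1 : differentiable f (x + t *: v + s *: u).
    by rewrite addrAC; case: (df s t st tt).
  have h2 : differentiable f (x + s *: u).
    by case: (df s 0 st zt); rewrite scale0r addr0.
  by apply: is_deriveB; exact: derivable_line.
have [s|| a /[!in_itv] /= at_ E] := MVT t0 (f := phi)
    (df := fun s => 'D_u f (x + s *: u + t *: v) - 'D_u f (x + s *: u)).
- by rewrite in_itv /= => /andP[s0 st]; apply: dphi; rewrite !ltW.
- apply: derivable_within_continuous => s; rewrite in_itv /= => st.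
  by case: (dphi s st).
have at' : 0 <= a <= t by case/andP: at_ => ? ?; rewrite !ltW.
have [|b bt E'] := @MVT_line m ('D_u f) (x + a *: u) v t t0.
  by move=> b bt; case: (df a b at' bt).
exists a, b; split=> //; rewrite -E' [RHS]mulrC.
move: E; rewrite /phi subr0 scale0r addr0 => <-.
by rewrite [x + t *: v + _]addrAC addr0.
Qed.

Lemma half_dist (A B C e : R) :
  `|B - C| <= e / 2 -> `|A - C| <= e / 2 -> `|A - B| <= e.
Proof.
move=> BC AC; rewrite [e]splitr -(subrKA C).
by apply: le_trans (ler_normD _ _) _; rewrite lerD // distrC.
Qed.

(** The second difference of f over a small parallelogram is symmetric in u and
    v.  It equals t^2 times each of the two mixed derivatives at some point of
    the parallelogram, and both are continuous at x. *)
Lemma schwarz_C2 (m : nat) (U : set 'rV[R]_m) (f : 'rV[R]_m -> R) x u v :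
  open U -> class_C 2 U f -> U x -> 'D_u ('D_v f) x = 'D_v ('D_u f) x.
Proof.
move=> oU cf Ux.
have df y : U y -> differentiable f y by case: cf => + _; apply.
have dD w y : U y -> differentiable ('D_w f) y.
  by have [+ _] := class_C_derive w oU cf; apply.
have cD w w' : {for x, continuous ('D_w' ('D_w f))}.
  exact: (class_C_derive w' oU (class_C_derive w oU cf)).
apply/eqP; rewrite -subr_eq0 -normr_le0; apply/ler_addgt0Pr => e e0; rewrite add0r.
have e2 : 0 < e / 2 by rewrite divr_gt0.
have nU : \near x, U x by apply: open_near oU Ux _.
have /cvgrPdist_le/(_ _ e2) n1 := cD u v.
have /cvgrPdist_le/(_ _ e2) n2 := cD v u.
have [r /= r0 nr] := (nbhs_ballP _ _).1 (filterI nU (filterI n1 n2)).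
pose N := `|u| + `|v| + 1.
have N0 : 0 < N by rewrite /N ltr_wpDl // addr_ge0.
pose t := r / (2 * N).
have t0 : 0 < t by rewrite divr_gt0 // mulr_gt0.
have near_x a b : 0 <= a <= t -> 0 <= b <= t -> ball x r (x + a *: u + b *: v).
  move=> /andP[a0 at_] /andP[b0 bt]; rewrite -ball_normE /= -addrA opprD addNKr normrN.
  apply: le_lt_trans (ler_normD _ _) _; rewrite !normrZ !ger0_norm //.
  apply: (@le_lt_trans _ _ (t * (`|u| + `|v|))).
    by rewrite mulrDr lerD // ler_wpM2r.
  apply: (@lt_le_trans _ _ (t * N)); first by rewrite ltr_pM2l // /N ltrDl.
  rewrite /t invfM mulrA -mulrA mulVf ?gt_eqF // mulr1.
  by rewrite ler_pdivrMr // ler_peMr ?ler1n // ltW.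
have dd w a b : 0 <= a <= t -> 0 <= b <= t ->
    differentiable f (x + a *: u + b *: v) /\
    differentiable ('D_w f) (x + a *: u + b *: v).
  by move=> at_ bt; have [Uy _] := nr _ (near_x a b at_ bt); split; [exact: df|exact: dD].
have [a [b [at_ bt E]]] := second_difference t0 (dd u).
have [b' [a' [bt' at' E']]] : exists b a, [/\ 0 < b < t, 0 < a < t &
    f (x + t *: v + t *: u) - f (x + t *: v) - (f (x + t *: u) - f x) =
    t * (t * 'D_u ('D_v f) (x + b *: v + a *: u))].
  apply: second_difference => // b1 a1 bt1 at1.
  by rewrite [x + b1 *: v + _]addrAC; exact: dd.
have W c : 0 < c < t -> 0 <= c <= t by case/andP=> *; rewrite !ltW.
have [_ [h1 _]] := nr _ (near_x a b (W _ at_) (W _ bt)).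
have [_ [_ h2]] := nr _ (near_x a' b' (W _ at') (W _ bt')).
have Eq : 'D_v ('D_u f) (x + a *: u + b *: v) = 'D_u ('D_v f) (x + a' *: u + b' *: v).
  have tn : t != 0 by rewrite gt_eqF.
  rewrite [x + a' *: u + _]addrAC.
  apply: (mulfI tn); apply: (mulfI tn); apply: etrans (esym E) _.
  apply: etrans E'; rewrite [x + t *: v + _]addrAC; ring.
rewrite -Eq in h2.
exact: half_dist h1 h2.
Qed.

Lemma schwarz_rV (m p : nat) (U : set 'rV[R]_m) (f : 'rV[R]_m -> 'rV[R]_p) x u v :
  open U -> class_C 2 U f -> U x -> 'D_u ('D_v f) x = 'D_v ('D_u f) x.
Proof.
move=> oU cf Ux; have [df _] := cf.
have dDx w w' : derivable ('D_w f) x w'.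
  by have [+ _] := class_C_derive w oU cf => /(_ x Ux)/diff_derivable; apply.
have E w w' j : ('D_w' ('D_w f) x) 0 j = 'D_w' ('D_w (fun y => f y 0 j)) x.
  rewrite -derive_entry //; apply: near_eq_derive; apply: open_near oU Ux _ => y Uy.
  by rewrite derive_entry //; exact/diff_derivable/df.
apply/rowP => j; apply: etrans (E v u j) _; apply: etrans (esym (E u v j)).
exact: (schwarz_C2 u v oU (class_C_entry 0 j oU cf) Ux).
Qed.

Section matrices.
Variable m : nat.
Implicit Types U : set 'rV[R]_m.

(** Entrywise, because composition and products are available for scalar
    functions. *)
Definition class_Cmx k U p q (A : 'rV[R]_m -> 'M[R]_(p, q)) : Prop :=
  forall i j, class_C k U (fun x => A x i j).

Lemma class_C_mx k U p q (A : 'rV[R]_m -> 'M[R]_(p, q)) :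
  open U -> class_C k U A -> class_Cmx k U A.
Proof. by move=> oU cA i j; exact: class_C_entry. Qed.

Lemma class_Cmx_mul k U p q r (A : 'rV[R]_m -> 'M[R]_(p, q))
    (B : 'rV[R]_m -> 'M[R]_(q, r)) : open U ->
  class_Cmx k U A -> class_Cmx k U B -> class_Cmx k U (fun x => A x *m B x).
Proof.
move=> oU cA cB i j.
apply: (@class_C_eq _ _ _ _ (fun x => \sum_l A x i l * B x l j)) => //.
  by move=> x _; rewrite mxE.
by apply: class_C_sum => // l _; exact: class_CM.
Qed.

Lemma class_Cmx_tr k U p q (A : 'rV[R]_m -> 'M[R]_(p, q)) : open U ->
  class_Cmx k U A -> class_Cmx k U (fun x => (A x)^T).
Proof.
by move=> oU cA i j; apply: class_C_eq (cA j i) => // x _; rewrite mxE.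
Qed.

Lemma class_C_det k U p (A : 'rV[R]_m -> 'M[R]_p) : open U ->
  class_Cmx k U A -> class_C k U (fun x => \det (A x)).
Proof.
move=> oU cA; rewrite /determinant.
apply: class_C_sum => // s _; apply: class_CM => //.
  exact: (class_C_cst k U ((-1) ^+ s : R)).
by apply: class_C_prod => // i _.
Qed.

Lemma class_Cmx_inv k U p (A : 'rV[R]_m -> 'M[R]_p) : open U ->
  (forall x, U x -> A x \in unitmx) ->
  class_Cmx k U A -> class_Cmx k U (fun x => invmx (A x)).
Proof.
move=> oU uA cA i j.
apply: (@class_C_eq _ _ _ _ (fun x => (\det (A x))^-1 * (\adj (A x)) i j)) => //.
  by move=> x Ux; rewrite /invmx (uA x Ux) [in RHS]mxE.
have dA : class_C k U (fun x => \det (A x)) by exact: class_C_det.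
apply: class_CM => //.
  apply: class_CV => // x Ux.
  by rewrite -unitfE -unitmxE uA.
apply: (@class_C_eq _ _ _ _ (fun x => (-1) ^+ (j + i) * \det (row' j (col' i (A x))))) => //.
  by move=> x Ux; rewrite mxE.
apply: class_CM => //; first exact: (class_C_cst k U ((-1) ^+ (j + i) : R)).
apply: class_C_det => // a b.
by apply: class_C_eq (cA (lift j a) (lift i b)) => // x _; rewrite !mxE.
Qed.

End matrices.

Section derive_matrix.
Variable V : normedModType R.

Lemma deriveMf (f g : V -> R) x v : derivable f x v -> derivable g x v ->
  'D_v (fun y => f y * g y) x = 'D_v f x * g x + f x * 'D_v g x.
Proof.
move=> df dg; apply: etrans (deriveM df dg) _.
by rewrite addrC; congr (_ + _); exact: mulrC.
Qed.

Lemma derivable_sumf (I : Type) (r : seq I) (f : I -> V -> R) x v :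
  (forall i, derivable (f i) x v) -> derivable (fun y => \sum_(i <- r) f i y) x v.
Proof.
move=> df; elim: r => [|i r IH].
  rewrite (_ : (fun y => _) = cst 0); first exact: derivable_cst.
  by apply/funext => y; rewrite big_nil.
rewrite (_ : (fun y => _) = (fun y => f i y + \sum_(i <- r) f i y)).
  exact: (derivableD (df i) IH).
by apply/funext => y; rewrite big_cons.
Qed.

Lemma derive_sumf (I : Type) (r : seq I) (f : I -> V -> R) x v :
  (forall i, derivable (f i) x v) ->
  'D_v (fun y => \sum_(i <- r) f i y) x = \sum_(i <- r) 'D_v (f i) x.
Proof.
move=> df; elim: r => [|i r IH].
  rewrite (_ : (fun y => _) = cst 0); first by rewrite big_nil derive_cst.
  by apply/funext => y; rewrite big_nil.
rewrite (_ : (fun y => _) = (fun y => f i y + \sum_(i <- r) f i y)).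
  transitivity ('D_v (f i + (fun y => \sum_(i <- r) f i y)) x); first by [].
  by rewrite (deriveD (df i) (derivable_sumf df)) big_cons IH.
by apply/funext => y; rewrite big_cons.
Qed.

Lemma derivable_mulmx p q r (A : V -> 'M[R]_(p, q)) (B : V -> 'M[R]_(q, r)) x v :
  derivable A x v -> derivable B x v -> derivable (fun y => A y *m B y) x v.
Proof.
move=> /derivable_mxP dA /derivable_mxP dB; apply/derivable_mxP => i j.
rewrite (_ : (fun y => _) = (fun y => \sum_l A y i l * B y l j)).
  by apply: derivable_sumf => l; exact: derivableM.
by apply/funext => y; rewrite mxE.
Qed.

Lemma derive_mulmx p q r (A : V -> 'M[R]_(p, q)) (B : V -> 'M[R]_(q, r)) x v :
  derivable A x v -> derivable B x v ->
  'D_v (fun y => A y *m B y) x = 'D_v A x *m B x + A x *m 'D_v B x.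
Proof.
move=> dA dB; have dAB := derivable_mulmx dA dB.
move/derivable_mxP: (dA) => dA'; move/derivable_mxP: (dB) => dB'.
rewrite derive_mx // (derive_mx dA) (derive_mx dB); apply/matrixP => i j.
rewrite !mxE (_ : (fun y => _) = (fun y => \sum_l A y i l * B y l j)); last first.
  by apply/funext => y; rewrite mxE.
rewrite derive_sumf => [|l]; last exact: derivableM.
rewrite -big_split /=; apply: eq_bigr => l _.
by rewrite deriveMf // !mxE.
Qed.

Lemma derivable_trmx p q (A : V -> 'M[R]_(p, q)) x v :
  derivable A x v -> derivable (fun y => (A y)^T) x v.
Proof.
move=> /derivable_mxP dA; apply/derivable_mxP => i j.
by rewrite (_ : (fun y => _) = (fun y => A y j i)) //; apply/funext => y; rewrite mxE.
Qed.

Lemma derive_trmx p q (A : V -> 'M[R]_(p, q)) x v :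
  derivable A x v -> 'D_v (fun y => (A y)^T) x = ('D_v A x)^T.
Proof.
move=> dA; rewrite derive_mx; last exact: derivable_trmx.
rewrite derive_mx //; apply/matrixP => i j; rewrite !mxE.
by congr ('D_v _ x); apply/funext => y; rewrite mxE.
Qed.

Lemma derive_prodf k (f : 'I_k -> V -> R) x v :
  (forall i, derivable (f i) x v) ->
  derivable (fun y => \prod_i f i y) x v /\
  'D_v (fun y => \prod_i f i y) x =
    \sum_i \prod_j (if j == i then 'D_v (f j) x else f j x).
Proof.
elim: k f => [|k IH] f df.
  rewrite (_ : (fun y => _) = cst 1); last by apply/funext => y; rewrite big_ord0.
  by rewrite derive_cst big_ord0; split=> //; exact: derivable_cst.
rewrite (_ : (fun y => _) = (fun y => f ord0 y * \prod_i f (lift ord0 i) y)); last first.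
  by apply/funext => y; rewrite big_ord_recl.
have [d1 d2] := IH (fun i => f (lift ord0 i)) (fun i => df _).
split; first exact: (derivableM (df ord0) d1).
rewrite (deriveMf (df ord0) d1) d2 big_ord_recl; congr (_ + _).
  by rewrite big_ord_recl eqxx.
rewrite mulr_sumr; apply: eq_bigr => i _; rewrite [RHS]big_ord_recl /=; congr (_ * _).
Qed.

(** Jacobi's formula: the product rule differentiates one row at a time, and
    expanding along the differentiated row produces the cofactors. *)
Lemma derive_det k (A : V -> 'M[R]_k) x v : derivable A x v ->
  derivable (fun y => \det (A y)) x v /\
  'D_v (fun y => \det (A y)) x = \tr (\adj (A x) *m 'D_v A x).
Proof.
move=> dA; have /derivable_mxP dA' := dA.
have dp (s : 'S_k) := derive_prodf (fun i => dA' i (s i)).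
have dt (s : 'S_k) : derivable (fun y => (-1) ^+ s * \prod_i A y i (s i)) x v.
  by apply: derivableM; [exact: derivable_cst|exact: (dp s).1].
split; first exact: derivable_sumf.
rewrite derive_sumf //.
pose B i := \matrix_(j, l) if j == i then 'D_v (fun y => A y j l) x else A x j l.
transitivity (\sum_i \det (B i)).
  rewrite /determinant exchange_big /=; apply: eq_bigr => s _.
  rewrite deriveMf; [|exact: derivable_cst|exact: (dp s).1].
  rewrite derive_cst mul0r add0r (dp s).2 mulr_sumr; apply: eq_bigr => i _.
  by congr (_ * _); apply: eq_bigr => j _; rewrite mxE.
rewrite mxtrace_mulC /mxtrace; apply: eq_bigr => i _.
rewrite (expand_det_row _ i) mxE; apply: eq_bigr => l _.
rewrite !mxE eqxx derive_entry // /cofactor; congr (_ * (_ * \det _)).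
by apply/matrixP => a b; rewrite !mxE eq_sym (negbTE (neq_lift _ _)).
Qed.

End derive_matrix.

Lemma posdef_unit k (G : 'M[R]_k) : posdef G -> G \in unitmx.
Proof.
move=> pG; rewrite -row_free_unit -kermx_eq0.
apply/negPn/negP => /rowV0Pn[v /sub_kermxP vG v0].
by have := pG v v0; rewrite /bil vG mul0mx mxE ltxx.
Qed.

(** The segment from the identity to G consists of positive definite, hence
    invertible, forms.  Along it the determinant is a polynomial without zeros
    that starts at 1. *)
Lemma posdef_det k (G : 'M[R]_k) : posdef G -> 0 < \det G.
Proof.
move=> pG.
pose P : {poly R} := \det (map_mx polyC (1%:M : 'M[R]_k) + 'X *: map_mx polyC (G - 1%:M)).
have PE t : P.[t] = \det (1%:M + t *: (G - 1%:M)).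
  rewrite -[LHS]/(horner_eval t P) -det_map_mx; congr (\det _).
  apply/matrixP => i j; rewrite !mxE /=.
  by rewrite /horner_eval hornerD hornerM hornerX !hornerC.
have pt t : 0 <= t <= 1 -> posdef (1%:M + t *: (G - 1%:M)).
  move=> /andP[t0 t1] v v0.
  have v2 : 0 < (v *m v^T) 0 0.
    rewrite mxE; have : 0 <= \sum_j v 0 j * v^T j 0.
      by apply: sumr_ge0 => j _; rewrite mxE -expr2 sqr_ge0.
    rewrite le_eqVlt => /orP[/eqP/esym|//] s0.
    case/negP: v0; apply/eqP/rowP => j; rewrite mxE.
    have /psumr_eq0P : forall j, true -> 0 <= v 0 j * v^T j 0.
      by move=> i _; rewrite mxE -expr2 sqr_ge0.
    move=> /(_ s0 j isT) /eqP; rewrite mxE mulf_eq0 => /orP[] /eqP //.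
  have -> : bil (1%:M + t *: (G - 1%:M)) v v = (1 - t) * (v *m v^T) 0 0 + t * bil G v v.
    rewrite /bil mulmxDr mulmx1 -scalemxAr mulmxBr mulmx1 mulmxDl -scalemxAl mulmxBl !mxE.
    by ring.
  have := pG v v0; move: t0; rewrite le_eqVlt => /orP[/eqP <-|t0] b0.
    by rewrite subr0 mul1r mul0r addr0.
  by apply: ltr_wpDl; [rewrite mulr_ge0 ?subr_ge0 // ltW|rewrite mulr_gt0].
rewrite ltNge; apply/negP => G0.
have [|t t01 /rootP] := @poly_ivt _ (- P) 0 1 ler01.
  by rewrite !hornerN !PE scale0r addr0 det1 scale1r addrC subrK oppr_le0 ler01 oppr_ge0.
rewrite hornerN PE => /eqP; rewrite oppr_eq0 => d0.
have := posdef_unit (pt t t01); rewrite unitmxE unitfE (eqP d0) eqxx //.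
Qed.

End calculus.

(** * Integration over a manifold through coordinate densities *)

Section iterated_integral.
Variable R : realType.
Local Open Scope ereal_scope.
Local Notation leb := (@lebesgue_measure R).

Import HBNNSimple.

(** The integral of a nonnegative function is a supremum over the simple
    functions below it, hence monotone whether or not the functions are
    measurable.  The inner integrals of an iterated integral are not known to
    be measurable, so this matters below. *)
Lemma ge0_le_integralT d (T : measurableType d) (mu : {measure set T -> \bar R})
    (f g : T -> \bar R) : (forall x, 0 <= f x) -> (forall x, f x <= g x) ->
  \int[mu]_x f x <= \int[mu]_x g x.
Proof.
move=> f0 fg; have g0 x : 0 <= g x by exact: le_trans (fg x).
rewrite !ge0_integralTE //; apply: le_ereal_sup => _ /= [h hf <-].
by exists h => // x; exact: le_trans (fg x).
Qed.

Lemma lebesgue_shift (c : R) (A : set (measurableTypeR R)) : measurable A ->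
  leb ((fun t => (t + c)%R) @^-1` A) = leb A.
Proof.
move=> mA; apply/esym.
have mf : measurable_fun [set: measurableTypeR R] (fun t : measurableTypeR R => (t + c)%R : measurableTypeR R).
  by apply: measurable_funD => //; exact: measurable_cst.
rewrite -[RHS]/(pushforward leb (fun t : measurableTypeR R => (t + c)%R : measurableTypeR R) A).
apply: (lebesgue_measure_unique (mu := measure_function_pushforward__canonical__measure_function_Measure leb mf)) mA => X /ocitvP[->|[[a b] /= ab ->]].
  by rewrite !measure0.
rewrite /= /pushforward (_ : _ @^-1` _ = `](a - c)%R, (b - c)%R]%classic); last first.
  by apply/seteqP; split=> t /=; rewrite !in_itv /= ltrBlDr lerBrDr.
rewrite !lebesgue_measure_itv /= !lte_fin ltrD2r ab -!EFinB; congr (_%:E).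
by rewrite opprB addrA subrK.
Qed.

(** Translating the simple functions below f gives the simple functions below
    its translate, and their integrals agree by [lebesgue_shift]. *)
Lemma integral_shift (c : R) (f : R -> \bar R) : (forall x, 0 <= f x) ->
  \int[leb]_(t in [set: R]) f (t + c)%R = \int[leb]_(t in [set: R]) f t.
Proof.
suff le (b : R) (g : R -> \bar R) : (forall x, 0 <= g x) ->
    \int[leb]_(t in [set: R]) g t <= \int[leb]_(t in [set: R]) g (t + b)%R.
  move=> f0; apply/eqP; rewrite eq_le le // andbT.
  have := le (- c)%R (fun t => f (t + c)%R) (fun t => f0 _).
  by under [X in _ <= X -> _]eq_integral do rewrite subrK.
move=> g0; rewrite [leLHS]ge0_integralTE //; apply: ge_ereal_sup => _ /= [h hg <-].
have mf : measurable_fun [set: measurableTypeR R] (fun t : measurableTypeR R => (t + b)%R : measurableTypeR R).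
  by apply: measurable_funD => //; exact: measurable_cst.
have <- : \int[leb]_(t in [set: R]) (h t)%:E = sintegral leb h by exact: integralT_nnsfun.
apply: (@le_trans _ _ (\int[leb]_(t in [set: R]) (h (t + b)%R)%:E)); last first.
  by apply: ge0_le_integralT => t; [rewrite lee_fin; exact: fun_ge0|exact: hg].
have mh : measurable_fun [set: measurableTypeR R] (EFin \o h) by exact/measurable_EFinP.
have h0 : {in [set: measurableTypeR R], forall y, 0 <= (EFin \o h) y}.
  by move=> t _ /=; rewrite lee_fin; exact: fun_ge0.
have := ge0_integral_pushforward mf leb measurableT mh h0.
rewrite preimage_setT /= => <-.
rewrite le_eqVlt; apply/orP; left; apply/eqP.
by apply: eq_measure_integral => X mX _; apply/esym; exact: lebesgue_shift.
Qed.

Lemma integral_rV_ge0 k (f : 'rV[R]_k -> \bar R) : (forall x, 0 <= f x) ->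
  0 <= integral_rV f.
Proof.
elim: k f => [|k IH] f f0 /=; first exact: f0.
by apply: integral_ge0 => t _; exact: IH.
Qed.

Lemma eq_integral_rV k (f g : 'rV[R]_k -> \bar R) : f =1 g ->
  integral_rV f = integral_rV g.
Proof. by move=> /funext ->. Qed.

Lemma row_mx_ord0 k (t : R) (v : 'rV[R]_k) :
  (row_mx (t%:M : 'rV_1) v : 'rV_k.+1) 0%R ord0 = t.
Proof.
rewrite mxE; case: (@fintype.splitP 1 k ord0) => j; last by [].
by move=> _; rewrite mxE !ord1.
Qed.

Lemma row_mx_lift k (t : R) (v : 'rV[R]_k) j :
  (row_mx (t%:M : 'rV_1) v : 'rV_k.+1) 0%R (lift ord0 j) = v 0%R j.
Proof.
rewrite mxE; case: (@fintype.splitP 1 k (lift ord0 j)) => i /=.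
  by rewrite /bump; case: i => -[].
by rewrite /bump leq0n => -[ji]; congr (v _ _); exact/val_inj.
Qed.

Lemma integral_rV_shift k (f : 'rV[R]_k -> \bar R) (b : 'I_k) (c : R) :
  (forall x, 0 <= f x) ->
  integral_rV (fun x => f (x + c *: basis_vec R b)%R) = integral_rV f.
Proof.
elim: k f b => [f []//|k IH] f b f0 /=.
case: (unliftP ord0 b) => [b' ->|->].
  apply: eq_integral => t _.
  rewrite -[RHS](IH _ b') //; apply: eq_integral_rV => v; congr f.
  apply/rowP => j; rewrite mxE [X in (_ + X)%R]mxE [X in (_ + _ * X)%R]mxE eqxx /=.
  case: (unliftP ord0 j) => [j' ->|->].
    by rewrite !row_mx_lift !mxE (inj_eq (@lift_inj _ _)).
  by rewrite !row_mx_ord0 (negbTE (neq_lift _ _)) mulr0 addr0.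
rewrite -[RHS](integral_shift c); last by move=> t; exact: integral_rV_ge0.
apply: eq_integral => t _; apply: eq_integral_rV => v; congr f.
apply/rowP => j; rewrite mxE [X in (_ + X)%R]mxE [X in (_ + _ * X)%R]mxE eqxx /=.
case: (unliftP ord0 j) => [j' ->|->]; last by rewrite !row_mx_ord0 eqxx mulr1.
by rewrite !row_mx_lift eq_sym (negbTE (neq_lift _ _)) mulr0 addr0.
Qed.

Lemma integral_rV0 k : integral_rV (fun _ : 'rV[R]_k => 0 : \bar R) = 0.
Proof.
elim: k => [|k IH] //=; under eq_integral do rewrite IH.
by rewrite integral0.
Qed.

(** The bound propagates through the iteration: at each stage the inner
    integral is at most a constant on [-r, r] and zero outside. *)
Lemma integral_rV_fin k (f : 'rV[R]_k -> \bar R) (C r : R) : (0 <= C)%R -> (0 <= r)%R ->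
  (forall x, 0 <= f x <= C%:E) -> (forall (x : 'rV[R]_k) (b : 'I_k), (r < `|x 0%R b|)%R -> f x = 0) ->
  integral_rV f <= (C * (2 * r) ^+ k)%:E.
Proof.
move=> C0 r0; elim: k f => [|k IH] f fC f0 /=.
  by rewrite expr0 mulr1; case/andP: (fC 0%R).
have fge0 x : 0 <= f x by case/andP: (fC x).
have C'0 : (0 <= C * (2 * r) ^+ k)%R by rewrite mulr_ge0 // exprn_ge0 // mulr_ge0.
apply: (@le_trans _ _ (\int[leb]_(t in [set: R]) ((C * (2 * r) ^+ k) * \1_(`[(- r)%R, r]%classic) t)%:E)).
  apply: ge0_le_integralT => t; first exact: integral_rV_ge0.
  rewrite indicE; have [tr|tr] := boolP (t \in `[(- r)%R, r]%classic).
    rewrite mulr1; apply: IH => [v|v b vr]; first exact: fC.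
    by apply: (f0 _ (lift ord0 b)); rewrite row_mx_lift.
  rewrite mulr0; have H v : f (row_mx (t%:M : 'rV_1) v) = 0.
    apply: (f0 _ ord0); rewrite row_mx_ord0.
    rewrite ltNge; apply/negP => rt; move/negP: tr; apply; apply/mem_set.
    by rewrite /= in_itv /= -ler_norml.
  by rewrite (eq_integral_rV H) integral_rV0.
under eq_integral do rewrite EFinM.
rewrite ge0_integralZl //=.
  2: by apply/measurable_EFinP; exact: measurable_indic.
rewrite integral_indic // setIT /= lebesgue_measure_itv /= lte_fin.
rewrite exprSr mulrA; case: ifP => _.
  by rewrite -EFinD -EFinM lee_fin opprK mulr_natl mulr2n.
by rewrite mule0 lee_fin mulr_ge0 // mulr_ge0.
Qed.

End iterated_integral.

Lemma compact_ball (R : realType) k (x0 : 'rV[R]_k) (r : R) :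
  compact [set x : 'rV[R]_k | `|x0 - x| <= r].
Proof.
apply: bounded_closed_compact; last exact: closed_closed_ball_.
exists (`|x0| + r); split; first exact: num_real.
move=> M ltM x /= xr; apply: le_trans (ltW ltM).
by rewrite -[x](subKr x0) (le_trans (ler_normB _ _)) // lerD2l.
Qed.

Section measure_on_manifold.
Variables (R : realType) (k : nat) (S : manifold R k).

Lemma continuous_borel_measurable (f : S -> R) : continuous f ->
  measurable_fun [set: borel S] (f : borel S -> R).
Proof.
move=> cf; apply: (measurability _ (RGenOpens.measurableE R)) => _ [_ [a [b ->] <-]].
rewrite setTI; apply: sub_sigma_algebra.
by move/continuousP: cf; apply; exact: interval_open.
Qed.

Variable mu : {measure set (borel S) -> \bar R}.
Variables (a : chart S) (D : set S) (rho : 'rV[R]_k -> R).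
Hypothesis oD : open D.
Hypothesis Da : D `<=` dom a.
Let U := coord a @` D.
Hypothesis crho : forall x, U x -> {for x, continuous rho}.
Hypothesis rho0 : forall x, U x -> 0 < rho x.
Hypothesis hmu : forall f : S -> R, continuous f -> (forall p, 0 <= f p) ->
  (forall p, ~ D p -> f p = 0) ->
  (\int[mu]_p (f p)%:E)%E =
  integral_rV ((fun x => (f (param a x) * rho x)%:E) \_ U).

(** A function of the coordinates, transported to the manifold and extended by
    zero outside the coordinate domain D. *)
Definition chart_ext (u : 'rV[R]_k -> R) : S -> R := (u \o coord a) \_ D.

Lemma chart_extE u p : D p -> chart_ext u p = u (coord a p).
Proof. by move=> Dp; rewrite /chart_ext patchE mem_set. Qed.

Lemma chart_ext0 u p : ~ D p -> chart_ext u p = 0.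
Proof. by move=> nDp; rewrite /chart_ext patchE memNset. Qed.

(** Continuity on D is clear; near a point outside D the extension vanishes,
    since the image of the compact K is closed in a Hausdorff space. *)
Lemma chart_ext_continuous (K : set 'rV[R]_k) (u : 'rV[R]_k -> R) : compact K -> K `<=` U ->
  (forall x, U x -> {for x, continuous u}) -> (forall x, ~ K x -> u x = 0) ->
  continuous (chart_ext u).
Proof.
move=> cK KU cu u0 p.
have [Dp|nDp] := pselect (D p).
  have nE : \near p, u (coord a p) = chart_ext u p.
    by apply: open_near oD Dp _ => q Dq; rewrite chart_extE.
  rewrite /continuous_at -(nbhs_singleton nE).
  apply: cvg_trans; first exact: near_eq_cvg nE.
  apply: (@continuous_comp _ _ _ (coord a) u); first exact/coord_cont/Da.
  by apply: cu; exists p.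
have KS : closed (param a @` K).
  apply: compact_closed; first exact: manifold_hausdorff.
  apply: continuous_compact => //.
  apply: continuous_in_subspaceT => x /set_mem /KU [q Dq <-].
  by apply: param_cont; exists q => //; exact: Da.
have oKS := closed_openC KS.
have nE : \near p, 0 = chart_ext u p.
  apply: (open_near oKS) => [[x Kx xp]|q nKq].
    have [q Dq qx] := KU _ Kx; apply: nDp; rewrite -xp -qx coordK //; exact: Da.
  have [Dq|/chart_ext0 -> //] := pselect (D q).
  rewrite chart_extE // u0 // => Kq; apply: nKq; exists (coord a q) => //.
  exact/coordK/Da.
rewrite /continuous_at -(nbhs_singleton nE).
apply: cvg_trans; first exact: near_eq_cvg nE.
exact: cvg_cst.
Qed.

Lemma integral_chart_ext (K : set 'rV[R]_k) (u : 'rV[R]_k -> R) : compact K -> K `<=` U ->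
  (forall x, U x -> {for x, continuous u}) -> (forall x, ~ K x -> u x = 0) ->
  (forall x, 0 <= u x) ->
  (\int[mu]_p (chart_ext u p)%:E)%E = integral_rV (fun x => (u x * rho x)%:E).
Proof.
move=> cK KU cu u0 uge0; rewrite hmu.
- apply: eq_integral_rV => x; rewrite patchE.
  case: ifPn => [/set_mem [p Dp <-]|/negP nUx].
    by rewrite coordK ?chart_extE //; exact: Da.
  by rewrite u0 ?mul0r // => /KU Ux; apply: nUx; exact: mem_set.
- exact: chart_ext_continuous cK KU cu u0.
- move=> p; have [Dp|/chart_ext0 -> //] := pselect (D p).
  by rewrite chart_extE.
- by move=> p; exact: chart_ext0.
Qed.

Lemma bounded_on_compact (T : topologicalType) (W : normedModType R) (K : set T) (f : T -> W) :
  compact K -> (forall x, K x -> {for x, continuous f}) ->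
  exists2 M : R, 0 <= M & forall x, K x -> `|f x| <= M.
Proof.
move=> cK cf.
have : compact (f @` K).
  by apply: continuous_compact => //; apply: continuous_in_subspaceT => x /set_mem /cf.
move=> /compact_bounded[M [_ HM]]; exists (`|M| + 1); first exact: addr_ge0.
move=> x Kx; apply: (HM (`|M| + 1)); last by exists x.
by rewrite (le_lt_trans (ler_norm M)) // ltrDl.
Qed.

Lemma entry_le_norm (x : 'rV[R]_k) b : `|x 0 b| <= `|x|.
Proof. by rewrite [leRHS]/Num.norm /= mx_normrE; exact: (le_bigmax _ _ (0, b)). Qed.

Lemma integral_chart_ext_fin (K : set 'rV[R]_k) (u : 'rV[R]_k -> R) :
  compact K -> K `<=` U ->
  (forall x, U x -> {for x, continuous u}) -> (forall x, ~ K x -> u x = 0) ->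
  (forall x, 0 <= u x) -> (\int[mu]_p (chart_ext u p)%:E < +oo)%E.
Proof.
move=> cK KU cu u0 uge0; rewrite (integral_chart_ext cK KU cu u0 uge0).
have [M M0 HM] : exists2 M : R, 0 <= M & forall x, K x -> `|u x * rho x| <= M.
  apply: bounded_on_compact => // x /KU Ux.
  exact: cvgM (cu x Ux) (crho Ux).
have [N N0 HN] : exists2 N : R, 0 <= N & forall x, K x -> `|x| <= N.
  by apply: (bounded_on_compact (f := id)) => // x _; exact: cvg_id.
apply: le_lt_trans (ltry (M * (2 * N) ^+ k)).
apply: integral_rV_fin => // [x|x b xN].
  have [Kx|nKx] := pselect (K x); last by rewrite u0 // mul0r !lee_fin lexx M0.
  rewrite !lee_fin mulr_ge0 //=; last exact/ltW/rho0/KU.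
  by apply: le_trans (HM x Kx); exact: ler_norm.
rewrite u0 ?mul0r // => Kx; move: xN; apply/negP; rewrite -leNgt.
by apply: le_trans (HN x Kx); exact: entry_le_norm.
Qed.

Hypothesis cS : compact [set: S].
Hypothesis muS : (mu setT < +oo)%E.

Lemma continuous_integrable (f : S -> R) : continuous f ->
  mu.-integrable setT (EFin \o (f : borel S -> R)).
Proof.
move=> cf; apply: measurable_bounded_integrable => //.
  exact: continuous_borel_measurable.
have [M M0 HM] := bounded_on_compact cS (fun x _ => cf x).
exists M; split; first exact: num_real.
by move=> x Mx p _; apply: le_trans (HM p I) _; exact: ltW.
Qed.

Variables (x0 : 'rV[R]_k) (r : R).
Hypothesis r0 : 0 < r.
Hypothesis ballU : forall x, `|x0 - x| <= 2 * r -> U x.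
Let K2 := [set x : 'rV[R]_k | `|x0 - x| <= 2 * r].

Let K2_compact : compact K2. Proof. exact: compact_ball. Qed.

Let K2U : K2 `<=` U.
Proof. by move=> x; exact: ballU. Qed.

Section weighted.
Variable u : 'rV[R]_k -> R.
Hypothesis cu : continuous u.
Hypothesis u0 : forall x, ~ K2 x -> u x = 0.

Let cur x : U x -> {for x, continuous (fun x => u x / rho x)}.
Proof.
have cx : {for x, continuous u} := @cu x.
by move=> Ux; apply: cvgM cx _; apply: cvgV (crho Ux); rewrite gt_eqF // rho0.
Qed.

Let ur0 x : ~ K2 x -> u x / rho x = 0.
Proof. by move=> /u0 ->; rewrite mul0r. Qed.

Lemma weighted_continuous : continuous (chart_ext (fun x => u x / rho x)).
Proof. exact: chart_ext_continuous K2_compact K2U cur ur0. Qed.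

Lemma weighted_integrable :
  mu.-integrable setT (EFin \o (chart_ext (fun x => u x / rho x) : borel S -> R)).
Proof. exact: continuous_integrable weighted_continuous. Qed.

Lemma integral_weighted : (forall x, 0 <= u x) ->
  (\int[mu]_p (chart_ext (fun x => u x / rho x) p)%:E)%E = integral_rV (EFin \o u).
Proof.
move=> uge0; rewrite (integral_chart_ext K2_compact K2U cur ur0).
  apply: eq_integral_rV => x /=; have [Kx|nKx] := pselect (K2 x); last by rewrite u0 // !mul0r.
  by rewrite divfK // gt_eqF // rho0 //; exact: K2U.
move=> x; have [Kx|nKx] := pselect (K2 x); last by rewrite u0 // mul0r.
by rewrite divr_ge0 //; exact/ltW/rho0/K2U.
Qed.

End weighted.

Section translation.
Variables (b : 'I_k) (t : R).
Hypothesis tr : 0 <= t <= r.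
Local Notation e := (basis_vec R b).

Lemma norm_basis : `|e| <= 1.
Proof.
rewrite [leLHS]/Num.norm /= mx_normrE; apply: bigmax_le => // -[i j] _ /=.
by rewrite mxE; case: (_ && _); rewrite ?normr1 // normr0.
Qed.

Lemma shift_far x : 2 * r < `|x0 - x| -> r < `|x0 - (x + t *: e)|.
Proof.
move=> xr; have /andP[t0 t_r] := tr.
rewrite opprD addrA ltNge; apply/negP => le1.
move: xr; apply/negP; rewrite -leNgt -(subrK (t *: e) (x0 - x)) mulr_natl mulr2n.
apply: le_trans (ler_normD _ _) _; apply: lerD => //.
rewrite normrZ ger0_norm //; apply: le_trans t_r.
by rewrite ler_piMr // norm_basis.
Qed.

Variable u : 'rV[R]_k -> R.
Hypothesis cu : continuous u.
Hypothesis u0 : forall x, r < `|x0 - x| -> u x = 0.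

Lemma far0 x : ~ K2 x -> u x = 0.
Proof.
move=> /negP; rewrite -ltNge => x2; apply: u0; apply: lt_trans x2.
by rewrite ltr_pMl // ltr1n.
Qed.

Lemma far0_shift x : ~ K2 x -> u (x + t *: e) = 0.
Proof. by move=> /negP; rewrite -ltNge => x2; apply/u0/shift_far. Qed.

Lemma continuous_translate : continuous (fun x : 'rV[R]_k => u (x + t *: e)).
Proof.
move=> x.
have cs : {for x, continuous (fun y : 'rV[R]_k => y + t *: e)}.
  exact: (cvgD (@cvg_id _ _) (cvg_cst _)).
exact: (continuous_comp cs (@cu _)).
Qed.

Lemma integral_translate_ge0 : (forall x, 0 <= u x) ->
  \int[mu]_p chart_ext (fun x => u (x + t *: e) / rho x) p =
  \int[mu]_p chart_ext (fun x => u x / rho x) p.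
Proof.
move=> uge0; congr fine.
rewrite (integral_weighted continuous_translate far0_shift) // (integral_weighted cu far0) //.
by rewrite -[RHS](integral_rV_shift b t) //= => x; rewrite lee_fin.
Qed.

End translation.

Lemma chart_ext_lin (f g h : 'rV[R]_k -> R) (c : R) p :
  (forall x, f x = c * (g x - h x)) ->
  chart_ext f p = c * (chart_ext g p - chart_ext h p).
Proof.
move=> E; have [Dp|nDp] := pselect (D p); first by rewrite !chart_extE.
by rewrite !chart_ext0 // subrr mulr0.
Qed.

(** Reduces to nonnegative functions, where the integral is an iterated
    Lebesgue integral, by splitting into positive and negative parts. *)
Lemma integral_translate (b : 'I_k) (t : R) (u : 'rV[R]_k -> R) : 0 <= t <= r ->
  continuous u -> (forall x, r < `|x0 - x| -> u x = 0) ->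
  \int[mu]_p chart_ext (fun x => u (x + t *: basis_vec R b) / rho x) p =
  \int[mu]_p chart_ext (fun x => u x / rho x) p.
Proof.
move=> tr cu u0.
have split_int (v : 'rV[R]_k -> R) : continuous v -> (forall x, ~ K2 x -> v x = 0) ->
    \int[mu]_p chart_ext (fun x => v x / rho x) p =
    \int[mu]_p chart_ext (fun x => (2^-1 * (`|v x| + v x)) / rho x) p -
    \int[mu]_p chart_ext (fun x => (2^-1 * (`|v x| - v x)) / rho x) p.
  move=> cv v0.
  have c1 : continuous (fun x => 2^-1 * (`|v x| + v x)).
    by move=> x; exact: (cvgM (cvg_cst _) (cvgD (cvg_norm (@cv x)) (@cv x))).
  have c2 : continuous (fun x => 2^-1 * (`|v x| - v x)).
    by move=> x; exact: (cvgM (cvg_cst _) (cvgB (cvg_norm (@cv x)) (@cv x))).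
  rewrite -RintegralB //; last 2 first.
  - by apply: (weighted_integrable c1) => x /v0 ->; rewrite normr0 addr0 mulr0.
  - by apply: (weighted_integrable c2) => x /v0 ->; rewrite normr0 subr0 mulr0.
  apply: eq_Rintegral => p _.
  rewrite -[RHS]mul1r; apply: chart_ext_lin => x; rewrite mul1r -mulrBl -mulrBr.
  by congr (_ / _); field.
rewrite (split_int _ (continuous_translate cu) (far0_shift b tr u0)) (split_int _ cu (far0 u0)).
congr (_ - _).
- apply: (@integral_translate_ge0 b t tr (fun x => 2^-1 * (`|u x| + u x))) => //.
  + by move=> x; exact: (cvgM (cvg_cst _) (cvgD (cvg_norm (@cu x)) (@cu x))).
  + by move=> x /u0 ->; rewrite normr0 addr0 mulr0.
  by move=> x; rewrite mulr_ge0 // -lerBlDr sub0r -normrN ler_norm.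
- apply: (@integral_translate_ge0 b t tr (fun x => 2^-1 * (`|u x| - u x))) => //.
  + by move=> x; exact: (cvgM (cvg_cst _) (cvgB (cvg_norm (@cu x)) (@cu x))).
  + by move=> x /u0 ->; rewrite normr0 subr0 mulr0.
  by move=> x; rewrite mulr_ge0 // subr_ge0 ler_norm.
Qed.

Lemma derive_far0 (w : 'rV[R]_k -> R) v : (forall x, r < `|x0 - x| -> w x = 0) ->
  forall x, r < `|x0 - x| -> 'D_v w x = 0.
Proof.
move=> w0 x xr; rewrite (near_eq_derive (g := cst 0)) ?derive_cst //.
have oF : open (~` [set x : 'rV[R]_k | `|x0 - x| <= r]).
  exact/closed_openC/closed_closed_ball_.
apply: (open_near oF) => [|y /negP]; first by apply/negP; rewrite -ltNge.
by rewrite -ltNge => /w0.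
Qed.

(** The difference quotients of w along the b-th axis integrate to zero by
    translation invariance.  By the mean value theorem they are bounded by the
    maximum of the derivative, so dominated convergence applies. *)
Lemma integral_derive0 (w : 'rV[R]_k -> R) (b : 'I_k) : class_C 1 [set: 'rV[R]_k] w ->
  (forall x, r < `|x0 - x| -> w x = 0) ->
  \int[mu]_p chart_ext (fun x => 'D_(basis_vec R b) w x / rho x) p = 0.
Proof.
move=> [dw cdw] w0; set e := basis_vec R b.
have cw : continuous w by move=> x; exact: differentiable_continuous (dw x I).
have cD : continuous ('D_e w) by move=> x; exact: (cdw b x I).
have D0 := derive_far0 e w0.
(* The steps stay below r, so the translates of w keep their support in the
   ball of radius 2 r, which lies in the coordinate domain. *)
pose t (n : nat) : R := r * harmonic n.
have t0 n : 0 < t n by rewrite mulr_gt0 // /harmonic invr_gt0 ltr0n.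
have t_r n : 0 <= t n <= r.
  rewrite (ltW (t0 n)) /= ler_piMr //; first exact: ltW.
  by rewrite /harmonic invf_le1 ?ltr0n // ler1n.
pose q n x : R := (t n)^-1 * (w (x + t n *: e) - w x).
have cq n : continuous (q n).
  have ct := continuous_translate (t := t n) (b := b) cw.
  by move=> x; exact: (cvgM (cvg_cst _) (cvgB (@ct x) (@cw x))).
have q0 n x : ~ K2 x -> q n x = 0.
  by move=> nKx; rewrite /q (far0 w0 nKx) (far0_shift b (t_r n) w0 nKx) subrr mulr0.
have cf n := weighted_continuous (cq n) (q0 n).
have If n := weighted_integrable (cq n) (q0 n).
have int0 n : \int[mu]_p chart_ext (fun x => q n x / rho x) p = 0.
  pose u1 (x : 'rV[R]_k) := w (x + t n *: e) / rho x; pose u2 x := w x / rho x.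
  have I1 := weighted_integrable (continuous_translate (t := t n) (b := b) cw) (far0_shift b (t_r n) w0).
  have I2 := weighted_integrable cw (far0 w0).
  transitivity (\int[mu]_p ((t n)^-1 * (chart_ext u1 p - chart_ext u2 p))).
    apply: eq_Rintegral => p _; apply: chart_ext_lin => x.
    by rewrite /q /u1 /u2 -mulrBl mulrA.
  rewrite RintegralZl //; last exact: (integrableB measurableT I1 I2).
  by rewrite RintegralB // (integral_translate b (t_r n) cw w0) subrr mulr0.
have [M M0 HM] : exists2 M : R, 0 <= M & forall x, `|'D_e w x| <= M.
  have [M M0 HM] := bounded_on_compact K2_compact (fun x _ => @cD x).
  exists M => // x; have [/HM //|nKx] := pselect (K2 x).
  by rewrite (far0 D0 nKx) normr0.
have [N N0 HN] : exists2 N : R, 0 <= N & forall x, K2 x -> `|(rho x)^-1| <= N.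
  apply: (bounded_on_compact K2_compact) => x /K2U Ux.
  by apply: cvgV (crho Ux); rewrite gt_eqF // rho0.
have qM n x : `|q n x| <= M.
  have [s st E] : exists2 s, 0 < s < t n & w (x + t n *: e) - w x = t n * 'D_e w (x + s *: e).
    by apply: MVT_line => // s _; exact: dw.
  by rewrite /q E mulrA mulVf ?mul1r // gt_eqF.
have fM n p : `|chart_ext (fun x => q n x / rho x) p| <= M * N.
  have [Dp|nDp] := pselect (D p); last by rewrite chart_ext0 // normr0 mulr_ge0.
  rewrite chart_extE //; have [Kx|nKx] := pselect (K2 (coord a p)).
    by rewrite normrM ler_pM // HN.
  by rewrite q0 // mul0r normr0 mulr_ge0.
have fcvg p : chart_ext (fun x => q n x / rho x) p @[n --> \oo] -->
    chart_ext (fun x => 'D_e w x / rho x) p.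
  have [Dp|nDp] := pselect (D p); last first.
    rewrite chart_ext0 //; under eq_fun do rewrite chart_ext0 //.
    exact: cvg_cst.
  rewrite chart_extE //; under eq_fun do rewrite chart_extE //.
  set x := coord a p; apply: cvgMl.
  have dwx : (fun h : R => h^-1 * (w (x + h *: e) - w x)) h @[h --> 0^'] --> 'D_e w x.
    under eq_fun do rewrite [x + _]addrC.
    exact: diff_derivable (dw x I).
  apply: ((cvgr_dnbhsP _ _ _).1 dwx t).
  split; first by move=> n; rewrite gt_eqF.
  rewrite -(mulr0 r); apply: cvgMr; exact: cvg_harmonic.
have cl := weighted_continuous cD (far0 D0).
have [|||||_ _ lim] := @dominated_convergence _ (borel S) R mu setT measurableT
    (fun n p => (chart_ext (fun x => q n x / rho x) p)%:E)
    (fun p => (chart_ext (fun x => 'D_e w x / rho x) p)%:E)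
    (fun=> (M * N)%:E).
- by move=> n; apply/measurable_EFinP; exact: continuous_borel_measurable.
- by apply/measurable_EFinP; exact: continuous_borel_measurable.
- by apply: aeW => p _; apply: cvg_EFin; [exact: nearW|exact: fcvg].
- apply: (@continuous_integrable (fun=> M * N)) => p; exact: cvg_cst.
- by apply: aeW => p n _; rewrite lee_fin.
have int0e n : (\int[mu]_p (chart_ext (fun x => q n x / rho x) p)%:E = 0)%E.
  have /fineK <- := integrable_fin_num measurableT (If n).
  by congr EFin; exact: int0.
rewrite /Rintegral -[RHS]/(fine 0%E); congr fine; apply: cvg_unique lim _ => //.
by rewrite (_ : [sequence _]_n = cst 0%E); [exact: cvg_cst|apply/funext => n; exact: int0e].
Qed.


End measure_on_manifold.

(** * The connection under a change of coordinates *)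

Local Opaque derive jacobian.

Section covariant.
Variable R : realType.

Section bilinear.
Variable m : nat.
Implicit Types (A B : 'M[R]_m) (u v w : 'rV[R]_m).

Lemma bilDm A B u v : bil (A + B) u v = bil A u v + bil B u v.
Proof. by rewrite /bil mulmxDr mulmxDl mxE. Qed.
Lemma bilDl A u v w : bil A (u + v) w = bil A u w + bil A v w.
Proof. by rewrite /bil !mulmxDl mxE. Qed.
Lemma bilDr A u v w : bil A w (u + v) = bil A w u + bil A w v.
Proof. by rewrite /bil linearD /= mulmxDr mxE. Qed.
Lemma bilNl A u v : bil A (- u) v = - bil A u v.
Proof. by rewrite /bil !mulNmx mxE. Qed.
Lemma bilZl A c u v : bil A (c *: u) v = c * bil A u v.
Proof. by rewrite /bil -!scalemxAl mxE. Qed.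
Lemma bilZr A c u v : bil A u (c *: v) = c * bil A u v.
Proof. by rewrite /bil linearZ /= -scalemxAr mxE. Qed.
Lemma bil0l A v : bil A 0 v = 0.
Proof. by rewrite /bil !mul0mx mxE. Qed.
Lemma bil0r A v : bil A v 0 = 0.
Proof. by rewrite /bil trmx0 mulmx0 mxE. Qed.
Lemma bil_suml A (I : Type) (r : seq I) (f : I -> 'rV[R]_m) v :
  bil A (\sum_(i <- r) f i) v = \sum_(i <- r) bil A (f i) v.
Proof.
elim: r => [|i r IH]; first by rewrite !big_nil bil0l.
by rewrite !big_cons bilDl IH.
Qed.
Lemma bil_sumr A (I : Type) (r : seq I) (f : I -> 'rV[R]_m) v :
  bil A v (\sum_(i <- r) f i) = \sum_(i <- r) bil A v (f i).
Proof.
elim: r => [|i r IH]; first by rewrite !big_nil bil0r.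
by rewrite !big_cons bilDr IH.
Qed.

Lemma bil_pull A p (J : 'M[R]_(p, m)) (u v : 'rV[R]_p) :
  bil (J *m A *m J^T) u v = bil A (u *m J) (v *m J).
Proof. by rewrite /bil trmx_mul !mulmxA. Qed.

Lemma gram_entry A p (E : 'M[R]_(p, m)) b c :
  (E *m A *m E^T) b c = bil A (row b E) (row c E).
Proof. by rewrite !rowE -bil_pull /bil trmx_delta -rowE -colE !mxE. Qed.

Lemma bil_skew A u v : A^T = - A -> bil A u v = - bil A v u.
Proof.
move=> sA; rewrite !bilE exchange_big /= -sumrN; apply: eq_bigr => k _.
rewrite -sumrN; apply: eq_bigr => j _.
have -> : A j k = - A k j by move/matrixP/(_ k j): sA; rewrite !mxE.
by rewrite !mulNr mulrAC.
Qed.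

Lemma bil_nondeg A u : A \in unitmx -> (forall v, bil A u v = 0) -> u = 0.
Proof.
move=> uA u0; rewrite -[u](mulmxK uA); suff -> : u *m A = 0 by rewrite mul0mx.
apply/rowP => j; have := u0 (delta_mx 0 j).
by rewrite /bil trmx_delta -colE !mxE => ->.
Qed.

Lemma derive_bil (V : normedModType R) (A : V -> 'M[R]_m) (w1 w2 : V -> 'rV[R]_m) x e :
  derivable A x e -> derivable w1 x e -> derivable w2 x e ->
  'D_e (fun y => bil (A y) (w1 y) (w2 y)) x =
  bil ('D_e A x) (w1 x) (w2 x) + bil (A x) ('D_e w1 x) (w2 x)
  + bil (A x) (w1 x) ('D_e w2 x).
Proof.
move=> dA d1 d2; have d1A := derivable_mulmx d1 dA; have d2T := derivable_trmx d2.
rewrite [LHS](derive_entry _ _ (derivable_mulmx d1A d2T)) (derive_mulmx d1A d2T).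
rewrite (derive_mulmx d1 dA) (derive_trmx d2) /bil mulmxDl !mxE.
by congr (_ + _); rewrite addrC.
Qed.

(** Uniqueness of the Levi-Civita connection.  The difference of two symmetric
    metric connections, seen as a trilinear form d, is symmetric in its first two
    arguments and skew in its last two; six alternating swaps give d = - d. *)
Lemma koszul A (c c' : 'rV[R]_m -> 'rV[R]_m -> 'rV[R]_m)
    (D : 'rV[R]_m -> 'rV[R]_m -> 'rV[R]_m -> R) u v :
  A^T = A -> A \in unitmx ->
  (forall u v, c u v = c v u) -> (forall u v, c' u v = c' v u) ->
  (forall u v w, D u v w = bil A (c u v) w + bil A v (c u w)) ->
  (forall u v w, D u v w = bil A (c' u v) w + bil A v (c' u w)) ->
  c u v = c' u v.
Proof.
move=> sA uA sc sc' mc mc'; apply/eqP; rewrite -subr_eq0; apply/eqP.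
pose d u v w := bil A (c u v - c' u v) w.
have ds x y z : d x y z = d y x z by rewrite /d sc sc'.
have da x y z : d x y z = - d x z y.
  have := mc x y z; rewrite mc' (bil_sym y _ sA) (bil_sym y _ sA).
  by rewrite /d !bilDl !bilNl => H; lra.
apply: bil_nondeg uA _ => w; rewrite -/(d u v w).
have : d u v w = - d u v w.
  by rewrite {1}da ds da ds da ds !opprK.
by move=> H; lra.
Qed.

End bilinear.

Section nabla.
Variables (a m : nat) (G : 'rV[R]_m -> 'M[R]_m).

(** The covariant derivative in the direction u of a field w along the map
    phi. *)
Definition cov (phi w : 'rV[R]_a -> 'rV[R]_m) (u x : 'rV[R]_a) : 'rV[R]_m :=
  'D_u w x + gamma G (phi x) ('D_u phi x) (w x).

Lemma covE phi w u x :
  cov phi w u x = 'D_u w x + gamma G (phi x) ('D_u phi x) (w x).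
Proof. by []. Qed.

(** This is the product rule of the covariant derivative for the pairing
    A(w1, w2); the connection terms added to and subtracted from the ordinary
    product rule cancel. *)
Lemma derive_bil_along (A : 'rV[R]_m -> 'M[R]_m) (phi w1 w2 : 'rV[R]_a -> 'rV[R]_m) u x :
  differentiable A (phi x) -> differentiable phi x ->
  derivable w1 x u -> derivable w2 x u ->
  'D_u (fun y => bil (A (phi y)) (w1 y) (w2 y)) x =
  nabla G A (phi x) ('D_u phi x) (w1 x) (w2 x)
  + bil (A (phi x)) (cov phi w1 u x) (w2 x) + bil (A (phi x)) (w1 x) (cov phi w2 u x).
Proof.
move=> dA dphi d1 d2.
have dAp : derivable (A \o phi) x u.
  exact/diff_derivable/differentiable_comp.
rewrite (derive_bil dAp d1 d2) (derive_chain u dphi dA) /nabla /cov bilDl bilDr /=.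
by ring.
Qed.

Lemma metric_bil y X Y Z : differentiable G y -> (\near y, (G y)^T = G y) ->
  G y \in unitmx ->
  bil ('D_X G y) Y Z = bil (G y) (gamma G y X Y) Z + bil (G y) Y (gamma G y X Z).
Proof.
move=> dG sG uG; have := nabla_metric X Y Z dG sG uG.
by rewrite /nabla => /eqP; rewrite -addrA -opprD subr_eq0 => /eqP.
Qed.

End nabla.

Section change.
Variables (m : nat) (O : set 'rV[R]_m) (tau : 'rV[R]_m -> 'rV[R]_m).
Variables (G1 G2 : 'rV[R]_m -> 'M[R]_m) (y : 'rV[R]_m).
Hypothesis oO : open O.
Hypothesis Oy : O y.
Hypothesis ctau : class_C 2 O tau.
Hypothesis tG : forall z, O z -> G1 z = 'J tau z *m G2 (tau z) *m ('J tau z)^T.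
Hypothesis sG1 : \near y, (G1 y)^T = G1 y.
Hypothesis sG2 : \forall z \near tau y, (G2 z)^T = G2 z.
Hypothesis uG1 : G1 y \in unitmx.
Hypothesis uG2 : G2 (tau y) \in unitmx.
Hypothesis dG1 : differentiable G1 y.
Hypothesis dG2 : differentiable G2 (tau y).

Let J := 'J tau y.

Let dtau z : O z -> differentiable tau z.
Proof. by case: ctau => + _; apply. Qed.

Let dDtau v u : derivable ('D_v tau) y u.
Proof. by have [+ _] := class_C_derive v oO ctau => /(_ y Oy)/diff_derivable; apply. Qed.

Let JE z v : O z -> v *m 'J tau z = 'D_v tau z.
Proof. by move=> Oz; rewrite deriveEjacobian //; exact: dtau. Qed.

Let uJ : J \in unitmx.
Proof.
by move: uG1; rewrite (tG Oy) !unitmx_mul => /andP[/andP[]].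
Qed.

(** Obtained by differentiating A1(Y, Z) = A2(d tau Y, d tau Z) for constant
    fields Y, Z. *)
Lemma bil_change (A1 A2 : 'rV[R]_m -> 'M[R]_m) X Y Z :
  (forall z, O z -> A1 z = 'J tau z *m A2 (tau z) *m ('J tau z)^T) ->
  differentiable A1 y -> differentiable A2 (tau y) ->
  bil ('D_X A1 y) Y Z = nabla G2 A2 (tau y) (X *m J) (Y *m J) (Z *m J)
   + bil (A2 (tau y)) ('D_X ('D_Y tau) y + gamma G2 (tau y) (X *m J) (Y *m J)) (Z *m J)
   + bil (A2 (tau y)) (Y *m J) ('D_X ('D_Z tau) y + gamma G2 (tau y) (X *m J) (Z *m J)).
Proof.
move=> tA d1 d2.
have := derive_bil_along G2 d2 (dtau Oy) (@dDtau Y X) (@dDtau Z X).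
rewrite /cov -!(JE _ Oy) => <-.
have := derive_bil (diff_derivable d1) (derivable_cst Y y X) (derivable_cst Z y X).
rewrite !derive_cst bil0l bil0r !addr0 => <-.
apply: near_eq_derive; apply: open_near oO Oy _ => z Oz.
by rewrite (tA z Oz) bil_pull !JE.
Qed.

(** The second coordinate system induces on the first a connection that is
    symmetric by Schwarz's theorem and metric by [bil_change]; uniqueness
    identifies it with the connection of G1. *)
Lemma gamma_change u v : gamma G2 (tau y) (u *m J) (v *m J) =
  gamma G1 y u v *m J - 'D_u ('D_v tau) y.
Proof.
pose c' u v := ('D_u ('D_v tau) y + gamma G2 (tau y) (u *m J) (v *m J)) *m invmx J.
suff -> : gamma G1 y u v = c' u v by rewrite /c' mulmxKV // addrC addKr.
have bc (x w : 'rV[R]_m) : bil (G1 y) (x *m invmx J) w = bil (G2 (tau y)) x (w *m J).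
  by rewrite (tG Oy) bil_pull -/J mulmxKV.
have sG1y := nbhs_singleton sG1; have sG2y := nbhs_singleton sG2.
apply: (koszul (A := G1 y) (D := fun u v w => bil ('D_u G1 y) v w)) => //.
- by move=> *; exact: gamma_sym.
- move=> u' v'; rewrite /c' (schwarz_rV u' v' oO ctau Oy); congr ((_ + _) *m _).
  exact: gamma_sym.
- by move=> *; exact: metric_bil.
move=> u' v' w'; rewrite (bil_change u' v' w' tG dG1 dG2) (nabla_metric _ _ _ dG2 sG2 uG2) add0r.
rewrite [X in _ = _ + X](bil_sym _ _ sG1y) !bc; congr (_ + _).
by rewrite (bil_sym _ _ sG2y).
Qed.

(** The second derivatives of tau that appear on differentiating the components
    of Q are exactly those in the transformation law of the connection. *)
Lemma nabla_change (Q1 Q2 : 'rV[R]_m -> 'M[R]_m) X Y Z :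
  (forall z, O z -> Q1 z = 'J tau z *m Q2 (tau z) *m ('J tau z)^T) ->
  differentiable Q1 y -> differentiable Q2 (tau y) ->
  nabla G1 Q1 y X Y Z = nabla G2 Q2 (tau y) (X *m J) (Y *m J) (Z *m J).
Proof.
move=> tQ d1 d2; rewrite {1}/nabla (bil_change X Y Z tQ d1 d2) (tQ y Oy) !bil_pull -/J.
have E W : 'D_X ('D_W tau) y + gamma G2 (tau y) (X *m J) (W *m J) = gamma G1 y X W *m J.
  by rewrite gamma_change addrC subrK.
have K (b c d c' d' : R) : c = c' -> d = d' -> b + c + d - c' - d' = b.
  by move=> -> ->; ring.
by apply: K; congr (bil _ _ _); exact: E.
Qed.

Variables (a : nat) (x : 'rV[R]_a) (sigma : 'rV[R]_a -> 'rV[R]_a).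
Variables (phi1 phi2 w1 w2 : 'rV[R]_a -> 'rV[R]_m).
Hypothesis phi1x : phi1 x = y.
Hypothesis dsigma : differentiable sigma x.
Hypothesis dphi1 : differentiable phi1 x.
Hypothesis dphi2 : differentiable phi2 (sigma x).
Hypothesis phiE : \near x, phi2 (sigma x) = tau (phi1 x).
Hypothesis dw1 : differentiable w1 x.
Hypothesis dw2 : differentiable w2 (sigma x).
Hypothesis wE : \near x, w2 (sigma x) = w1 x *m 'J tau (phi1 x).

Lemma derive_change u : 'D_('D_u sigma x) phi2 (sigma x) = 'D_u phi1 x *m J.
Proof.
rewrite -(derive_chain u dsigma dphi2) (near_eq_derive (g := tau \o phi1)) //.
have dt : differentiable tau (phi1 x) by rewrite phi1x; exact: dtau.
by rewrite (derive_chain u dphi1 dt) phi1x -JE.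
Qed.

(** Here the parametrization of the submanifold changes by sigma and the ambient
    coordinates by tau, at the same time. *)
Lemma cov_change u :
  cov G2 phi2 w2 ('D_u sigma x) (sigma x) = cov G1 phi1 w1 u x *m J.
Proof.
rewrite /cov derive_change (nbhs_singleton phiE) (nbhs_singleton wE) phi1x -/J.
rewrite gamma_change mulmxDl.
have dfix v : differentiable ('D_v tau) (phi1 x).
  by rewrite phi1x; have [+ _] := class_C_derive v oO ctau => /(_ y Oy).
have nO : \near x, O (phi1 x).
  have := differentiable_continuous dphi1; apply.
  by rewrite phi1x; exact: open_nbhs_nbhs.
have dJ : derivable (fun x => 'J tau (phi1 x)) x u.
  apply/derivable_mxP => i j.
  apply: (near_eq_derivable (f := fun z => ('D_(basis_vec R i) tau \o phi1) z 0 j)).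
    by apply: filterS nO => z Oz /=; rewrite -JE // /basis_vec -rowE mxE.
  apply/diff_derivable/differentiable_entry.
  exact: differentiable_comp dphi1 (dfix _).
have dw := @diff_derivable _ _ _ _ _ u dw1.
have K : 'D_u (fun x => w1 x *m 'J tau (phi1 x)) x =
    'D_u w1 x *m J + 'D_('D_u phi1 x) ('D_(w1 x) tau) y.
  rewrite (derive_mulmx dw dJ) phi1x -/J; congr (_ + _).
  rewrite -phi1x -(derive_chain u dphi1 (dfix _)).
  rewrite (near_eq_derive (g := fun z => w1 x *m 'J tau (phi1 z))).
    by rewrite (derive_mulmx (derivable_cst (w1 x) x u) dJ) derive_cst mul0mx add0r.
  by apply: filterS nO => z Oz /=; rewrite JE.
rewrite -(derive_chain u dsigma dw2).
rewrite (near_eq_derive (g := fun x => w1 x *m 'J tau (phi1 x))) //.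
by rewrite K [X in _ + X = _]addrC addrA addrK.
Qed.

End change.
End covariant.

(** * The divergence identity in coordinates *)

Local Opaque derive derivable jacobian gamma nabla cov.

Section divergence.
Variable R : realType.

Section contraction.
Variable k : nat.
Implicit Types (H S Qt N : 'I_k -> 'I_k -> R) (T : 'I_k -> 'I_k -> 'I_k -> R).

(** With S the shape operator and Qt the tangential part of the two-form: a
    symmetric matrix contracted with a skew one. *)
Lemma contract_skew0 H S Qt :
  (forall b c, H b c = H c b) -> (forall b c, S b c = S c b) ->
  (forall b c, Qt b c = - Qt c b) ->
  \sum_b \sum_c \sum_p \sum_q H b c * (H p q * S c p * Qt b q) = 0.
Proof.
move=> sH sS aQ; pose W b q := \sum_c \sum_p H b c * H p q * S c p.
have sW b q : W b q = W q b.
  rewrite /W exchange_big; apply: eq_bigr => p _; apply: eq_bigr => c _.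
  by rewrite (sH b c) (sH p q) (sS c p) [H c b * _]mulrC.
have -> : \sum_b \sum_c \sum_p \sum_q H b c * (H p q * S c p * Qt b q) =
    \sum_b \sum_q W b q * Qt b q.
  apply: eq_bigr => b _.
  under eq_bigr => c _ do rewrite exchange_big /=.
  rewrite exchange_big; apply: eq_bigr => q _ /=; rewrite mulr_suml.
  apply: eq_bigr => c _; rewrite mulr_suml; apply: eq_bigr => p _.
  by rewrite !mulrA.
set Z := (LHS in LHS = 0).
have : Z = - Z.
  rewrite {1}/Z exchange_big /= -sumrN; apply: eq_bigr => b _.
  by rewrite -sumrN; apply: eq_bigr => q _; rewrite sW aQ mulrN.
by move=> ZZ; lra.
Qed.

Lemma contract_swap H N : (forall b c, H b c = H c b) ->
  \sum_b \sum_c H b c * N c b = \sum_b \sum_c H b c * N b c.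
Proof.
move=> sH; rewrite exchange_big /=; apply: eq_bigr => b _; apply: eq_bigr => c _.
by rewrite sH.
Qed.

(** With H the inverse metric and T b p q = <D_b e_p, e_q>, so that
    d_b h_{pq} = T b p q + T b q p, the left-hand side consists of the terms
    coming from the derivatives of sqrt (det h) and of h^{bc}; they combine into
    the Christoffel symbols of the induced metric. *)
Lemma contract_christoffel H T (X : 'I_k -> R) :
  (forall b c, H b c = H c b) -> (forall b c d, T b c d = T c b d) ->
  \sum_b (2^-1 * (\sum_p \sum_q H p q * (T b q p + T b p q)) * (\sum_c H b c * X c)
     - \sum_c (\sum_q (\sum_p H b p * (T b p q + T b q p)) * H q c) * X c) =
  - \sum_b \sum_c H b c * (\sum_p \sum_q H p q * T b c p * X q).
Proof.
move=> sH sT; pose Y b := \sum_c H b c * X c.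
have E1 b : 2^-1 * (\sum_p \sum_q H p q * (T b q p + T b p q)) = \sum_p \sum_q H p q * T b p q.
  under eq_bigr => p _ do (under eq_bigr => q _ do rewrite mulrDr);
  under eq_bigr => p _ do rewrite big_split /=.
  by rewrite big_split /= contract_swap //; field.
have E2 b : \sum_c (\sum_q (\sum_p H b p * (T b p q + T b q p)) * H q c) * X c =
    \sum_q \sum_p H b p * T b p q * Y q + \sum_q \sum_p H b p * T b q p * Y q.
  under eq_bigr => c _ do rewrite mulr_suml.
  rewrite exchange_big /= -big_split /=; apply: eq_bigr => q _.
  rewrite -big_split /=.
  transitivity ((\sum_p H b p * (T b p q + T b q p)) * Y q).
    by rewrite /Y mulr_sumr; apply: eq_bigr => c _; rewrite mulrA.
  by rewrite mulr_suml; apply: eq_bigr => p _; rewrite -/(Y q); ring.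
have E3 : \sum_b (\sum_p \sum_q H p q * T b p q) * Y b =
    \sum_b \sum_q \sum_p H b p * T b q p * Y q.
  rewrite [RHS]exchange_big; apply: eq_bigr => b _.
  rewrite mulr_suml; apply: eq_bigr => p _; rewrite mulr_suml.
  by apply: eq_bigr => q _; rewrite sT.
under eq_bigr => b _ do rewrite E1 E2 -/(Y b).
rewrite sumrB big_split /= E3 opprD addrCA subrr addr0 -!sumrN.
apply: eq_bigr => b _; rewrite exchange_big /= -!sumrN; apply: eq_bigr => c _.
rewrite -mulrN -!sumrN mulr_sumr; apply: eq_bigr => p _.
rewrite mulrN /Y mulr_sumr mulr_sumr; congr (- _); apply: eq_bigr => q _.
by ring.
Qed.

Lemma contract_assemble H (N C D A B : 'I_k -> 'I_k -> R) :
  (forall b c, H b c = H c b) -> \sum_b \sum_c B b c = 0 ->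
  - \sum_b \sum_c H b c * A b c + \sum_b \sum_c H b c * (N b c + C b c + D c b) =
  \sum_b \sum_c (H b c * (N b c + C b c) + H b c * D b c - H b c * A b c - B b c).
Proof.
move=> sH B0.
under [RHS]eq_bigr => b _ do rewrite sumrB.
rewrite sumrB B0 subr0.
under [RHS]eq_bigr => b _ do rewrite sumrB.
rewrite sumrB addrC; congr (_ - _).
under [RHS]eq_bigr => b _ do rewrite big_split /=.
rewrite big_split /= -(contract_swap D sH) -big_split /=.
apply: eq_bigr => b _; rewrite -big_split /=; apply: eq_bigr => c _.
by rewrite mulrDr.
Qed.

End contraction.

Lemma is_derive_line (V W : normedModType R) (f : V -> W) x v df :
  is_derive x v f df <-> is_derive (0 : R) 1 (fun t : R => f (t *: v + x)) df.
Proof.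
have E : (fun h : R => h^-1 *: (f ((h *: (1 : R) + 0) *: v + x) - f ((0 : R) *: v + x)))
  = (fun h : R => h^-1 *: (f (h *: v + x) - f x)).
  by apply/funext => h; rewrite addr0 [h *: 1]mulr1 scale0r add0r.
Local Transparent derive derivable.
by split=> -[d1 d2]; split; move: d1 d2; rewrite /derivable /derive /= E.
Qed.
Local Opaque derive derivable.

Lemma derive_sqrt (V : normedModType R) (f : V -> R) x v :
  0 < f x -> derivable f x v ->
  derivable (fun y => Num.sqrt (f y)) x v /\
  'D_v (fun y => Num.sqrt (f y)) x = 'D_v f x / (2 * Num.sqrt (f x)).
Proof.
move=> f0 /derivableP/is_derive_line d1.
have fE : f ((0 : R) *: v + x) = f x by rewrite scale0r add0r.
have f0' : 0 < f ((0 : R) *: v + x) by rewrite fE.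
have := is_derive1_comp (is_derive1_sqrt f0') d1; rewrite fE => d2.
have [d3 ->] := (is_derive_line (fun y => Num.sqrt (f y)) x v _).2 d2.
by split; [exact: d3|rewrite mulrC].
Qed.

Lemma derivable_invmx (V : normedModType R) k (A : V -> 'M[R]_k) x v :
  (\near x, A x \in unitmx) -> derivable A x v ->
  derivable (fun y => invmx (A y)) x v.
Proof.
move=> nA dA; have uA := nbhs_singleton nA; apply/derivable_mxP => i j.
apply: (near_eq_derivable (f := fun y => (\det (A y))^-1 *
  ((-1) ^+ (j + i) * \det (row' j (col' i (A y)))))).
  by apply: filterS nA => y uy; rewrite /invmx uy !mxE.
have d1 := (derive_det dA).1.
have d0 : \det (A x) != 0 by rewrite -unitfE -unitmxE.
have dB : derivable (fun y => row' j (col' i (A y))) x v.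
  apply/derivable_mxP => a b; move/derivable_mxP/(_ (lift j a) (lift i b)): dA.
  by apply: near_eq_derivable; apply: nearW => y; rewrite !mxE.
have d2 := (derive_det dB).1.
exact: (derivableM (@derivableV _ _ (fun y => \det (A y)) x v d0 d1) (derivableM (derivable_cst ((-1) ^+ (j + i) : R) x v) d2)).
Qed.

Lemma derive_invmx (V : normedModType R) k (A : V -> 'M[R]_k) x v :
  (\near x, A x \in unitmx) -> derivable A x v ->
  'D_v (fun y => invmx (A y)) x = - (invmx (A x) *m 'D_v A x *m invmx (A x)).
Proof.
move=> nA dA; have uA := nbhs_singleton nA; have dI := derivable_invmx nA dA.
have : 'D_v (fun y => A y *m invmx (A y)) x = 0.
  rewrite -(derive_cst (1%:M : 'M[R]_k) x v); apply: near_eq_derive.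
  by apply: filterS nA => y uy; rewrite mulmxV.
rewrite (derive_mulmx dA dI) => /eqP; rewrite addrC addr_eq0 => /eqP E.
rewrite -[LHS](mulKmx uA) E mulmxN; congr (- _); exact: mulmxA.
Qed.

(** The terms come from sqrt (det h) by Jacobi's formula, from the inverse of h,
    and from X. *)
Lemma derive_density (V : normedModType R) k (h : V -> 'M[R]_k) (X : V -> 'cV[R]_k) x v b :
  (\near x, h x \in unitmx) -> 0 < \det (h x) -> derivable h x v -> derivable X x v ->
  let H := invmx (h x) in
  'D_v (fun y => Num.sqrt (\det (h y)) * (invmx (h y) *m X y) b 0) x =
  Num.sqrt (\det (h x)) * (2^-1 * \tr (H *m 'D_v h x) * (H *m X x) b 0
    - (H *m 'D_v h x *m H *m X x) b 0 + (H *m 'D_v X x) b 0).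
Proof.
move=> nh h0 dh dX H; have uh := nbhs_singleton nh.
have [dd De] := derive_det dh; have [ds Ds] := derive_sqrt (f := fun y => \det (h y)) h0 dd.
have dI := derivable_invmx nh dh; have dIX := derivable_mulmx dI dX.
have /derivable_mxP/(_ b 0) dIXb := dIX.
rewrite (deriveMf ds dIXb) Ds De (derive_entry b 0 dIX) (derive_mulmx dI dX).
rewrite (derive_invmx nh dh) -/H.
have -> : \adj (h x) = \det (h x) *: H.
  by rewrite /H /invmx uh scalerA mulfV ?scale1r // gt_eqF.
rewrite -scalemxAl mxtraceZ.
have dE : \det (h x) = Num.sqrt (\det (h x)) * Num.sqrt (\det (h x)).
  by rewrite -expr2 sqr_sqrtr // ltW.
have s0 : Num.sqrt (\det (h x)) != 0 by rewrite gt_eqF // sqrtr_gt0.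
have mxDN (A B : 'cV[R]_k) : (- A + B) b 0 = - A b 0 + B b 0 by rewrite !mxE.
move: dE s0; rewrite mulNmx mxDN; set s := Num.sqrt _ => -> s0.
by field.
Qed.

Section pointwise.
Variables (k m : nat) (U : set 'rV[R]_k) (O : set 'rV[R]_m).
Variables (f l : 'rV[R]_k -> 'rV[R]_m) (G Q : 'rV[R]_m -> 'M[R]_m).
Hypothesis oU : open U.
Hypothesis oO : open O.
Hypothesis fUO : forall y, U y -> O (f y).
Hypothesis cf : class_C 2 U f.
Hypothesis cl : class_C 1 U l.
Hypothesis cG : class_C 1 O G.
Hypothesis cQ : class_C 1 O Q.
Hypothesis sG : forall y, O y -> (G y)^T = G y.
Hypothesis uG : forall y, O y -> G y \in unitmx.
Hypothesis aQ : forall y, O y -> (Q y)^T = - Q y.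
Variable E : 'rV[R]_k -> 'M[R]_(k, m).
Hypothesis frame_row : forall y c, U y -> row c (E y) = 'D_(basis_vec R c) f y.
Local Notation h y := (E y *m G (f y) *m (E y)^T).
Hypothesis ph : forall y, U y -> posdef (h y).
Hypothesis nl : forall y c, U y -> bil (G (f y)) (l y) (row c (E y)) = 0.

(** The normal component for an arbitrary form A and an arbitrary frame F. *)
Definition normal_proj (A : 'M[R]_m) (F : 'M[R]_(k, m)) (v : 'rV[R]_m) : 'rV[R]_m :=
  v - \sum_(b < k) \sum_(c < k)
        (invmx (F *m A *m F^T) b c * bil A v (row b F)) *: row c F.

Local Notation e b := (basis_vec R b).

Lemma derivable_frame_row y c v : U y -> derivable (fun z => row c (E z)) y v.
Proof.
move=> Uy; apply: (near_eq_derivable (f := 'D_(e c) f)).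
  by apply: open_near oU Uy _ => z Uz; rewrite (frame_row _ Uz).
by have [+ _] := class_C_derive (e c) oU cf => /(_ y Uy)/diff_derivable; apply.
Qed.

Lemma derivable_frame y v : U y -> derivable E y v.
Proof.
move=> Uy; apply/derivable_mxP => i j.
have /derivable_mxP/(_ 0 j) := @derivable_frame_row y i v Uy.
by apply: near_eq_derivable; apply: open_near openT I _ => z _; rewrite mxE.
Qed.

(** Second derivatives of f commute and the connection is torsion-free. *)
Lemma cov_frame_sym y b c : U y ->
  cov G f (fun z => row c (E z)) (e b) y = cov G f (fun z => row b (E z)) (e c) y.
Proof.
move=> Uy; have D c' v : 'D_v (fun z => row c' (E z)) y = 'D_v ('D_(e c') f) y.
  by apply: near_eq_derive; apply: open_near oU Uy _ => z Uz; rewrite (frame_row _ Uz).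
have C b' c' : cov G f (fun z => row c' (E z)) (e b') y =
    'D_(e b') ('D_(e c') f) y + gamma G (f y) ('D_(e b') f y) ('D_(e c') f y).
  by rewrite covE D (frame_row _ Uy).
have S := schwarz_rV (e b) (e c) oU cf Uy.
have Gs : gamma G (f y) ('D_(e b) f y) ('D_(e c) f y) = gamma G (f y) ('D_(e c) f y) ('D_(e b) f y).
  by apply: gamma_sym; exact: open_near oO (fUO Uy) _.
apply: etrans (C b c) _; apply: etrans _ (esym (C c b)).
exact: congr2 S Gs.
Qed.

Let df y : U y -> differentiable f y.
Proof. by case: cf => + _; apply. Qed.

Let dl y : U y -> differentiable l y.
Proof. by case: cl => + _; apply. Qed.

Let dG y : O y -> differentiable G y.
Proof. by case: cG => + _; apply. Qed.

Let dQ y : O y -> differentiable Q y.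
Proof. by case: cQ => + _; apply. Qed.

Lemma gram_sym y : U y -> (h y)^T = h y.
Proof. by move=> Uy; rewrite !trmx_mul trmxK sG ?mulmxA //; exact: fUO. Qed.

Lemma metric_along w1 w2 u y : U y -> derivable w1 y u -> derivable w2 y u ->
  'D_u (fun z => bil (G (f z)) (w1 z) (w2 z)) y =
  bil (G (f y)) (cov G f w1 u y) (w2 y) + bil (G (f y)) (w1 y) (cov G f w2 u y).
Proof.
move=> Uy d1 d2; have Oy := fUO Uy.
rewrite (derive_bil_along G (dG Oy) (df Uy) d1 d2) nabla_metric ?add0r //.
- exact: dG.
- exact: open_near oO Oy _.
exact: uG.
Qed.

(** The tangent one-form Q(e_c, l), as a column. *)
Definition pairing y : 'cV[R]_k := \col_c bil (Q (f y)) (row c (E y)) (l y).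

Lemma derivable_gram y v : U y -> derivable (fun z => h z) y v.
Proof.
move=> Uy; have dE := @derivable_frame y v Uy.
have dGf : derivable (G \o f) y v.
  exact/diff_derivable/differentiable_comp/dG/fUO/Uy/df.
exact: (derivable_mulmx (derivable_mulmx dE dGf) (derivable_trmx dE)).
Qed.

Lemma derivable_pairing y v : U y -> derivable pairing y v.
Proof.
move=> Uy; apply/derivable_mxP => c j.
have dE := @derivable_frame_row y c v Uy.
have dQf : derivable (Q \o f) y v.
  exact/diff_derivable/differentiable_comp/dQ/fUO/Uy/df.
have dlT := derivable_trmx (@diff_derivable _ _ _ _ _ v (dl Uy)).
have /derivable_mxP/(_ 0 0) := derivable_mulmx (derivable_mulmx dE dQf) dlT.
by apply: near_eq_derivable; apply: open_near openT I _ => z _; rewrite [RHS]mxE.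
Qed.

Variable x : 'rV[R]_k.
Hypothesis Ux : U x.

Let Ox : O (f x) := fUO Ux.
Let H b c : R := invmx (h x) b c.
Let T b p q : R := bil (G (f x)) (cov G f (fun z => row p (E z)) (e b) x) (row q (E x)).

Lemma inv_gram_sym b c : H b c = H c b.
Proof.
rewrite /H; have /matrixP/(_ b c) : (invmx (h x))^T = invmx (h x).
  by rewrite trmx_inv gram_sym.
by rewrite mxE => ->.
Qed.

Lemma derive_gram b p q : ('D_(e b) (fun z => h z) x) p q = T b p q + T b q p.
Proof.
rewrite -derive_entry; last exact: derivable_gram.
rewrite (near_eq_derive (g := fun y => bil (G (f y)) (row p (E y)) (row q (E y)))).
  rewrite (metric_along Ux (@derivable_frame_row _ _ _ Ux) (@derivable_frame_row _ _ _ Ux)).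
  by congr (_ + _); rewrite (bil_sym _ _ (sG Ox)).
by apply: open_near openT I _ => z _; rewrite gram_entry.
Qed.

Lemma derive_pairing b c : ('D_(e b) pairing x) c 0 =
  nabla G Q (f x) (row b (E x)) (row c (E x)) (l x)
  + bil (Q (f x)) (cov G f (fun z => row c (E z)) (e b) x) (l x)
  + bil (Q (f x)) (row c (E x)) (cov G f l (e b) x).
Proof.
rewrite -derive_entry; last exact: derivable_pairing.
rewrite (near_eq_derive (g := fun y => bil (Q (f y)) (row c (E y)) (l y))).
  rewrite (derive_bil_along G (dQ Ox) (df Ux) (@derivable_frame_row _ _ _ Ux)
    (diff_derivable (dl Ux))).
  by rewrite (frame_row b Ux).
by apply: open_near openT I _ => z _; rewrite mxE.
Qed.

(** As l is orthogonal to the frame, <D_b l, e_c> = - <l, D_b e_c>, which is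
    symmetric in b and c. *)
Lemma shape_sym b c :
  bil (G (f x)) (cov G f l (e b) x) (row c (E x)) =
  bil (G (f x)) (cov G f l (e c) x) (row b (E x)).
Proof.
have K b' c' : bil (G (f x)) (cov G f l (e b') x) (row c' (E x)) =
    - bil (G (f x)) (l x) (cov G f (fun z => row c' (E z)) (e b') x).
  apply/eqP; rewrite -addr_eq0; apply/eqP.
  rewrite -(metric_along Ux (diff_derivable (dl Ux)) (@derivable_frame_row _ _ _ Ux)).
  rewrite (near_eq_derive (g := cst 0)) ?derive_cst //.
  by apply: open_near oU Ux _ => z Uz; rewrite nl.
apply: etrans (K b c) _; apply: etrans _ (esym (K c b)).
by congr (- bil _ _ _); exact: cov_frame_sym.
Qed.

Lemma bil_normal_proj A F u v (B : 'M[R]_m) :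
  bil B (normal_proj A F u) v = bil B u v -
   \sum_p \sum_q invmx (F *m A *m F^T) p q * bil A u (row p F) * bil B (row q F) v.
Proof.
rewrite /normal_proj bilDl bilNl bil_suml; congr (_ - _); apply: eq_bigr => p _.
by rewrite bil_suml; apply: eq_bigr => q _; rewrite bilZl.
Qed.

(** The left-hand side is the divergence density of X_c = Q(e_c, l) for the
    metric h.  Expanding it with [derive_density] and [derive_pairing], the
    Christoffel terms cancel the tangential part of the covariant derivative of
    the frame, and the tangential part of the derivative of l contributes
    nothing by [contract_skew0]. *)
Lemma divergence_identity :
  \sum_b 'D_(e b) (fun y => Num.sqrt (\det (h y)) * (invmx (h y) *m pairing y) b 0) x =
  Num.sqrt (\det (h x)) * \sum_b \sum_c invmx (h x) b c *
   (nabla G Q (f x) (row b (E x)) (row c (E x)) (l x)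
    + bil (Q (f x)) (normal_proj (G (f x)) (E x) (cov G f (fun z => row c (E z)) (e b) x)) (l x)
    + bil (Q (f x)) (row b (E x)) (normal_proj (G (f x)) (E x) (cov G f l (e c) x))).
Proof.
have nh : \near x, h x \in unitmx.
  by apply: open_near oU Ux _ => z Uz; exact/posdef_unit/ph.
have h0 : 0 < \det (h x) by apply/posdef_det/ph.
under eq_bigr => b _ do rewrite (derive_density b nh h0 (@derivable_gram _ _ Ux) (@derivable_pairing _ _ Ux)).
rewrite -mulr_sumr; congr (_ * _).
pose X c : R := bil (Q (f x)) (row c (E x)) (l x).
have XE b : (invmx (h x) *m pairing x) b 0 = \sum_c H b c * X c.
  by rewrite mxE; apply: eq_bigr => c _; rewrite mxE.
have trE b : \tr (invmx (h x) *m 'D_(e b) (fun z => h z) x) =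
    \sum_p \sum_q H p q * (T b q p + T b p q).
  by rewrite /mxtrace; apply: eq_bigr => p _; rewrite mxE; apply: eq_bigr => q _; rewrite derive_gram.
have DE b : (invmx (h x) *m 'D_(e b) (fun z => h z) x *m invmx (h x) *m pairing x) b 0 =
    \sum_c (\sum_q (\sum_p H b p * (T b p q + T b q p)) * H q c) * X c.
  rewrite mxE; apply: eq_bigr => c _; rewrite mxE [pairing x c 0]mxE; congr (_ * _).
  apply: eq_bigr => q _; rewrite mxE; congr (_ * _).
  by apply: eq_bigr => p _; rewrite derive_gram.
have PE b : (invmx (h x) *m 'D_(e b) pairing x) b 0 = \sum_c H b c *
    (nabla G Q (f x) (row b (E x)) (row c (E x)) (l x)
    + bil (Q (f x)) (cov G f (fun z => row c (E z)) (e b) x) (l x)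
    + bil (Q (f x)) (row c (E x)) (cov G f l (e b) x)).
  by rewrite mxE; apply: eq_bigr => c _; rewrite derive_pairing.
under eq_bigr => b _ do rewrite XE trE DE PE.
rewrite big_split /= contract_christoffel; last 2 first.
- exact: inv_gram_sym.
- by move=> b c d; rewrite /T (cov_frame_sym _ _ Ux).
have skew0 := contract_skew0 inv_gram_sym shape_sym (fun b c => bil_skew (row b (E x)) (row c (E x)) (aQ Ox)).
pose N b c := nabla G Q (f x) (row b (E x)) (row c (E x)) (l x).
pose C b c := bil (Q (f x)) (cov G f (fun z => row c (E z)) (e b) x) (l x).
pose D b c := bil (Q (f x)) (row b (E x)) (cov G f l (e c) x).
pose S c p := bil (G (f x)) (cov G f l (e c) x) (row p (E x)).
pose Qt b c := bil (Q (f x)) (row b (E x)) (row c (E x)).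
apply: etrans (contract_assemble N C D (fun b c => \sum_p \sum_q H p q * T b c p * X q)
  inv_gram_sym skew0) _.
apply: eq_bigr => b _; apply: eq_bigr => c _.
rewrite bil_normal_proj (bil_skew (row b (E x)) _ (aQ Ox)) bil_normal_proj.
rewrite -/(N b c) -/(C b c) -/(H b c).
have -> : bil (Q (f x)) (cov G f l (e c) x) (row b (E x)) = - D b c.
  exact: bil_skew (aQ Ox).
have -> : \sum_p \sum_q invmx (h x) p q * S c p * bil (Q (f x)) (row q (E x)) (row b (E x))
   = - \sum_p \sum_q H p q * S c p * Qt b q.
  rewrite -sumrN; apply: eq_bigr => p _; rewrite -sumrN; apply: eq_bigr => q _.
  by rewrite (bil_skew (row q (E x)) _ (aQ Ox)) mulrN.
have -> : \sum_p \sum_q H b c * (H p q * S c p * Qt b q) =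
    H b c * \sum_p \sum_q H p q * S c p * Qt b q.
  by rewrite mulr_sumr; apply: eq_bigr => p _; rewrite mulr_sumr.
set s1 := \sum_p _; set s2 := \sum_p _.
by ring.
Qed.

End pointwise.
End divergence.

(** * Tensor calculus along a map *)

Section local_tensors.
Variable R : realType.

Section gamma_linear.
Variables (m : nat) (G : 'rV[R]_m -> 'M[R]_m) (y : 'rV[R]_m).

Lemma gammaE u v l : gamma G y u v 0 l =
  \sum_(j < m) \sum_(k < m) christoffel G y l j k * u 0 j * v 0 k.
Proof. by rewrite mxE. Qed.

Lemma gamma_sumr u (I : Type) (r : seq I) (s : I -> R) (w : I -> 'rV[R]_m) :
  gamma G y u (\sum_(i <- r) s i *: w i) = \sum_(i <- r) s i *: gamma G y u (w i).
Proof.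
apply/rowP => l; rewrite gammaE summxE.
transitivity (\sum_j \sum_k \sum_(i <- r) christoffel G y l j k * u 0 j * (s i * w i 0 k)).
  apply: eq_bigr => j _; apply: eq_bigr => k _; rewrite summxE mulr_sumr.
  by apply: eq_bigr => i _; rewrite mxE.
under eq_bigr => j _ do rewrite exchange_big /=.
rewrite exchange_big /=; apply: eq_bigr => i _; rewrite mxE gammaE mulr_sumr.
apply: eq_bigr => j _; rewrite mulr_sumr; apply: eq_bigr => k _.
by ring.
Qed.

Lemma gamma_suml v (I : Type) (r : seq I) (s : I -> R) (w : I -> 'rV[R]_m) :
  gamma G y (\sum_(i <- r) s i *: w i) v = \sum_(i <- r) s i *: gamma G y (w i) v.
Proof.
apply/rowP => l; rewrite gammaE summxE.
transitivity (\sum_j \sum_k \sum_(i <- r) christoffel G y l j k * (s i * w i 0 j) * v 0 k).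
  apply: eq_bigr => j _; apply: eq_bigr => k _; rewrite summxE mulr_sumr mulr_suml.
  by apply: eq_bigr => i _; rewrite mxE.
under eq_bigr => j _ do rewrite exchange_big /=.
rewrite exchange_big /=; apply: eq_bigr => i _; rewrite mxE gammaE mulr_sumr.
apply: eq_bigr => j _; rewrite mulr_sumr; apply: eq_bigr => k _.
by ring.
Qed.

Lemma derive_sumdir (q : nat) (W : normedModType R) (f : 'rV[R]_q -> W) x
    (I : Type) (r : seq I) (s : I -> R) (u : I -> 'rV[R]_q) : differentiable f x ->
  'D_(\sum_(i <- r) s i *: u i) f x = \sum_(i <- r) s i *: 'D_(u i) f x.
Proof.
move=> df; rewrite deriveE // linear_sum /=; apply: eq_bigr => i _.
by rewrite linearZ deriveE.
Qed.

Lemma nabla_sumX (Q : 'rV[R]_m -> 'M[R]_m) Y Z (I : Type) (r : seq I)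
    (s : I -> R) (w : I -> 'rV[R]_m) : differentiable Q y ->
  nabla G Q y (\sum_(i <- r) s i *: w i) Y Z = \sum_(i <- r) s i * nabla G Q y (w i) Y Z.
Proof.
Local Transparent nabla.
move=> dQ; rewrite /nabla (derive_sumdir _ _ _ dQ) !gamma_suml bil_suml bil_sumr.
rewrite (_ : bil (\sum_(i <- r) s i *: 'D_(w i) Q y) Y Z =
             \sum_(i <- r) s i * bil ('D_(w i) Q y) Y Z); last first.
  elim: r => [|i r IH]; first by rewrite !big_nil /bil mulmx0 mul0mx mxE.
  rewrite !big_cons bilDm IH; congr (_ + _).
  by rewrite /bil -scalemxAr -scalemxAl mxE.
rewrite -!sumrB; apply: eq_bigr => i _; rewrite bilZl bilZr.
by rewrite !mulrBr.
Qed.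

Lemma nabla_sumY (Q : 'rV[R]_m -> 'M[R]_m) X Z (I : Type) (r : seq I)
    (s : I -> R) (w : I -> 'rV[R]_m) :
  nabla G Q y X (\sum_(i <- r) s i *: w i) Z = \sum_(i <- r) s i * nabla G Q y X (w i) Z.
Proof.
rewrite /nabla gamma_sumr !bil_suml -!sumrB; apply: eq_bigr => i _.
by rewrite !bilZl !mulrBr.
Qed.
Local Opaque nabla.

End gamma_linear.

Section cov_rules.
Variables (a m : nat) (G : 'rV[R]_m -> 'M[R]_m).
Implicit Types (phi w : 'rV[R]_a -> 'rV[R]_m).

Lemma cov_sumdir phi w x (I : Type) (r : seq I) (s : I -> R) (u : I -> 'rV[R]_a) :
  differentiable phi x -> differentiable w x ->
  cov G phi w (\sum_(i <- r) s i *: u i) x = \sum_(i <- r) s i *: cov G phi w (u i) x.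
Proof.
move=> dphi dw; rewrite covE !derive_sumdir // gamma_suml -big_split /=.
by apply: eq_bigr => i _; rewrite covE scalerDr.
Qed.

Lemma cov_comp (sigma : 'rV[R]_a -> 'rV[R]_a) phi w u x :
  differentiable sigma x -> differentiable phi (sigma x) -> differentiable w (sigma x) ->
  cov G (phi \o sigma) (w \o sigma) u x = cov G phi w ('D_u sigma x) (sigma x).
Proof.
move=> ds dphi dw.
by rewrite !covE (derive_chain u ds dphi) (derive_chain u ds dw).
Qed.

Lemma derive_scale (V : normedModType R) (s : V -> R) (w : V -> 'rV[R]_m) (x v : V) :
  derivable s x v -> derivable w x v ->
  derivable (fun z => s z *: w z) x v /\
  'D_v (fun z => s z *: w z) x = 'D_v s x *: w x + s x *: 'D_v w x.
Proof.
move=> ds dw; have /derivable_mxP dw' := dw.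
have dsw : derivable (fun z => s z *: w z) x v.
  apply/derivable_mxP => i j.
  rewrite (_ : (fun z => _) = (fun z => s z * w z i j)); last first.
    by apply/funext => z; rewrite mxE.
  exact: (derivableM ds (dw' i j)).
split=> //; apply/rowP => j; rewrite -(derive_entry _ _ dsw).
rewrite (_ : (fun z => _) = (fun z => s z * w z 0 j)); last first.
  by apply/funext => z; rewrite mxE.
by rewrite (deriveMf ds (dw' 0 j)) !mxE derive_entry.
Qed.

Lemma differentiable_scale (V : normedModType R) (s : V -> R) (w : V -> 'rV[R]_m) (x : V) :
  differentiable s x -> differentiable w x -> differentiable (fun z => s z *: w z) x.
Proof.
move=> ds dw.
have -> : (fun z => s z *: w z) = \sum_e (fun z => (s z * w z 0 e) *: basis_vec R e).
  apply/funext => z; rewrite fct_sumE [in LHS](row_sum_delta (w z)) scaler_sumr.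
  by apply: eq_bigr => e _; rewrite scalerA.
apply: differentiable_sum => e; apply: differentiableZl.
by apply: differentiableM => //; exact: differentiable_entry.
Qed.

Lemma derive_sum_scale (V : normedModType R) (I : Type) (r : seq I)
    (s : I -> V -> R) (w : I -> V -> 'rV[R]_m) (x v : V) :
  (forall i, derivable (s i) x v) -> (forall i, derivable (w i) x v) ->
  derivable (fun z => \sum_(i <- r) s i z *: w i z) x v /\
  'D_v (fun z => \sum_(i <- r) s i z *: w i z) x =
    \sum_(i <- r) ('D_v (s i) x *: w i x + s i x *: 'D_v (w i) x).
Proof.
move=> ds dw; elim: r => [|i r [IH1 IH2]].
  rewrite (_ : (fun z => _) = cst 0); last by apply/funext => z; rewrite big_nil.
  by rewrite big_nil derive_cst; split=> //; exact: derivable_cst.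
rewrite (_ : (fun z => _) = (fun z => s i z *: w i z) + (fun z => \sum_(i <- r) s i z *: w i z)); last first.
  by apply/funext => z; rewrite big_cons.
have [d1 d2] := derive_scale (ds i) (dw i).
split; first exact: derivableD d1 IH1.
by rewrite (deriveD d1 IH1) big_cons d2 IH2.
Qed.

Lemma cov_leibniz phi (I : Type) (r : seq I) (s : I -> 'rV[R]_a -> R)
    (w : I -> 'rV[R]_a -> 'rV[R]_m) u x :
  (forall i, derivable (s i) x u) -> (forall i, derivable (w i) x u) ->
  cov G phi (fun z => \sum_(i <- r) s i z *: w i z) u x =
  \sum_(i <- r) ('D_u (s i) x *: w i x + s i x *: cov G phi (w i) u x).
Proof.
move=> ds dw; rewrite covE (derive_sum_scale r ds dw).2 gamma_sumr -big_split /=.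
by apply: eq_bigr => i _; rewrite covE scalerDr addrA.
Qed.

End cov_rules.

Section projection.
Variables (k m : nat).
Implicit Types (A : 'M[R]_m) (F : 'M[R]_(k, m)) (v : 'rV[R]_m).

Lemma normal_projE A F v :
  normal_proj A F v = v - v *m A *m F^T *m invmx (F *m A *m F^T) *m F.
Proof.
congr (_ - _); set H := invmx _.
rewrite [RHS]mulmx_sum_row exchange_big /=; apply: eq_bigr => c _.
rewrite mxE scaler_suml; apply: eq_bigr => b _.
rewrite mulrC /bil [in LHS]mxE [X in _ = (X * _) *: _]mxE; congr ((_ * _) *: _).
by apply: eq_bigr => j _; rewrite !mxE.
Qed.

Lemma normal_proj_sum A F (I : Type) (r : seq I) (s : I -> R) (w : I -> 'rV[R]_m) :
  normal_proj A F (\sum_(i <- r) s i *: w i) = \sum_(i <- r) s i *: normal_proj A F (w i).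
Proof.
rewrite normal_projE !mulmx_suml -sumrB; apply: eq_bigr => i _.
by rewrite normal_projE scalerBr -!scalemxAl.
Qed.

Lemma normal_projD A F v w : normal_proj A F (v + w) = normal_proj A F v + normal_proj A F w.
Proof. by rewrite !normal_projE !mulmxDl opprD addrACA. Qed.

Lemma normal_proj_row A F d : F *m A *m F^T \in unitmx -> normal_proj A F (row d F) = 0.
Proof.
by move=> uh; rewrite normal_projE -!row_mul mulmxV // mul1mx subrr.
Qed.

Lemma invmx_congr (P h : 'M[R]_k) : P \in unitmx -> h \in unitmx ->
  invmx (P *m h *m P^T) = invmx P^T *m invmx h *m invmx P.
Proof.
move=> uP uh; have uPT : P^T \in unitmx by rewrite unitmx_tr.
have uA : P *m h *m P^T \in unitmx by rewrite !unitmx_mul uP uh.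
have E : P *m h *m P^T *m (invmx P^T *m invmx h *m invmx P) = 1%:M.
  by rewrite !mulmxA mulmxK // mulmxK // mulmxV.
by rewrite -[LHS]mulmx1 -E mulKmx.
Qed.

(** F J = P F' expresses the old frame in the new coordinates and the new
    frame. *)
Lemma gram_change A A' F F' (J : 'M[R]_m) (P : 'M[R]_k) :
  A = J *m A' *m J^T -> F *m J = P *m F' ->
  F *m A *m F^T = P *m (F' *m A' *m F'^T) *m P^T.
Proof.
by move=> -> FE; rewrite !mulmxA FE -!mulmxA -trmx_mul FE trmx_mul !mulmxA.
Qed.

Lemma normal_proj_change A A' F F' (J : 'M[R]_m) (P : 'M[R]_k) v :
  A = J *m A' *m J^T -> F *m J = P *m F' -> F *m A *m F^T \in unitmx ->
  normal_proj A F v *m J = normal_proj A' F' (v *m J).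
Proof.
move=> AE FE uh; rewrite !normal_projE mulmxBl; congr (_ - _).
have hE : F *m A *m F^T = P *m (F' *m A' *m F'^T) *m P^T.
  exact: (gram_change AE FE).
have [uP uh'] : P \in unitmx /\ F' *m A' *m F'^T \in unitmx.
  by move: uh; rewrite hE !unitmx_mul => /andP[/andP[-> ->]].
have uPT : P^T \in unitmx by rewrite unitmx_tr.
rewrite hE invmx_congr //.
have -> : v *m A *m F^T = v *m J *m A' *m F'^T *m P^T.
  by rewrite AE !mulmxA -!mulmxA -trmx_mul FE trmx_mul !mulmxA.
by rewrite -!mulmxA FE mulKmx // mulKVmx.
Qed.

End projection.

Section regularity.
Variables (a m : nat) (U : set 'rV[R]_a) (O : set 'rV[R]_m).
Hypothesis oU : open U.
Hypothesis oO : open O.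

Lemma class_Cmx_eq k p q (A B : 'rV[R]_a -> 'M[R]_(p, q)) :
  (forall x, U x -> A x = B x) -> class_Cmx k U A -> class_Cmx k U B.
Proof. by move=> AB cA i j; apply: class_C_eq oU _ (cA i j) => x /AB ->. Qed.

Lemma class_CmxD k p q (A B : 'rV[R]_a -> 'M[R]_(p, q)) :
  class_Cmx k U A -> class_Cmx k U B -> class_Cmx k U (fun x => A x + B x).
Proof.
move=> cA cB i j; apply: class_C_eq oU _ (class_CD oU (cA i j) (cB i j)) => x _.
by rewrite [RHS]mxE.
Qed.

Lemma class_CmxN k p q (A : 'rV[R]_a -> 'M[R]_(p, q)) :
  class_Cmx k U A -> class_Cmx k U (fun x => - A x).
Proof.
move=> cA i j; apply: class_C_eq oU _ (class_CN oU (cA i j)) => x _.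
by rewrite [RHS]mxE.
Qed.

Lemma class_Cmx_row k p q (A : 'rV[R]_a -> 'M[R]_(p, q)) c :
  class_Cmx k U A -> class_Cmx k U (fun x => row c (A x)).
Proof.
by move=> cA i j; apply: class_C_eq oU _ (cA c j) => x _; rewrite mxE.
Qed.

Lemma class_C_bil k (A : 'rV[R]_a -> 'M[R]_m) (u v : 'rV[R]_a -> 'rV[R]_m) :
  class_Cmx k U A -> class_Cmx k U u -> class_Cmx k U v ->
  class_C k U (fun x => bil (A x) (u x) (v x)).
Proof.
move=> cA cu cv.
exact: (class_Cmx_mul oU (class_Cmx_mul oU cu cA) (class_Cmx_tr oU cv)) 0 0.
Qed.

Lemma class_Cmx_comp k p q (A : 'rV[R]_m -> 'M[R]_(p, q)) (f : 'rV[R]_a -> 'rV[R]_m) :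
  (forall x, U x -> O (f x)) -> class_C k U f -> class_Cmx k O A ->
  class_Cmx k U (fun x => A (f x)).
Proof. by move=> fUO cf cA i j; exact: (class_C_comp oU fUO cf (cA i j)). Qed.

Lemma class_C_christoffel k (G : 'rV[R]_m -> 'M[R]_m) l i j :
  (forall y, O y -> G y \in unitmx) -> class_C k.+1 O G ->
  class_C k O (fun y => christoffel G y l i j).
Proof.
move=> uG cG; apply: class_CM => //; first exact: (class_C_cst k O (2^-1 : R)).
have cGi b c d : class_C k O (partial b (fun y => G y c d)).
  by have [_] := class_C_entry c d oO cG => /(_ b).
apply: class_C_sum => // s _; apply: class_CM => //.
  by apply: class_Cmx_inv => // b c; apply: class_C_entry => //; exact: class_CW.
by apply: class_CB => //; apply: class_CD.
Qed.

Variables (k : nat) (G : 'rV[R]_m -> 'M[R]_m) (phi : 'rV[R]_a -> 'rV[R]_m).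
Hypothesis uG : forall y, O y -> G y \in unitmx.
Hypothesis cG : class_C k.+1 O G.
Hypothesis phiUO : forall x, U x -> O (phi x).
Hypothesis cphi : class_C k.+1 U phi.

Lemma class_Cmx_gamma (u v : 'rV[R]_a -> 'rV[R]_m) :
  class_Cmx k U u -> class_Cmx k U v ->
  class_Cmx k U (fun x => gamma G (phi x) (u x) (v x)).
Proof.
move=> cu cv i l; apply: (@class_C_eq _ _ _ _ _ (fun x =>
  \sum_(j < m) \sum_(b < m) christoffel G (phi x) l j b * u x 0 j * v x 0 b)) => //.
  by move=> x _; rewrite ord1 gammaE.
apply: class_C_sum => // j _; apply: class_C_sum => // b _.
apply: class_CM => //; apply: class_CM => //.
have cc := class_C_christoffel l j b uG cG.
exact: (class_C_comp oU phiUO (class_CW cphi) cc).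
Qed.

Lemma class_Cmx_derive p q (A : 'rV[R]_a -> 'M[R]_(p, q)) v :
  class_C k.+1 U A -> class_Cmx k U ('D_v A).
Proof. by move=> cA; apply: class_C_mx => //; exact: class_C_derive. Qed.

Lemma class_Cmx_cov (w : 'rV[R]_a -> 'rV[R]_m) v : class_C k.+1 U w ->
  class_Cmx k U (fun x => cov G phi w v x).
Proof.
move=> cw; apply: (@class_Cmx_eq _ _ _ (fun x => 'D_v w x + gamma G (phi x) ('D_v phi x) (w x))).
  by move=> x _; rewrite covE.
apply: class_CmxD; first exact: class_Cmx_derive.
apply: class_Cmx_gamma; first exact: class_Cmx_derive.
by apply: class_C_mx => //; exact: class_CW.
Qed.

Lemma class_C_nabla (Q : 'rV[R]_m -> 'M[R]_m) (X Y Z : 'rV[R]_a -> 'rV[R]_m) :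
  class_C k.+1 O Q -> class_Cmx k U X -> class_Cmx k U Y -> class_Cmx k U Z ->
  class_C k U (fun x => nabla G Q (phi x) (X x) (Y x) (Z x)).
Proof.
move=> cQ cX cY cZ; have cphi0 := class_CW cphi.
have cQphi : class_Cmx k U (fun x => Q (phi x)).
  by apply: class_Cmx_comp => //; apply: class_C_mx => //; exact: class_CW.
apply: (@class_C_eq _ _ _ _ _ (fun x =>
   \sum_l X x 0 l * bil ('D_(basis_vec R l) Q (phi x)) (Y x) (Z x)
   - bil (Q (phi x)) (gamma G (phi x) (X x) (Y x)) (Z x)
   - bil (Q (phi x)) (Y x) (gamma G (phi x) (X x) (Z x)))) => //.
  move=> x Ux.
Local Transparent nabla.
  rewrite /nabla.
Local Opaque nabla.
  congr (_ - _ - _).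
  rewrite derive_basis; last by case: cQ => + _; apply; exact: phiUO.
  rewrite /bil mulmx_sumr mulmx_suml summxE; apply: eq_bigr => l _.
  by rewrite -scalemxAr -scalemxAl [RHS]mxE.
apply: class_CB => //; last by apply: class_C_bil => //; exact: class_Cmx_gamma.
apply: class_CB => //; last by apply: class_C_bil => //; exact: class_Cmx_gamma.
apply: class_C_sum => // l _; apply: class_CM => //.
have cDQ : class_Cmx k O ('D_(basis_vec R l) Q).
  by apply: class_C_mx => //; case: cQ => _; apply.
exact: class_C_bil (class_Cmx_comp phiUO cphi0 cDQ) cY cZ.
Qed.

Lemma class_Cmx_normal_proj q (A : 'rV[R]_a -> 'M[R]_m) (F : 'rV[R]_a -> 'M[R]_(q, m))
    (v : 'rV[R]_a -> 'rV[R]_m) : (forall x, U x -> F x *m A x *m (F x)^T \in unitmx) ->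
  class_Cmx k U A -> class_Cmx k U F -> class_Cmx k U v ->
  class_Cmx k U (fun x => normal_proj (A x) (F x) (v x)).
Proof.
move=> uh cA cF cv.
apply: (@class_Cmx_eq _ _ _ (fun x =>
   v x - v x *m A x *m (F x)^T *m invmx (F x *m A x *m (F x)^T) *m F x)).
  by move=> x _; rewrite normal_projE.
have cFT := class_Cmx_tr oU cF.
apply: class_CmxD => //; apply: class_CmxN.
apply: class_Cmx_mul => //; apply: class_Cmx_mul => //.
  by apply: class_Cmx_mul => //; exact: class_Cmx_mul.
apply: class_Cmx_inv => //.
by apply: class_Cmx_mul => //; exact: class_Cmx_mul.
Qed.

End regularity.

Section contraction_invariance.
Variable k : nat.
Implicit Types (h M P : 'M[R]_k).

Definition metric_trace h M : R := \sum_b \sum_c invmx h b c * M b c.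

Lemma metric_traceE h M : metric_trace h M = \tr (invmx h *m M^T).
Proof.
by rewrite /mxtrace; apply: eq_bigr => b _; rewrite mxE; apply: eq_bigr => c _; rewrite mxE.
Qed.

(** Both h and M are covariant, so the congruences cancel in
    tr (h^{-1} M^T). *)
Lemma metric_trace_congr h M P : P \in unitmx -> h \in unitmx ->
  metric_trace (P *m h *m P^T) (P *m M *m P^T) = metric_trace h M.
Proof.
move=> uP uh; have uPT : P^T \in unitmx by rewrite unitmx_tr.
rewrite !metric_traceE invmx_congr // !trmx_mul trmxK -!mulmxA mulKmx //.
by rewrite mxtrace_mulC -!mulmxA mulmxV // mulmx1.
Qed.

End contraction_invariance.

End local_tensors.

(** * Changes of charts for an immersed submanifold *)

Section manifolds.
Variable R : realType.

Section charts.
Variables (k : nat) (S : manifold R k).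

Lemma open_coord (a : chart S) (W : set S) : open W -> W `<=` dom a ->
  open (coord a @` W).
Proof.
move=> oW Wa; rewrite openE => x [p Wp <-] /=.
have ip : (coord a @` dom a) (coord a p) by exists p => //; exact: Wa.
have n1 : nbhs (coord a p) (coord a @` dom a).
  by apply: open_nbhs_nbhs; split=> //; exact: img_open.
have n2 : \forall y \near coord a p, W (param a y).
  apply: (param_cont ip); rewrite coordK; last exact: Wa.
  exact: open_nbhs_nbhs.
rewrite /interior; apply: filterS2 n1 n2 => y [q aq <-]; rewrite coordK // => Wq; exists q.
Qed.

Lemma class_C_transition (a a' : chart S) n :
  class_C n (coord a @` (dom a `&` dom a')) (transition a a').
Proof. exact: transition_smooth. Qed.

Lemma transition_coord (a a' : chart S) p : dom a p -> transition a a' (coord a p) = coord a' p.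
Proof. by move=> ap; rewrite /transition /= coordK. Qed.

Lemma open_overlap (a a' : chart S) : open (coord a @` (dom a `&` dom a')).
Proof. by apply: open_coord => [|q []//]; apply: openI; exact: dom_open. Qed.

Lemma differentiable_transition (a a' : chart S) p : dom a p -> dom a' p ->
  differentiable (transition a a') (coord a p).
Proof. by move=> ap ap'; case: (class_C_transition a a' 1) => + _; apply; exists p. Qed.

End charts.

Section submanifold_charts.
Variables (k m : nat) (S : manifold R k) (V : manifold R m) (F : S -> V).
Variables (g Q : chart V -> 'rV[R]_m -> 'M[R]_m) (L : chart V -> S -> 'rV[R]_m).
Hypothesis hg : pseudo_riemannian g.
Hypothesis hQ : two_form Q.
Hypothesis hF : immersion F.
Hypothesis hsp : spacelike g F.
Hypothesis hL : normal_field g F L.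
Implicit Types (a : chart S) (i : chart V) (p : S).

Definition chart_dom a i : set S := dom a `&` F @^-1` dom i.

Lemma open_chart_dom a i : open (chart_dom a i).
Proof.
apply: openI; first exact: dom_open.
by case: hF => /continuousP cF _; apply: cF; exact: dom_open.
Qed.

Lemma open_local_dom a i : open (local_dom F a i).
Proof. by apply: open_coord; [exact: open_chart_dom|move=> p []]. Qed.

Lemma local_mapE a i p : dom a p -> local_map F a i (coord a p) = coord i (F p).
Proof. by move=> ap; rewrite /local_map /= coordK. Qed.

Lemma local_dom_coord a i p : dom a p -> dom i (F p) -> local_dom F a i (coord a p).
Proof. by move=> ap ip; exists p. Qed.

Lemma local_map_img a i x : local_dom F a i x -> img i (local_map F a i x).
Proof. by case=> p [ap ip] <-; rewrite local_mapE //; exists (F p). Qed.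

Lemma open_img i : open (img i).
Proof. exact: img_open. Qed.

Lemma class_C_local_map n a i : class_C n (local_dom F a i) (local_map F a i).
Proof. by case: hF => _ /(_ a i)[+ _]; apply. Qed.

Lemma class_C_field n a i : class_C n (local_dom F a i) (L i \o param a).
Proof. by case: hL => -[/(_ a i n)]. Qed.

Lemma class_C_metric n i : class_C n (img i) (g i).
Proof. by case: hg => -[/(_ i n)]. Qed.

Lemma class_C_form n i : class_C n (img i) (Q i).
Proof. by case: hQ => -[/(_ i n)]. Qed.

Lemma metric_sym i y : img i y -> (g i y)^T = g i y.
Proof. by case: hg => _ /[apply] -[]. Qed.

Lemma metric_unit i y : img i y -> g i y \in unitmx.
Proof. by case: hg => _ /[apply] -[]. Qed.

Lemma form_skew i y : img i y -> (Q i y)^T = - Q i y.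
Proof. by case: hQ => _; apply. Qed.

Lemma frame_rowE a i x c : local_dom F a i x ->
  row c ('J (local_map F a i) x) = 'D_(basis_vec R c) (local_map F a i) x.
Proof.
move=> Ux; rewrite rowE deriveEjacobian //.
by case: (class_C_local_map 1 a i) => + _; apply.
Qed.

Lemma induced_metric_unit a i p : dom a p -> dom i (F p) ->
  induced_metric g F a i p \in unitmx.
Proof. by move=> ap ip; apply/posdef_unit/hsp. Qed.

Lemma normal_partE a i p v :
  normal_part g F a i p v = normal_proj (metric_at g F i p) (frame F a i p) v.
Proof. by []. Qed.

Lemma cov_alongE a i p w b : dom a p -> dom i (F p) ->
  cov_along g F a i p w b = cov (g i) (local_map F a i) w (basis_vec R b) (coord a p).
Proof.
move=> ap ip; rewrite covE local_mapE // /cov_along; congr (_ + gamma _ _ _ _).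
exact/frame_rowE/local_dom_coord.
Qed.

Definition frame_field a i c : 'rV[R]_k -> 'rV[R]_m :=
  fun x => row c ('J (local_map F a i) x).

Lemma class_C_frame_field n a i c : class_C n (local_dom F a i) (frame_field a i c).
Proof.
have oU := @open_local_dom a i.
have H := class_C_derive (basis_vec R c) oU (class_C_local_map n.+1 a i).
by apply: (class_C_eq oU _ H) => z Uz; rewrite -frame_rowE.
Qed.

(** The traces of [nabla_mx], [curvature_mx] and [normal_derivative_mx] with
    respect to the induced metric are the three terms of the divergence of the
    field X dual to Q(e_c, L); the trace of [gradient_mx] is <grad chi, X>. *)
Definition nabla_mx a i p : 'M[R]_k := \matrix_(b, c)
  nabla (g i) (Q i) (coord i (F p)) (row b (frame F a i p)) (row c (frame F a i p)) (L i p).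

Definition curvature_mx a i p : 'M[R]_k := \matrix_(b, c)
  bil (Q i (coord i (F p)))
    (normal_part g F a i p (cov_along g F a i p (frame_field a i c) b)) (L i p).

Definition normal_derivative_mx a i p : 'M[R]_k := \matrix_(b, c)
  bil (Q i (coord i (F p))) (row b (frame F a i p)) (normal_derivative g F a i p L c).

Definition gradient_mx (chi : S -> R) a i p : 'M[R]_k := \matrix_(b, c)
  ('D_(basis_vec R b) (chi \o param a) (coord a p)
   * bil (Q i (coord i (F p))) (row c (frame F a i p)) (L i p)).

Lemma differentiable_local_map a i p : dom a p -> dom i (F p) ->
  differentiable (local_map F a i) (coord a p).
Proof.
by move=> ap ip; case: (class_C_local_map 1 a i) => + _; apply; exact: local_dom_coord.
Qed.

Lemma near_overlap a a' i i' p (T : 'rV[R]_k -> Prop) :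
  dom a p -> dom a' p -> dom i (F p) -> dom i' (F p) ->
  (forall q, chart_dom a i q -> chart_dom a' i' q -> T (coord a q)) ->
  \forall x \near coord a p, T x.
Proof.
move=> ap ap' ip ip' H; have oW : open (coord a @` (chart_dom a i `&` chart_dom a' i')).
  by apply: open_coord; [apply: openI; exact: open_chart_dom|move=> q [[]]].
apply: (open_near oW); first by exists p.
by move=> z [q [q1 q2] <-]; exact: H.
Qed.

Lemma local_map_change a a' i i' p : dom a p -> dom a' p -> dom i (F p) -> dom i' (F p) ->
  \forall x \near coord a p,
    local_map F a' i' (transition a a' x) = transition i i' (local_map F a i x).
Proof.
move=> ap ap' ip ip'; apply: (near_overlap ap ap' ip ip') => q [aq iq] [aq' iq'].
by rewrite (transition_coord _ aq) !local_mapE // transition_coord.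
Qed.

Lemma frame_change a a' i i' p : dom a p -> dom a' p -> dom i (F p) -> dom i' (F p) ->
  frame F a i p *m 'J (transition i i') (coord i (F p)) =
  'J (transition a a') (coord a p) *m frame F a' i' p.
Proof.
move=> ap ap' ip ip'; apply/row_matrixP => b; rewrite !row_mul.
have ds := differentiable_transition ap ap'.
have df := differentiable_local_map ap ip.
have df' : differentiable (local_map F a' i') (transition a a' (coord a p)).
  by rewrite transition_coord //; exact: differentiable_local_map.
have Oy : (coord i @` (dom i `&` dom i')) (coord i (F p)) by exists (F p).
have Hb := derive_change Oy (class_C_transition i i' 2) (local_mapE i ap) ds df df'
  (local_map_change ap ap' ip ip') (basis_vec R b).
rewrite (_ : row b (frame F a i p) = 'D_(basis_vec R b) (local_map F a i) (coord a p)).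
  rewrite -Hb deriveEjacobian; last exact: df'.
  rewrite deriveEjacobian; last exact: ds.
  by rewrite -rowE transition_coord.
exact/frame_rowE/local_dom_coord.
Qed.

Section change_of_charts.
Variables (a a' : chart S) (i i' : chart V) (p : S).
Hypotheses (ap : dom a p) (ap' : dom a' p) (ip : dom i (F p)) (ip' : dom i' (F p)).
Let x := coord a p.
Let y := coord i (F p).
Let sigma := transition a a'.
Let tau := transition i i'.
Let P : 'M[R]_k := 'J sigma x.
Let J : 'M[R]_m := 'J tau y.
Let f := local_map F a i.
Let f' := local_map F a' i'.
Let O := coord i @` (dom i `&` dom i').

Let tauy : tau y = coord i' (F p). Proof. exact: transition_coord. Qed.
Let sigmax : sigma x = coord a' p. Proof. exact: transition_coord. Qed.
Let oO : open O. Proof. exact: open_overlap. Qed.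
Let Oy : O y. Proof. by exists (F p). Qed.
Let img_y : img i y. Proof. by exists (F p). Qed.
Let img_y' : img i' (tau y). Proof. by rewrite tauy; exists (F p). Qed.
Let dsigma : differentiable sigma x. Proof. exact: differentiable_transition. Qed.
Let df : differentiable f x. Proof. exact: differentiable_local_map. Qed.
Let df' : differentiable f' (sigma x).
Proof. by rewrite sigmax; exact: differentiable_local_map. Qed.
Let fx : f x = y. Proof. exact: local_mapE. Qed.
Let near_f : \near x, f' (sigma x) = tau (f x). Proof. exact: local_map_change. Qed.
Let frameE : frame F a i p *m J = P *m frame F a' i' p. Proof. exact: frame_change. Qed.

Let sym_near : \near y, (g i y)^T = g i y.
Proof. exact: open_near (@open_img i) img_y (@metric_sym i). Qed.

Let sym_near' : \forall z \near tau y, (g i' z)^T = g i' z.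
Proof. exact: open_near (@open_img i') img_y' (@metric_sym i'). Qed.

Let dg : differentiable (g i) y.
Proof. by case: (class_C_metric 1 i) => + _; apply. Qed.
Let dg' : differentiable (g i') (tau y).
Proof. by case: (class_C_metric 1 i') => + _; apply. Qed.
Let dQ : differentiable (Q i) y.
Proof. by case: (class_C_form 1 i) => + _; apply. Qed.
Let dQ' : differentiable (Q i') (tau y).
Proof. by case: (class_C_form 1 i') => + _; apply. Qed.

Let gE z : O z -> g i z = 'J tau z *m g i' (tau z) *m ('J tau z)^T.
Proof. by case: hg => -[_ H] _; exact: H. Qed.

Let QE z : O z -> Q i z = 'J tau z *m Q i' (tau z) *m ('J tau z)^T.
Proof. by case: hQ => -[_ H] _; exact: H. Qed.

Let LE : L i' p = L i p *m J.
Proof. by case: hL => -[_ H] _; exact: H. Qed.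

Lemma metric_change : metric_at g F i p = J *m metric_at g F i' p *m J^T.
Proof. by rewrite /metric_at (gE Oy) tauy. Qed.

Lemma induced_metric_change :
  induced_metric g F a i p = P *m induced_metric g F a' i' p *m P^T.
Proof. exact: gram_change metric_change frameE. Qed.

Lemma transition_unit : P \in unitmx.
Proof.
have := induced_metric_unit ap ip; rewrite induced_metric_change !unitmx_mul.
by case/andP => /andP[].
Qed.

Lemma normal_part_change v :
  normal_part g F a i p v *m J = normal_part g F a' i' p (v *m J).
Proof.
rewrite !normal_partE; apply: normal_proj_change metric_change frameE _.
exact: induced_metric_unit.
Qed.

Lemma form_change u v : bil (Q i y) u v = bil (Q i' (tau y)) (u *m J) (v *m J).
Proof. by rewrite (QE Oy) bil_pull. Qed.

Lemma row_frame_change b :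
  row b (frame F a i p) *m J = \sum_d P b d *: row d (frame F a' i' p).
Proof. by rewrite -row_mul frameE row_mul mulmx_sum_row; apply: eq_bigr => d _; rewrite mxE. Qed.

Lemma row_transition b : 'D_(basis_vec R b) sigma x = \sum_d P b d *: basis_vec R d.
Proof.
rewrite deriveEjacobian; last exact: dsigma.
rewrite -/P -rowE [LHS]row_sum_delta; apply: eq_bigr => d _.
by rewrite mxE.
Qed.

Lemma cov_along_field_change b :
  cov_along g F a i p (L i \o param a) b *m J =
  \sum_d P b d *: cov_along g F a' i' p (L i' \o param a') d.
Proof.
have dl a1 i1 : dom a1 p -> dom i1 (F p) -> differentiable (L i1 \o param a1) (coord a1 p).
  by move=> *; case: (class_C_field 1 a1 i1) => + _; apply; exact: local_dom_coord.
have dl' : differentiable (L i' \o param a') (sigma x) by rewrite sigmax; exact: dl.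
have nw : \near x, (L i' \o param a') (sigma x) = (L i \o param a) x *m 'J tau (f x).
  apply: (near_overlap ap ap' ip ip') => q [aq iq] [aq' iq'].
  rewrite /f (local_mapE _ aq) /sigma /= (transition_coord _ aq) (coordK aq) (coordK aq').
  by case: hL => -[_ H] _; exact: H.
rewrite (cov_alongE _ _ ap ip).
rewrite -(cov_change oO Oy (class_C_transition i i' 2) gE sym_near sym_near' (metric_unit img_y)
  (metric_unit img_y') dg dg' fx dsigma df df' near_f (dl _ _ ap ip) dl' nw).
rewrite row_transition (cov_sumdir _ _ _ _ df' dl').
by apply: eq_bigr => d _; rewrite cov_alongE // sigmax.
Qed.

(** The new frame is a combination of the old one with variable coefficients,
    so the Leibniz rule produces derivatives of the coefficients times frame
    vectors.  These are tangent and disappear in the normal component. *)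
Lemma curvature_change b c :
  normal_part g F a i p (cov_along g F a i p (frame_field a i c) b) *m J =
  \sum_d \sum_e (P c d * P b e) *:
     normal_part g F a' i' p (cov_along g F a' i' p (frame_field a' i' d) e).
Proof.
have dff a1 i1 c1 : dom a1 p -> dom i1 (F p) -> differentiable (frame_field a1 i1 c1) (coord a1 p).
  by move=> *; case: (class_C_frame_field 1 a1 i1 c1) => + _; apply; exact: local_dom_coord.
have dff' d : differentiable (frame_field a' i' d) (sigma x) by rewrite sigmax; exact: dff.
pose s d z := 'J sigma z c d.
have ds d : differentiable (s d) x.
  apply: (near_eq_differentiable (f := fun z => 'D_(basis_vec R c) sigma z 0 d)).
    apply: (near_overlap ap ap' ip ip') => q [aq iq] [aq' iq'].
    have Wq : (coord a @` (dom a `&` dom a')) (coord a q) by exists q.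
    rewrite deriveEjacobian; last by case: (class_C_transition a a' 1) => + _; apply.
    by rewrite /basis_vec -rowE mxE.
  have oW := @open_overlap _ S a a'.
  have [+ _] := class_C_entry 0 d oW (class_C_derive (basis_vec R c) oW (class_C_transition a a' 2)).
  by apply; exists p.
have dwd d : differentiable (frame_field a' i' d \o sigma) x.
  exact: differentiable_comp dsigma (dff' d).
(* The field e_c of the chart a, written along the submanifold in the
   coordinates of i' and in terms of the frame of a'. *)
pose w2 z := \sum_d s d z *: (frame_field a' i' d \o sigma) z.
have dw2 : differentiable w2 x.
  have -> : w2 = \sum_d (fun z => s d z *: (frame_field a' i' d \o sigma) z).
    by apply/funext => z; rewrite /w2 fct_sumE.
  by apply: differentiable_sum => d; exact: differentiable_scale.
have wE : \near x, w2 (idfun x) = frame_field a i c x *m 'J tau (f x).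
  apply: (near_overlap ap ap' ip ip') => q [aq iq] [aq' iq'].
  rewrite /w2 /s /= /frame_field /sigma /f /tau.
  rewrite -row_mul (local_mapE i aq) (frame_change aq aq' iq iq') row_mul mulmx_sum_row;
    apply: eq_bigr => d _; rewrite /frame /transition /= coordK //; congr (_ *: _); apply/esym; exact: mxE.
have nf : \near x, (f' \o sigma) (idfun x) = tau (f x) := near_f.
have d1 : differentiable idfun x by [].
have d2 : differentiable (f' \o sigma) x := differentiable_comp dsigma df'.
rewrite normal_part_change (cov_alongE _ _ ap ip).
rewrite -(cov_change oO Oy (class_C_transition i i' 2) gE sym_near sym_near' (metric_unit img_y)
  (metric_unit img_y') dg dg' fx d1 df d2 nf (dff a i c ap ip) dw2 wE).
rewrite derive_id.
have covd d : cov (g i') (f' \o sigma) (frame_field a' i' d \o sigma) (basis_vec R b) x =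
    \sum_e P b e *: cov_along g F a' i' p (frame_field a' i' d) e.
  rewrite (cov_comp _ _ dsigma df' (dff' d)) row_transition (cov_sumdir _ _ _ _ df' (dff' d)).
  have E e : cov (g i') f' (frame_field a' i' d) (basis_vec R e) (sigma x) =
      cov_along g F a' i' p (frame_field a' i' d) e.
    rewrite sigmax; apply/esym; exact: cov_alongE.
  apply: eq_bigr => e _; exact: (congr1 (fun v => P b e *: v) (E e)).
have ds' d : derivable (s d) x (basis_vec R b) by apply/diff_derivable/ds.
have dwd' d : derivable (frame_field a' i' d \o sigma) x (basis_vec R b).
  by apply/diff_derivable/dwd.
have -> : cov (g i') (f' \o sigma) w2 (basis_vec R b) (idfun x) = \sum_d
    ('D_(basis_vec R b) (s d) x *: row d (frame F a' i' p)
     + s d x *: \sum_e P b e *: cov_along g F a' i' p (frame_field a' i' d) e).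
  have H := cov_leibniz (g i') (f' \o sigma) (index_enum 'I_k) ds' dwd'.
  have rowd d : (frame_field a' i' d \o sigma) x = row d (frame F a' i' p).
    by rewrite /= /frame_field sigmax.
  apply: etrans H _; apply: eq_bigr => d _.
  exact: (congr2 (fun u v => 'D_(basis_vec R b) (s d) x *: u + s d x *: v) (rowd d) (covd d)).
rewrite big_split /= normal_partE normal_projD !normal_proj_sum big1 ?add0r; last first.
  by move=> d _; rewrite normal_proj_row ?scaler0 //; exact: induced_metric_unit.
apply: eq_bigr => d _; rewrite normal_proj_sum scaler_sumr.
by apply: eq_bigr => e _; rewrite scalerA.
Qed.

Lemma congr_mxE M b c : (P *m M *m P^T) b c = \sum_d \sum_e P b d * (P c e * M d e).
Proof.
rewrite mxE; under eq_bigr => d _ do rewrite mxE mulr_suml mxE.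
rewrite exchange_big /=; apply: eq_bigr => d _.
by apply: eq_bigr => e _; ring.
Qed.

Lemma nabla_mx_change : nabla_mx a i p = P *m nabla_mx a' i' p *m P^T.
Proof.
apply/matrixP => b c; rewrite congr_mxE [LHS]mxE.
have H := nabla_change oO Oy (class_C_transition i i' 2) gE sym_near sym_near' (metric_unit img_y)
  (metric_unit img_y') dg dg' (row b (frame F a i p)) (row c (frame F a i p)) (L i p) QE dQ dQ'.
rewrite H; clear H.
rewrite -(LE) !row_frame_change (tauy : transition i i' y = _).
rewrite nabla_sumX; last by rewrite -tauy; exact: dQ'.
apply: eq_bigr => d _; rewrite nabla_sumY mulr_sumr.
by apply: eq_bigr => e _; rewrite [nabla_mx a' i' p d e]mxE.
Qed.

Lemma curvature_mx_change : curvature_mx a i p = P *m curvature_mx a' i' p *m P^T.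
Proof.
apply/matrixP => b c; rewrite congr_mxE [LHS]mxE form_change curvature_change -LE tauy bil_suml.
under eq_bigr => d _ do rewrite bil_suml.
rewrite exchange_big /=; apply: eq_bigr => e _; apply: eq_bigr => d _.
by rewrite bilZl [curvature_mx a' i' p e d]mxE; ring.
Qed.

Lemma normal_derivative_mx_change :
  normal_derivative_mx a i p = P *m normal_derivative_mx a' i' p *m P^T.
Proof.
apply/matrixP => b c; rewrite congr_mxE [LHS]mxE form_change normal_part_change.
rewrite cov_along_field_change tauy row_frame_change normal_partE normal_proj_sum bil_suml.
apply: eq_bigr => d _; rewrite bilZl bil_sumr mulr_sumr; apply: eq_bigr => e _.
by rewrite bilZr [normal_derivative_mx a' i' p d e]mxE.
Qed.

Lemma gradient_mx_change chi : differentiable (chi \o param a') (coord a' p) ->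
  gradient_mx chi a i p = P *m gradient_mx chi a' i' p *m P^T.
Proof.
move=> dchi.
apply/matrixP => b c; rewrite congr_mxE [LHS]mxE form_change -LE tauy row_frame_change.
have dchi' : differentiable (chi \o param a') (sigma x) by rewrite sigmax.
have -> : 'D_(basis_vec R b) (chi \o param a) x =
    \sum_d P b d * 'D_(basis_vec R d) (chi \o param a') (coord a' p).
  rewrite (near_eq_derive (g := (chi \o param a') \o sigma)); last first.
    by apply: (near_overlap ap ap' ip ip') => q [aq iq] [aq' iq']; rewrite /sigma /transition /= !coordK.
  rewrite (derive_chain _ dsigma dchi') row_transition.
  by rewrite (derive_sumdir _ _ _ dchi') sigmax.
rewrite mulr_suml; apply: eq_bigr => d _; rewrite bil_suml mulr_sumr.
apply: eq_bigr => e _; rewrite bilZl [gradient_mx chi a' i' p d e]mxE; ring.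
Qed.

End change_of_charts.
End submanifold_charts.
End manifolds.

(** * Chart-independent traces *)

Section invariant_traces.
Variable R : realType.
Variables (k m : nat) (S : manifold R k) (V : manifold R m) (F : S -> V).
Variables (g Q : chart V -> 'rV[R]_m -> 'M[R]_m) (L : chart V -> S -> 'rV[R]_m).
Hypothesis hg : pseudo_riemannian g.
Hypothesis hQ : two_form Q.
Hypothesis hF : immersion F.
Hypothesis hsp : spacelike g F.
Hypothesis hL : normal_field g F L.
Implicit Types (a : chart S) (i : chart V) (p : S) (M : chart S -> chart V -> S -> 'M[R]_k).

Local Notation Nab := (nabla_mx F g Q L).
Local Notation Cur := (curvature_mx F g Q L).
Local Notation Nor := (normal_derivative_mx F g Q L).
Local Notation Grad := (gradient_mx F Q L).

Definition chart_tensor M : Prop := forall a a' i i' p,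
  dom a p -> dom a' p -> dom i (F p) -> dom i' (F p) ->
  M a i p = 'J (transition a a') (coord a p) *m M a' i' p *m
            ('J (transition a a') (coord a p))^T.

(** Evaluated in the selected charts, like the integrands; for a matrix
    satisfying [chart_tensor] any other charts give the same value. *)
Definition invariant_trace M p : R :=
  metric_trace (induced_metric g F (chart_at p) (chart_at (F p)) p)
               (M (chart_at p) (chart_at (F p)) p).

Lemma invariant_traceE M a i p : chart_tensor M -> dom a p -> dom i (F p) ->
  invariant_trace M p = metric_trace (induced_metric g F a i p) (M a i p).
Proof.
move=> tM ap ip; have ap' := chart_atP p; have ip' := chart_atP (F p).
rewrite /invariant_trace (tM _ a _ i p) //.
rewrite (induced_metric_change hg hF ap' ap ip' ip) metric_trace_congr //.
  exact: (transition_unit hg hF hsp ap' ap ip' ip).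
exact: induced_metric_unit.
Qed.

Lemma param_local a i x : local_dom F a i x ->
  [/\ dom a (param a x), dom i (F (param a x)) & coord a (param a x) = x].
Proof. by case=> p [ap ip] <-; rewrite coordK. Qed.

Lemma frame_param a i x : local_dom F a i x ->
  frame F a i (param a x) = 'J (local_map F a i) x.
Proof. by move=> /param_local[_ _ xE]; rewrite /frame xE. Qed.

Lemma induced_metric_param a i x : local_dom F a i x ->
  induced_metric g F a i (param a x) =
  'J (local_map F a i) x *m g i (local_map F a i x) *m ('J (local_map F a i) x)^T.
Proof. by move=> Ux; rewrite /induced_metric frame_param. Qed.

Lemma class_Cmx_frame n a i : class_Cmx n (local_dom F a i) (fun x => 'J (local_map F a i) x).
Proof.
move=> b c; have H := class_C_entry 0 c (open_local_dom hF (a := a) (i := i))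
  (class_C_frame_field hF n a i b).
apply: (class_C_eq (open_local_dom hF (a := a) (i := i)) _ H) => x _.
exact: mxE.
Qed.

Lemma class_Cmx_metric n a i : class_Cmx n (local_dom F a i) (fun x => g i (local_map F a i x)).
Proof.
apply: (@class_Cmx_comp _ _ _ _ (img i)); first exact: open_local_dom.
- by move=> x; exact: local_map_img.
- exact: class_C_local_map.
apply: class_C_mx; first exact: open_img.
exact: class_C_metric.
Qed.

Lemma class_Cmx_form n a i : class_Cmx n (local_dom F a i) (fun x => Q i (local_map F a i x)).
Proof.
apply: (@class_Cmx_comp _ _ _ _ (img i)); first exact: open_local_dom.
- by move=> x; exact: local_map_img.
- exact: class_C_local_map.
apply: class_C_mx; first exact: open_img.
exact: class_C_form.
Qed.

Lemma class_Cmx_field n a i : class_Cmx n (local_dom F a i) (L i \o param a).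
Proof. by apply: class_C_mx; [exact: open_local_dom|exact: (class_C_field hL)]. Qed.

Lemma class_Cmx_induced_metric n a i :
  class_Cmx n (local_dom F a i) (fun x => induced_metric g F a i (param a x)).
Proof.
have oU := open_local_dom hF (a := a) (i := i).
apply: (class_Cmx_eq oU (A := fun x =>
  'J (local_map F a i) x *m g i (local_map F a i x) *m ('J (local_map F a i) x)^T)).
  by move=> x Ux; exact: (esym (induced_metric_param Ux)).
have cJ := class_Cmx_frame n a i.
exact: (class_Cmx_mul oU (class_Cmx_mul oU cJ (class_Cmx_metric n a i)) (class_Cmx_tr oU cJ)).
Qed.

Definition chart_continuous M : Prop := forall a i b c,
  class_C 0 (local_dom F a i) (fun x => M a i (param a x) b c).

Lemma class_C_metric_trace a i M n :
  (forall b c, class_C n (local_dom F a i) (fun x => M a i (param a x) b c)) ->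
  class_C n (local_dom F a i)
    (fun x => metric_trace (induced_metric g F a i (param a x)) (M a i (param a x))).
Proof.
move=> cM; have oU := open_local_dom hF (a := a) (i := i).
have cI : class_Cmx n (local_dom F a i) (fun x => invmx (induced_metric g F a i (param a x))).
  apply: class_Cmx_inv => //; last exact: class_Cmx_induced_metric.
  by move=> x /param_local[ap ip _]; exact: induced_metric_unit.
apply: class_C_sum => // b _; apply: class_C_sum => // c _.
exact: class_CM.
Qed.

(** Around a point the charts selected there can be kept fixed, and the trace is
    then a continuous function of the coordinates. *)
Lemma invariant_trace_continuous M : chart_tensor M -> chart_continuous M ->
  continuous (invariant_trace M).
Proof.
move=> tM cM p; set a := chart_at p; set i := chart_at (F p).
have ap : dom a p := chart_atP p; have ip : dom i (F p) := chart_atP (F p).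
pose u x := metric_trace (induced_metric g F a i (param a x)) (M a i (param a x)).
have cu : {for coord a p, continuous u}.
  by apply: (class_C_metric_trace (cM a i)); exact: local_dom_coord.
have nE : \near p, u (coord a p) = invariant_trace M p.
  apply: (open_near (open_chart_dom hF a i)) => // q [aq iq].
  by rewrite (invariant_traceE tM aq iq) /u coordK.
rewrite /continuous_at -(nbhs_singleton nE).
apply: cvg_trans; first exact: near_eq_cvg nE.
exact: (@continuous_comp _ _ _ (coord a) u p (coord_cont ap) cu).
Qed.

Lemma nabla_mx_tensor : chart_tensor Nab.
Proof. by move=> *; exact: nabla_mx_change. Qed.

Lemma curvature_mx_tensor : chart_tensor Cur.
Proof. by move=> *; exact: curvature_mx_change. Qed.

Lemma normal_derivative_mx_tensor : chart_tensor Nor.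
Proof. by move=> *; exact: normal_derivative_mx_change. Qed.

Definition class_C1 (chi : S -> R) := forall a, class_C 1 (img a) (chi \o param a).

Lemma gradient_mx_tensor chi : class_C1 chi -> chart_tensor (Grad chi).
Proof.
move=> cchi a a' i i' p ap ap' ip ip'.
have dchi : differentiable (chi \o param a') (coord a' p).
  by have [+ _] := cchi a'; apply; exists p.
exact: (gradient_mx_change hQ hF hL ap ap' ip ip' dchi).
Qed.

Local Notation e b := (basis_vec R b).

Lemma cov_along_param a i x w b : local_dom F a i x ->
  cov_along g F a i (param a x) w b = cov (g i) (local_map F a i) w (e b) x.
Proof.
move=> Ux; have [ap ip xE] := param_local Ux.
by apply: etrans (cov_alongE g hF w b ap ip) _; rewrite xE.
Qed.

Lemma normal_part_param a i x v : local_dom F a i x ->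
  normal_part g F a i (param a x) v =
  normal_proj (g i (local_map F a i x)) ('J (local_map F a i) x) v.
Proof. by move=> Ux; rewrite normal_partE frame_param. Qed.

Lemma nabla_mx_param a i x b c : local_dom F a i x -> Nab a i (param a x) b c =
  nabla (g i) (Q i) (local_map F a i x) (row b ('J (local_map F a i) x))
    (row c ('J (local_map F a i) x)) (L i (param a x)).
Proof. by move=> Ux; rewrite mxE frame_param. Qed.

Lemma curvature_mx_param a i x b c : local_dom F a i x -> Cur a i (param a x) b c =
  bil (Q i (local_map F a i x)) (normal_proj (g i (local_map F a i x)) ('J (local_map F a i) x)
    (cov (g i) (local_map F a i) (frame_field F a i c) (e b) x)) (L i (param a x)).
Proof.
move=> Ux; rewrite mxE (normal_part_param _ Ux).
exact: (congr1 (fun v => bil (Q i (local_map F a i x)) (normal_proj (g i (local_map F a i x))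
  ('J (local_map F a i) x) v) (L i (param a x))) (cov_along_param (frame_field F a i c) b Ux)).
Qed.

Lemma normal_derivative_mx_param a i x b c : local_dom F a i x -> Nor a i (param a x) b c =
  bil (Q i (local_map F a i x)) (row b ('J (local_map F a i) x))
   (normal_proj (g i (local_map F a i x)) ('J (local_map F a i) x)
    (cov (g i) (local_map F a i) (L i \o param a) (e c) x)).
Proof.
move=> Ux; rewrite mxE /normal_derivative (normal_part_param _ Ux) (frame_param Ux).
exact: (congr1 (fun v => bil (Q i (local_map F a i x)) (row b ('J (local_map F a i) x))
  (normal_proj (g i (local_map F a i x)) ('J (local_map F a i) x) v))
  (cov_along_param (L i \o param a) c Ux)).
Qed.

Lemma nabla_mx_continuous : chart_continuous Nab.
Proof.
move=> a i b c; have oU := open_local_dom hF (a := a) (i := i).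
apply: (class_C_eq oU (fun x Ux => esym (nabla_mx_param b c Ux))).
apply: (class_C_nabla oU (@open_img _ _ V i) (O := img i)).
- exact: metric_unit.
- exact: class_C_metric.
- exact: local_map_img.
- exact: class_C_local_map.
- exact: class_C_form.
- by apply: class_Cmx_row => //; exact: class_Cmx_frame.
- by apply: class_Cmx_row => //; exact: class_Cmx_frame.
- exact: class_Cmx_field.
Qed.

Lemma class_Cmx_normal_part a i (w : 'rV[R]_k -> 'rV[R]_m) u : class_C 1 (local_dom F a i) w ->
  class_Cmx 0 (local_dom F a i) (fun x => normal_proj (g i (local_map F a i x))
    ('J (local_map F a i) x) (cov (g i) (local_map F a i) w u x)).
Proof.
move=> cw; have oU := open_local_dom hF (a := a) (i := i).
apply: class_Cmx_normal_proj => //.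
- move=> x Ux; have [ap ip _] := param_local Ux.
  by rewrite -induced_metric_param //; exact: induced_metric_unit.
- exact: class_Cmx_metric.
- exact: class_Cmx_frame.
exact: (class_Cmx_cov oU (@open_img _ _ V i) (metric_unit hg (i := i)) (class_C_metric hg 1 i)
  (@local_map_img _ _ _ _ _ F a i) (class_C_local_map hF 1 a i) u cw).
Qed.

Lemma curvature_mx_continuous : chart_continuous Cur.
Proof.
move=> a i b c; have oU := open_local_dom hF (a := a) (i := i).
apply: (class_C_eq oU (fun x Ux => esym (curvature_mx_param b c Ux))).
apply: class_C_bil => //; first exact: class_Cmx_form.
  by apply: class_Cmx_normal_part; exact: class_C_frame_field.
exact: class_Cmx_field.
Qed.

Lemma normal_derivative_mx_continuous : chart_continuous Nor.
Proof.
move=> a i b c; have oU := open_local_dom hF (a := a) (i := i).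
apply: (class_C_eq oU (fun x Ux => esym (normal_derivative_mx_param b c Ux))).
apply: class_C_bil => //; first exact: class_Cmx_form.
  by apply: class_Cmx_row => //; exact: class_Cmx_frame.
exact: (@class_Cmx_normal_part a i (L i \o param a) (e c) (class_C_field hL 1 a i)).
Qed.

Lemma gradient_mx_param chi a i x b c : local_dom F a i x -> Grad chi a i (param a x) b c =
  'D_(e b) (chi \o param a) x *
  bil (Q i (local_map F a i x)) (row c ('J (local_map F a i) x)) (L i (param a x)).
Proof.
by move=> Ux; have [_ _ xE] := param_local Ux; rewrite mxE frame_param // xE.
Qed.

Definition density a i x : R := Num.sqrt (\det (induced_metric g F a i (param a x))).

(** The vector density sqrt (det h) X^b, where X is the field dual to
    Q(e_c, L). *)
Definition flux a i b x : R := density a i x *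
  (invmx (induced_metric g F a i (param a x)) *m
   pairing (local_map F a i) (L i \o param a) (Q i) (fun y => 'J (local_map F a i) y) x) b 0.

(** The sum of the three terms; [flux_divergence] identifies it with
    div X. *)
Definition divergence p : R :=
  invariant_trace Nab p + invariant_trace Cur p + invariant_trace Nor p.

Lemma det_induced_metric_gt0 a i x : local_dom F a i x ->
  0 < \det (induced_metric g F a i (param a x)).
Proof. by case/param_local => ap ip _; exact/posdef_det/hsp. Qed.

Lemma density_gt0 a i x : local_dom F a i x -> 0 < density a i x.
Proof. by move=> Ux; rewrite sqrtr_gt0 det_induced_metric_gt0. Qed.

Lemma class_C_density n a i : class_C n (local_dom F a i) (density a i).
Proof.
have oU := open_local_dom hF (a := a) (i := i).
apply: class_C_sqrt => //; first by move=> x; exact: det_induced_metric_gt0.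
by apply: class_C_det => //; exact: class_Cmx_induced_metric.
Qed.

Lemma class_C_flux n a i b : class_C n (local_dom F a i) (flux a i b).
Proof.
have oU := open_local_dom hF (a := a) (i := i).
apply: class_CM => //; first exact: class_C_density.
apply: class_Cmx_mul => //.
  apply: class_Cmx_inv => //; last exact: class_Cmx_induced_metric.
  by move=> x /param_local[ap ip _]; exact: induced_metric_unit.
move=> c j.
have cJ := class_Cmx_row oU c (class_Cmx_frame n a i).
apply: (class_C_eq oU _ (class_C_bil oU (class_Cmx_form n a i) cJ (class_Cmx_field n a i))).
by move=> x _; rewrite mxE.
Qed.

Lemma flux_divergence a i x : local_dom F a i x ->
  \sum_b 'D_(e b) (flux a i b) x = density a i x * divergence (param a x).
Proof.
move=> Ux; have oU := open_local_dom hF (a := a) (i := i).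
pose h y := 'J (local_map F a i) y *m g i (local_map F a i y) *m ('J (local_map F a i) y)^T.
pose X := pairing (local_map F a i) (L i \o param a) (Q i) (fun y => 'J (local_map F a i) y).
have hE y : local_dom F a i y -> induced_metric g F a i (param a y) = h y.
  by move=> Uy; exact: induced_metric_param.
have fE b : 'D_(e b) (flux a i b) x =
    'D_(e b) (fun y => Num.sqrt (\det (h y)) * (invmx (h y) *m X y) b 0) x.
  apply: near_eq_derive; apply: (open_near oU Ux) => y Uy.
  by rewrite /flux /density (hE y Uy).
under eq_bigr => b _ do rewrite fE.
have [ap ip xE] := param_local Ux.
have ph y : local_dom F a i y -> posdef (h y).
  by move=> Uy; have [aq iq _] := param_local Uy; rewrite -(hE y Uy); exact: hsp.
have nl y c : local_dom F a i y ->
    bil (g i (local_map F a i y)) ((L i \o param a) y) (row c ('J (local_map F a i) y)) = 0.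
  move=> Uy; have [aq iq _] := param_local Uy; rewrite -(frame_param Uy).
  by case: hL => _ H; exact: (H a i (param a y) aq iq c).
have fr y c : local_dom F a i y ->
    row c ('J (local_map F a i) y) = 'D_(e c) (local_map F a i) y.
  by move=> Uy; exact: frame_rowE.
have H := divergence_identity oU (@open_img _ _ V i) (@local_map_img _ _ _ _ _ F a i)
  (class_C_local_map hF 2 a i) (class_C_field hL 1 a i) (class_C_metric hg 1 i)
  (class_C_form hQ 1 i) (metric_sym hg (i := i)) (metric_unit hg (i := i))
  (form_skew hQ (i := i)) fr ph nl Ux.
apply: etrans H _.
rewrite /density (hE x Ux) -/(h x); congr (_ * _).
rewrite /divergence (invariant_traceE nabla_mx_tensor ap ip)
  (invariant_traceE curvature_mx_tensor ap ip) (invariant_traceE normal_derivative_mx_tensor ap ip).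
rewrite /metric_trace (hE x Ux) -!big_split; apply: eq_bigr => b _.
rewrite -!big_split; apply: eq_bigr => c _.
rewrite (nabla_mx_param b c Ux) (curvature_mx_param b c Ux) (normal_derivative_mx_param b c Ux).
by rewrite !mulrDr.
Qed.

Lemma flux_gradient chi a i x : class_C1 chi -> local_dom F a i x ->
  \sum_b 'D_(e b) (chi \o param a) x * flux a i b x =
  density a i x * invariant_trace (Grad chi) (param a x).
Proof.
move=> cchi Ux; have [ap ip xE] := param_local Ux.
rewrite (invariant_traceE (gradient_mx_tensor cchi) ap ip) mulr_sumr; apply: eq_bigr => b _.
rewrite /flux mulrCA; congr (_ * _); rewrite mxE mulr_sumr; apply: eq_bigr => c _.
by rewrite (gradient_mx_param chi b c Ux) mxE mulrCA.
Qed.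

(** The product rule div (chi X) = chi div X + <grad chi, X>. *)
Lemma localized_flux_divergence chi a i x : class_C1 chi -> local_dom F a i x ->
  \sum_b 'D_(e b) (fun y => (chi \o param a) y * flux a i b y) x =
  density a i x *
    (chi (param a x) * divergence (param a x) + invariant_trace (Grad chi) (param a x)).
Proof.
move=> cchi Ux.
have dchi : differentiable (chi \o param a) x.
  by have [+ _] := cchi a; apply; case: Ux => p [ap _] <-; exists p.
have dflux b : differentiable (flux a i b) x.
  by have [+ _] := class_C_flux 1 a i b; apply.
have E b : 'D_(e b) (fun y => (chi \o param a) y * flux a i b y) x =
    'D_(e b) (chi \o param a) x * flux a i b x + chi (param a x) * 'D_(e b) (flux a i b) x.
  exact: (deriveMf (@diff_derivable _ _ _ _ _ (e b) dchi) (@diff_derivable _ _ _ _ _ (e b) (dflux b))).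
under eq_bigr => b _ do rewrite E.
rewrite big_split /= (flux_gradient cchi Ux) -mulr_sumr (flux_divergence Ux).
by rewrite [RHS]mulrDr addrC; congr (_ + _); exact: mulrCA.
Qed.

Lemma Q_mean_curvatureE p : Q_mean_curvature g F Q L p = invariant_trace Cur p.
Proof.
rewrite /Q_mean_curvature /mean_curvature bil_suml; apply: eq_bigr => b _.
by rewrite bil_suml; apply: eq_bigr => c _; rewrite bilZl [in RHS]mxE.
Qed.

Lemma Q_normal_derivativeE p : Q_normal_derivative g F Q L p = invariant_trace Nor p.
Proof.
by apply: eq_bigr => b _; apply: eq_bigr => c _; rewrite [in RHS]mxE.
Qed.

Lemma sum_invmx_diag (h : 'M[R]_k) : h \in unitmx -> h^T = h ->
  \sum_b \sum_c invmx h b c * h b c = k%:R.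
Proof.
move=> uh sh; transitivity (\tr (invmx h *m h)).
  by apply: eq_bigr => b _; rewrite mxE; apply: eq_bigr => c _; rewrite -{2}sh mxE.
by rewrite mulVmx // mxtrace1.
Qed.


Lemma transition_diag a p : dom a p -> 'J (transition a a) (coord a p) = 1%:M.
Proof.
move=> ap; apply/row_matrixP => b; rewrite row1 rowE.
have W : (coord a @` (dom a `&` dom a)) (coord a p) by exists p.
have dt : differentiable (transition a a) (coord a p).
  by have [+ _] := class_C_transition a a 1; apply.
rewrite -(deriveEjacobian (e b) dt) (near_eq_derive (g := id)); first by rewrite derive_id.
apply: (open_near (open_coord (dom_open a) (@subset_refl _ _)) (ex_intro2 _ _ p ap erefl)).
by move=> _ [q aq <-]; rewrite /transition /= coordK.
Qed.

(** The volume density is prescribed in the ambient chart selected at each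
    point; this allows a single ambient chart to be used on a whole coordinate
    ball. *)
Lemma induced_metric_ambient a i i' p : dom a p -> dom i (F p) -> dom i' (F p) ->
  induced_metric g F a i p = induced_metric g F a i' p.
Proof.
move=> ap ip ip'; rewrite (induced_metric_change hg hF ap ap ip ip').
by rewrite transition_diag // mul1mx trmx1 mulmx1.
Qed.

Lemma induced_volume_local (mu : {measure set (borel S) -> \bar R}) a i (f : S -> R) :
  induced_volume g F mu -> continuous f -> (forall p, 0 <= f p) ->
  (forall p, ~ chart_dom F a i p -> f p = 0) ->
  (\int[mu]_p (f p)%:E)%E =
  integral_rV ((fun x => (f (param a x) * density a i x)%:E) \_ (local_dom F a i)).
Proof.
move=> hmu cf f0 fD.
have mf : measurable_fun (dom a : set (borel S)) (EFin \o (f : borel S -> R)).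
  apply/measurable_EFinP; apply: measurable_funTS; exact: continuous_borel_measurable.
have H := hmu a _ mf (fun p => f0 p : (0 <= (EFin \o f) p)%E).
rewrite (_ : (\int[mu]_p (f p)%:E)%E =
  (\int[mu]_(p in (dom a : set (borel S))) (EFin \o (f : borel S -> R)) p)%E); last first.
  rewrite [RHS]integral_mkcond; apply: eq_integral => p _.
  rewrite patchE; case: ifPn => // /negP nap; rewrite fD // => -[ap _].
  by apply: nap; exact/mem_set.
rewrite H; apply: eq_integral_rV => x.
have [[p ap px]|nx] := pselect (img a x); last first.
  rewrite !patchE memNset // memNset // => -[p [ap _] px].
  by apply: nx; exists p.
have ix : img a x by exists p.
transitivity (f p * Num.sqrt (\det (induced_metric g F a (chart_at (F p)) p)))%:E.
  by rewrite patchE (mem_set ix) -px coordK.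
rewrite -px.
have [ip|nip] := pselect (dom i (F p)).
  rewrite patchE (mem_set (local_dom_coord ap ip)) /density (coordK ap).
  by rewrite (induced_metric_ambient ap ip (chart_atP (F p))).
rewrite (fD p) => [|[]//]; rewrite mul0r patchE memNset // => -[q [aq iq] qp].
by apply: nip; rewrite -(coordK ap) -qp coordK.
Qed.

End invariant_traces.

Section conformal_killing_yano_trace.
Variables (R : realType) (k n : nat) (S : manifold R k) (V : manifold R n.+1) (F : S -> V).
Variables (g Q : chart V -> 'rV[R]_n.+1 -> 'M[R]_n.+1) (L : chart V -> S -> 'rV[R]_n.+1).

(** The inverse metric is symmetric, so twice the trace only involves the
    symmetrization of (D_b Q)(e_c, L) in b and c, given by the conformal
    Killing-Yano equation.  The terms with <e_b, L> vanish, and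
    h^{bc} h_{bc} = k. *)
Lemma nabla_trace p : pseudo_riemannian g -> spacelike g F -> normal_field g F L ->
  conformal_killing_yano g Q ->
  invariant_trace F g (nabla_mx F g Q L) p = k%:R / n%:R * xi_dot g F Q L p.
Proof.
move=> hg hsp hL [_ cky].
set a := chart_at p; set i := chart_at (F p).
have ap : dom a p := chart_atP p; have ip : dom i (F p) := chart_atP (F p).
have iy : img i (coord i (F p)) by exists (F p).
have sG := metric_sym hg iy.
pose h := induced_metric g F a i p.
have uh : h \in unitmx by exact: induced_metric_unit.
have hE b c : h b c = bil (metric_at g F i p) (row b (frame F a i p)) (row c (frame F a i p)).
  exact: gram_entry.
have sh : h^T = h by apply/matrixP => b c; rewrite mxE !hE; exact: bil_sym.
have sI b c : invmx h b c = invmx h c b by rewrite -[in LHS]sh -trmx_inv mxE.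
pose N b c := nabla_mx F g Q L a i p b c.
pose xi := xi_dot g F Q L p.
have NE b c : N b c + N c b = 2 / n%:R * (h b c * xi).
  have nE b' c' : N b' c' = nabla (g i) (Q i) (coord i (F p)) (row b' (frame F a i p))
      (row c' (frame F a i p)) (L i p) by exact: mxE.
  rewrite !nE (cky i _ iy) hE.
  have nl d : bil (g i (coord i (F p))) (row d (frame F a i p)) (L i p) = 0.
    by rewrite bil_sym //; case: hL => _ H; exact: (H a i p ap ip d).
  by rewrite !nl !mul0r !mulr0 !subr0.
have E : 2 * invariant_trace F g (nabla_mx F g Q L) p = 2 * (k%:R / n%:R * xi).
  transitivity (\sum_b \sum_c invmx h b c * (N b c + N c b)).
    under [RHS]eq_bigr => b _ do (under eq_bigr => c _ do rewrite mulrDr; rewrite big_split /=).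
    rewrite big_split /= mulr_natl mulr2n; congr (_ + _).
    rewrite exchange_big; apply: eq_bigr => b _; apply: eq_bigr => c _ /=.
    by rewrite sI.
  rewrite -(sum_invmx_diag uh sh) !mulr_suml mulr_sumr; apply: eq_bigr => b _.
  rewrite !mulr_suml mulr_sumr; apply: eq_bigr => c _; rewrite NE; ring.
by apply: (mulfI _ E); rewrite pnatr_eq0.
Qed.

End conformal_killing_yano_trace.

(** * Partition of unity and the divergence theorem *)

Section bump.
Variable R : realType.

(** A C^1 function suffices, so the bumps are built from the square of the
    positive part. *)
Definition pos_sq (t : R) : R := Num.max 0 t ^+ 2.

Lemma maxr2 (t : R) : 2 * Num.max 0 t = t + `|t|.
Proof. by case: (lerP 0 t) => t0; rewrite ?(ger0_norm t0) ?(ltr0_norm t0); ring. Qed.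

Lemma pos_sq_expand (t h : R) :
  `|pos_sq (h + t) - pos_sq t - h * (2 * Num.max 0 t)| <= h ^+ 2.
Proof.
rewrite /pos_sq; case: (lerP 0 (h + t)) => [th|th];
  case: (lerP 0 t) => [t0|t0].
- by rewrite (_ : _ - _ - _ = h ^+ 2) ?ger0_norm ?sqr_ge0 //; ring.
- by rewrite ler_norml; apply/andP; split; nra.
- by rewrite ler_norml; apply/andP; split; nra.
by rewrite !expr0n /= mulr0 mulr0 !subr0 normr0 sqr_ge0.
Qed.

Lemma is_derive_pos_sq (t : R) : is_derive t (1 : R) pos_sq (2 * Num.max 0 t).
Proof.
have C : (fun h => h^-1 *: (pos_sq (h *: (1 : R) + t) - pos_sq t)) h @[h --> 0^'] -->
    2 * Num.max 0 t.
  apply/cvgrPdist_le => e e0; near=> h.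
  have h0 : h != 0 by near: h; exact: nbhs_dnbhs_neq.
  have he : `|h| <= e.
    near: h; apply: nbhs_dnbhs; near=> h; near: h.
    have := @cvg_id _ (nbhs (0 : R)) => /cvgrPdist_le/(_ e e0).
    by apply: filterS => h; rewrite sub0r normrN.
  apply: le_trans he; rewrite -normrN opprB.
  have -> : h^-1 *: (pos_sq (h *: 1 + t) - pos_sq t) - 2 * Num.max 0 t =
      h^-1 * (pos_sq (h + t) - pos_sq t - h * (2 * Num.max 0 t)).
    by rewrite -[h *: 1]/(h * 1) mulr1 [RHS]mulrBr mulKf.
  rewrite normrM normfV ler_pdivrMl ?normr_gt0 //.
  by apply: le_trans (pos_sq_expand _ _) _; rewrite -expr2 -normrX ger0_norm // sqr_ge0.
by split; [exact: (cvgP _ C)|exact: cvg_lim C].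
Unshelve. all: end_near. Qed.

Lemma class_C1_pos_sq m (U : set 'rV[R]_m) (f : 'rV[R]_m -> R) : open U ->
  class_C 1 U f -> class_C 1 U (fun x => pos_sq (f x)).
Proof.
move=> oU cf; have [df Df] := cf.
have ds (y : R) : differentiable pos_sq y.
  by apply/derivable1_diffP; case: (is_derive_pos_sq y).
split=> [x Ux|i]; first exact: differentiable_comp (df x Ux) (ds _).
have cM : class_C 0 U (fun x => f x + `|f x|).
  move=> x Ux; have cx := differentiable_continuous (df x Ux).
  exact: (cvgD cx (cvg_norm cx)).
have E x : U x -> 'D_(basis_vec R i) f x * (f x + `|f x|) =
    'D_(basis_vec R i) (fun x => pos_sq (f x)) x; last first.
  exact: (@class_C_eq _ _ _ 0 _ _ _ oU E (@class_CM _ _ 0 _ _ _ oU (Df i) cM)).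
move=> Ux.
transitivity ('D_('D_(basis_vec R i) f x) pos_sq (f x)); last first.
  by rewrite -(derive_chain _ (df x Ux) (ds _)).
rewrite (deriveE _ (ds _)) -[X in 'd _ _ X]mulr1 -[X in 'd _ _ X]/(_ *: (1 : R)).
rewrite linearZ /= -deriveE //; congr (_ * _).
by case: (is_derive_pos_sq (f x)) => _ ->; exact: (esym (maxr2 _)).
Qed.

Variables (k : nat) (x0 : 'rV[R]_k) (r : R).

Definition bump (x : 'rV[R]_k) : R := pos_sq (r ^+ 2 - \sum_l (x 0 l - x0 0 l) ^+ 2).

Lemma class_C1_bump : class_C 1 [set: 'rV[R]_k] bump.
Proof.
apply: class_C1_pos_sq; first exact: openT.
have cl l : class_C 1 [set: 'rV[R]_k] (fun x => x 0 l - x0 0 l).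
  split=> [x _|i].
    by apply: differentiableB; [exact: differentiable_coord|exact: differentiable_cst].
  apply: (@class_C_eq _ _ _ 0 _ (fun=> (i == l)%:R : R) _ openT _ (class_C_cst _ _ _)).
  move=> x _.
  have d : differentiable (fun x : 'rV[R]_k => x 0 l) x by exact: differentiable_coord.
  have D1 := @diff_derivable _ _ _ _ _ (basis_vec R i) d.
  apply: etrans _ (esym (deriveB D1 (derivable_cst _ _ _))).
  rewrite derive_cst subr0 (derive_entry 0 l (@derivable_id _ _ x (basis_vec R i))).
  by rewrite derive_id mxE eqxx eq_sym.
apply: class_CB; [exact: openT|exact: class_C_cst|].
apply: class_C_sum; first exact: openT.
by move=> l _; exact: (class_CM openT (cl l) (cl l)).
Qed.

Lemma bump_ge0 x : 0 <= bump x.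
Proof. exact: sqr_ge0. Qed.

Lemma bump_center : 0 < r -> 0 < bump x0.
Proof.
move=> r0; rewrite /bump big1 ?subr0; last by move=> l _; rewrite subrr expr0n.
by rewrite /pos_sq (max_idPr (sqr_ge0 r)) !exprn_gt0.
Qed.

(** The norm is the maximum of the coordinates, and it is at most the Euclidean
    norm, in which the support is a ball. *)
Lemma bump_far x : 0 < r -> r < `|x0 - x| -> bump x = 0.
Proof.
move=> r0 xr; have [l lr] : exists l, r < `|x0 0 l - x 0 l|.
  apply: contrapT => /forallNP H; move: xr; apply/negP; rewrite -leNgt.
  rewrite [leLHS]/Num.norm /= mx_normrE; apply: bigmax_le; first exact: ltW.
  by move=> [i l] _ /=; rewrite ord1 !mxE leNgt; apply/negP/H.
rewrite /bump /pos_sq (max_idPl _) ?expr0n // subr_le0.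
rewrite (bigD1 l) //= -[leLHS]addr0 lerD //; last by apply: sumr_ge0 => *; exact: sqr_ge0.
rewrite -normrN opprB in lr.
by rewrite -(real_normK (num_real (x 0 l - _))) lerXn2r ?nnegrE ?normr_ge0 ?ltW.
Qed.

End bump.

Section finite_sums.
Context {d : measure_display} {T : measurableType d} {R : realType}.
Variable mu : {measure set T -> \bar R}.

Lemma Rintegral_sum (I : Type) (s : seq I) (f : I -> T -> R) :
  (forall j, mu.-integrable setT (EFin \o f j)) ->
  mu.-integrable setT (EFin \o (fun x => \sum_(j <- s) f j x)) /\
  \int[mu]_x (\sum_(j <- s) f j x) = \sum_(j <- s) \int[mu]_x f j x.
Proof.
move=> If; elim: s => [|j s [IH1 IH2]].
  have E : (fun x : T => \sum_(j <- [::]) f j x) = cst 0 by apply/funext => x; rewrite big_nil.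
  rewrite E big_nil; split; first exact: integrable0.
  by rewrite /Rintegral integral0.
have E : (fun x : T => \sum_(i <- j :: s) f i x) = (fun x => f j x + \sum_(i <- s) f i x).
  by apply/funext => x; rewrite big_cons.
rewrite E big_cons RintegralD // IH2; split=> //.
exact: (integrableD measurableT (If j) IH1).
Qed.

End finite_sums.

Section compact_submanifold.
Variable R : realType.
Variables (k m : nat) (S : manifold R k) (V : manifold R m) (F : S -> V).
Variables (g Q : chart V -> 'rV[R]_m -> 'M[R]_m) (L : chart V -> S -> 'rV[R]_m).
Hypothesis hg : pseudo_riemannian g.
Hypothesis hQ : two_form Q.
Hypothesis hF : immersion F.
Hypothesis hsp : spacelike g F.
Hypothesis hL : normal_field g F L.
Variable mu : {measure set (borel S) -> \bar R}.
Hypothesis hmu : induced_volume g F mu.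
Hypothesis cS : compact [set: S].

Local Notation Grad := (gradient_mx F Q L).
Local Notation trace := (invariant_trace F g).
Local Notation div := (divergence F g Q L).
Local Notation e b := (basis_vec R b).

(** Derivatives are local, so an equality near p is enough. *)
Lemma gradient_trace_local (chi eta : S -> R) (W : set S) p : open W -> W p ->
  (forall q, W q -> chi q = eta q) -> trace (Grad chi) p = trace (Grad eta) p.
Proof.
move=> oW Wp ce; set a := chart_at p; set i := chart_at (F p).
have ap : dom a p := chart_atP p.
have nE : \forall x \near coord a p, (chi \o param a) x = (eta \o param a) x.
  have oWa : open (coord a @` (dom a `&` W)).
    by apply: open_coord => [|q []//]; apply: openI => //; exact: dom_open.
  apply: (open_near oWa); first by exists p.
  by move=> _ [q [aq Wq] <-] /=; rewrite coordK // ce.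
apply: eq_bigr => b _; apply: eq_bigr => c _; congr (_ * _).
by rewrite !mxE (near_eq_derive (e b) nE).
Qed.

Lemma gradient_trace_cst (t : R) p : trace (Grad (fun=> t)) p = 0.
Proof.
apply: big1 => b _; apply: big1 => c _; rewrite mxE.
rewrite (_ : (fun=> t) \o param _ = cst t); last by [].
by rewrite derive_cst mul0r mulr0.
Qed.

Lemma gradient_trace_sum (I : Type) (s : seq I) (chi : I -> S -> R) p :
  (forall j, class_C1 (chi j)) ->
  trace (Grad (fun q => \sum_(j <- s) chi j q)) p = \sum_(j <- s) trace (Grad (chi j)) p.
Proof.
move=> cchi; set a := chart_at p; set i := chart_at (F p).
have ap : dom a p := chart_atP p.
have dchi j b : derivable (chi j \o param a) (coord a p) (e b).
  apply: diff_derivable.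
  by have [+ _] := cchi j a; apply; exists p.
rewrite /invariant_trace -/a -/i /metric_trace exchange_big /= exchange_big /=.
rewrite [RHS]exchange_big /=; apply: eq_bigr => b _.
rewrite [RHS]exchange_big /=; apply: eq_bigr => c _.
rewrite -mulr_sumr; congr (_ * _); rewrite mxE.
under [RHS]eq_bigr => j _ do rewrite mxE.
rewrite -mulr_suml; congr (_ * _).
by rewrite -(derive_sumf s (fun j => dchi j b)).
Qed.

Section supported_in_a_ball.
Variables (a : chart S) (i : chart V) (x0 : 'rV[R]_k) (r : R).
Hypothesis r0 : 0 < r.
Hypothesis ballU : forall x, `|x0 - x| <= 2 * r -> local_dom F a i x.
Let U := local_dom F a i.
Let D := chart_dom F a i.
Let K := [set x : 'rV[R]_k | `|x0 - x| <= r].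

Definition supported_in_ball (chi : S -> R) : Prop :=
  forall p, chi p != 0 -> D p /\ `|x0 - coord a p| <= r.

Let Da : D `<=` dom a. Proof. by move=> p []. Qed.

Lemma ball_local : K `<=` U.
Proof. by move=> x xr; apply: ballU; apply: le_trans xr _; rewrite ler_peMl ?ler1n ?ltW. Qed.

Lemma open_ball_complement : open (~` (param a @` K)).
Proof.
apply: closed_openC; apply: compact_closed; first exact: manifold_hausdorff.
apply: continuous_compact; last exact: compact_ball.
apply: continuous_in_subspaceT => x /set_mem /ball_local [q [aq _] <-].
by apply: param_cont; exists q.
Qed.

Lemma supported0 chi p : supported_in_ball chi -> (~` (param a @` K)) p -> chi p = 0.
Proof.
move=> sc nKp; apply/eqP; apply: contraPT nKp => /sc[[ap ip] pr]; apply.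
by exists (coord a p) => //; exact: coordK.
Qed.

Lemma notin_ball p : ~ D p -> (~` (param a @` K)) p.
Proof.
by move=> nDp [x Kx xp]; apply: nDp; rewrite -xp; have [] := param_local (ball_local Kx).
Qed.

(** The space is covered by U and by the complement of the ball, on which the
    extension is zero. *)
Lemma class_C1_extend (u : 'rV[R]_k -> R) : class_C 1 U u ->
  (forall x, U x -> r < `|x0 - x| -> u x = 0) -> class_C 1 [set: 'rV[R]_k] (u \_ U).
Proof.
move=> cu u0; have oU : open U := open_local_dom hF (a := a) (i := i).
have oK : open (~` K) by exact/closed_openC/closed_closed_ball_.
have -> : [set: 'rV[R]_k] = U `|` ~` K.
  apply/seteqP; split=> // x _; have [Kx|nKx] := pselect (K x); last by right.
  by left; exact: ball_local.
have c1 : class_C 1 U (u \_ U).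
  apply: (@class_C_eq _ _ _ 1 _ u _ oU _ cu) => x Ux.
  by rewrite patchE mem_set.
have c2 : class_C 1 (~` K) (u \_ U).
  apply: (@class_C_eq _ _ _ 1 _ (fun=> 0 : R) _ oK _ (class_C_cst _ _ _)) => x nKx.
  have [Ux|nUx] := pselect (U x); last by rewrite patchE memNset.
  rewrite patchE mem_set // u0 // ltNge; exact/negP.
exact: (class_CU c1 c2).
Qed.

(** Another chart is covered by the part meeting D, where the transition map is
    composed with u, and the complement of the closed ball, where the extension is
    zero. *)
Lemma chart_ext_class_C1 (u : 'rV[R]_k -> R) : class_C 1 U u ->
  (forall x, U x -> r < `|x0 - x| -> u x = 0) -> class_C1 (chart_ext a D u).
Proof.
move=> cu u0 a'.
have oW1 : open (coord a' @` (dom a' `&` D)).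
  apply: open_coord => [|p []//]; apply: openI; first exact: dom_open.
  exact: open_chart_dom.
have oW2 : open (coord a' @` (dom a' `&` ~` (param a @` K))).
  apply: open_coord => [|p []//]; apply: openI; first exact: dom_open.
  exact: open_ball_complement.
have -> : img a' = coord a' @` (dom a' `&` D) `|` coord a' @` (dom a' `&` ~` (param a @` K)).
  apply/seteqP; split=> [_ [p ap <-]|x [[p [ap _] <-]|[p [ap _] <-]]]; last 2 first.
  - by exists p.
  - by exists p.
  have [Dp|nDp] := pselect (D p); first by left; exists p.
  by right; exists p => //; split=> //; exact: notin_ball.
have c1 : class_C 1 (coord a' @` (dom a' `&` D)) (chart_ext a D u \o param a').
  have sub : coord a' @` (dom a' `&` D) `<=` coord a' @` (dom a' `&` dom a).
    by move=> _ [p [ap' [ap _]] <-]; exists p.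
  have tU x : (coord a' @` (dom a' `&` D)) x -> U (transition a' a x).
    by move=> [p [ap' Dp] <-]; exists p => //; rewrite /transition /= coordK.
  apply: (class_C_eq oW1 _ (class_C_comp oW1 tU
    (class_C_sub sub (class_C_transition a' a 1)) cu)).
  move=> _ [p [ap' Dp] <-]; rewrite /transition /= coordK // chart_extE //.
have c2 : class_C 1 (coord a' @` (dom a' `&` ~` (param a @` K))) (chart_ext a D u \o param a').
  apply: (@class_C_eq _ _ _ 1 _ (fun=> 0 : R) _ oW2 _ (class_C_cst _ _ _)).
  move=> _ [p [ap' nKp] <-] /=; rewrite coordK //.
  have [Dp|nDp] := pselect (D p); last by rewrite chart_ext0.
  have [ap ip] := Dp.
  rewrite chart_extE // u0 //; first by exists p.
  by rewrite ltNge; apply/negP => Kp; apply: nKp; exists (coord a p) => //; exact: coordK.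
exact: (class_CU c1 c2).
Qed.

Let oD : open D. Proof. exact: open_chart_dom. Qed.

Let crho x : U x -> {for x, continuous (density F g a i)}.
Proof. exact: (class_C_density hg hF hsp 0 a i). Qed.

Let rho0 x : U x -> 0 < density F g a i x.
Proof. exact: density_gt0. Qed.

Let vol (f : S -> R) : continuous f -> (forall p, 0 <= f p) -> (forall p, ~ D p -> f p = 0) ->
  (\int[mu]_p (f p)%:E)%E =
  integral_rV ((fun x => (f (param a x) * density F g a i x)%:E) \_ U).
Proof. exact: induced_volume_local. Qed.

Lemma integral_supported_fin (u : 'rV[R]_k -> R) : class_C 1 U u ->
  (forall x, U x -> r < `|x0 - x| -> u x = 0) -> (forall x, U x -> 0 <= u x) ->
  (\int[mu]_p (chart_ext a D u p)%:E < +oo)%E.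
Proof.
move=> cu u0 uge0; have [dw _] := class_C1_extend cu u0.
have E p : chart_ext a D u p = chart_ext a D (u \_ U) p.
  have [[ap ip]|nDp] := pselect (D p); last by rewrite !chart_ext0.
  by rewrite !chart_extE // patchE mem_set //; exact: local_dom_coord.
under eq_integral do rewrite E.
apply: (integral_chart_ext_fin oD Da crho rho0 vol (@compact_ball _ _ x0 r) ball_local).
- by move=> x _; exact: differentiable_continuous (dw x I).
- move=> x nKx; have [Ux|nUx] := pselect (U x); last by rewrite patchE memNset.
  by rewrite patchE mem_set // u0 // ltNge; exact/negP.
move=> x; have [Ux|nUx] := pselect (U x); last by rewrite patchE memNset.
by rewrite patchE mem_set // uge0.
Qed.

Hypothesis muS : (mu setT < +oo)%E.

(** In the chart a the integrand is rho^{-1} sum_b d_b w^b, where w^b, equal to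
    chi times the flux, extends by zero to a C^1 function on the whole
    coordinate space. *)
Lemma integral_localized_divergence chi : class_C1 chi -> supported_in_ball chi ->
  mu.-integrable setT (EFin \o ((fun p => chi p * div p + trace (Grad chi) p) : borel S -> R)) /\
  \int[mu]_p (chi p * div p + trace (Grad chi) p) = 0.
Proof.
move=> cchi sc; have oU : open U := open_local_dom hF (a := a) (i := i).
pose w b := (fun x => (chi \o param a) x * flux F g Q L a i b x) \_ U.
have cU b : class_C 1 U (fun x => (chi \o param a) x * flux F g Q L a i b x).
  have UI : U `<=` img a by move=> _ [p [ap _] <-]; exists p.
  exact: (class_CM oU (class_C_sub UI (cchi a)) (class_C_flux hg hQ hF hsp hL 1 a i b)).
have far b x : U x -> r < `|x0 - x| -> (chi \o param a) x * flux F g Q L a i b x = 0.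
  move=> [p [ap ip] <-] pr /=; rewrite coordK //.
  have -> : chi p = 0; last by rewrite mul0r.
  by apply/eqP; apply: contraTT pr => /sc[_ pr]; rewrite -leNgt.
have cw b : class_C 1 [set: 'rV[R]_k] (w b) := class_C1_extend (cU b) (far b).
have wfar b x : r < `|x0 - x| -> w b x = 0.
  move=> xr; have [Ux|nUx] := pselect (U x); last by rewrite /w patchE memNset.
  by rewrite /w patchE mem_set // far.
pose v b := chart_ext a D (fun x => 'D_(e b) (w b) x / density F g a i x).
have vE p : chi p * div p + trace (Grad chi) p = \sum_b v b p.
  have [[ap ip]|nDp] := pselect (D p); last first.
    rewrite big1 => [|b _]; last by rewrite /v chart_ext0.
    have nK := notin_ball nDp.
    rewrite (supported0 sc nK) mul0r add0r.
    rewrite (gradient_trace_local (eta := fun=> 0) open_ball_complement nK) ?gradient_trace_cst //.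
    by move=> q /(supported0 sc).
  have Ux : U (coord a p) by exact: local_dom_coord.
  have Dp : D p by [].
  have wE b : 'D_(e b) (w b) (coord a p) =
      'D_(e b) (fun y => (chi \o param a) y * flux F g Q L a i b y) (coord a p).
    apply: near_eq_derive; apply: (open_near oU Ux) => y Uy.
    by rewrite /w patchE mem_set.
  have rp := rho0 Ux.
  under eq_bigr => b _ do rewrite /v chart_extE // wE.
  rewrite -mulr_suml (localized_flux_divergence hg hQ hF hsp hL cchi Ux) coordK //.
  by rewrite mulrAC mulfV ?mul1r // gt_eqF.
have vI b : mu.-integrable setT (EFin \o (v b : borel S -> R)).
  have [_ cD] := cw b.
  apply: (weighted_integrable oD Da crho rho0 cS muS ballU).
    by move=> x; exact: (cD b x I).
  move=> x /negP; rewrite -ltNge => xr; apply: (derive_far0 (e b) (wfar b)).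
  by apply: lt_trans xr; rewrite ltr_pMl // ltr1n.
have [I1 I2] := Rintegral_sum (index_enum 'I_k) vI.
have E : (fun p => chi p * div p + trace (Grad chi) p) = (fun p => \sum_b v b p).
  by apply/funext.
rewrite E; split=> //; apply: etrans I2 _; apply: big1 => b _.
exact: (integral_derive0 oD Da crho rho0 vol cS muS r0 ballU b (cw b) (wfar b)).
Qed.

End supported_in_a_ball.
Lemma class_C1_continuous (chi : S -> R) : class_C1 chi -> continuous chi.
Proof.
move=> cchi p; set a := chart_at p; have ap : dom a p := chart_atP p.
have [dc _] := cchi a; have ix : img a (coord a p) by exists p.
have cc := differentiable_continuous (dc _ ix).
have nE : \near p, (chi \o param a) (coord a p) = chi p.
  by apply: (open_near (dom_open a)) => // q aq; rewrite /= coordK.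
rewrite /continuous_at -(nbhs_singleton nE).
apply: cvg_trans; first exact: near_eq_cvg nE.
exact: (@continuous_comp _ _ _ (coord a) (chi \o param a) p (coord_cont ap) cc).
Qed.

Lemma class_C1_sum (I : Type) (s : seq I) (chi : I -> S -> R) : (forall j, class_C1 (chi j)) ->
  class_C1 (fun p => \sum_(j <- s) chi j p).
Proof. by move=> cchi a; apply: class_C_sum => [|j _]; [exact: open_img|exact: cchi]. Qed.

Lemma class_C1_div (chi eta : S -> R) : class_C1 chi -> class_C1 eta ->
  (forall p, eta p != 0) -> class_C1 (fun p => chi p / eta p).
Proof.
move=> cchi ceta eta0 a; have oI := @open_img _ _ S a.
apply: (class_CM oI (cchi a)); apply: (class_CV oI _ (ceta a)) => x _; exact: eta0.
Qed.

Lemma small_ball q : exists r : R, 0 < r /\ forall x,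
  `|coord (chart_at q) q - x| <= 2 * r -> local_dom F (chart_at q) (chart_at (F q)) x.
Proof.
have Ux := local_dom_coord (chart_atP q) (chart_atP (F q)).
have : nbhs (coord (chart_at q) q) (local_dom F (chart_at q) (chart_at (F q))).
  by apply: open_nbhs_nbhs; split=> //; exact: open_local_dom.
move=> /nbhs_ballP[r /= r0 rU]; exists (r / 4); split; first by rewrite divr_gt0.
move=> x xr; apply: rU; rewrite -ball_normE /=; apply: le_lt_trans xr _.
by lra.
Qed.

Definition radius q : R := projT1 (cid (small_ball q)).

Lemma radius_gt0 q : 0 < radius q.
Proof. by rewrite /radius; case: cid => r []. Qed.

Lemma radius_ball q x : `|coord (chart_at q) q - x| <= 2 * radius q ->
  local_dom F (chart_at q) (chart_at (F q)) x.
Proof. by rewrite /radius; case: cid => r [? H] /=; exact: H. Qed.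

Local Notation a_ q := (chart_at q).
Local Notation U_ q := (local_dom F (a_ q) (chart_at (F q))).
Local Notation D_ q := (chart_dom F (a_ q) (chart_at (F q))).
Local Notation bump_ q := (bump (coord (a_ q) q) (radius q)).

Definition manifold_bump q : S -> R := chart_ext (a_ q) (D_ q) (bump_ q).

Lemma bump_class_C1 q : class_C 1 (U_ q) (bump_ q).
Proof. exact: (class_C_sub _ (@class_C1_bump _ _ _ _)). Qed.

Lemma manifold_bump_class_C1 q : class_C1 (manifold_bump q).
Proof.
apply: (chart_ext_class_C1 (radius_gt0 q) (@radius_ball q) (bump_class_C1 q)).
by move=> x _; exact: bump_far (radius_gt0 q).
Qed.

Lemma manifold_bump_ge0 q p : 0 <= manifold_bump q p.
Proof.
have [Dp|nDp] := pselect (D_ q p); last by rewrite /manifold_bump chart_ext0.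
by rewrite /manifold_bump chart_extE //; exact: bump_ge0.
Qed.

Lemma manifold_bump_center q : 0 < manifold_bump q q.
Proof.
rewrite /manifold_bump chart_extE; first exact/bump_center/radius_gt0.
by split; exact: chart_atP.
Qed.

Lemma manifold_bump_supported q :
  supported_in_ball (a_ q) (chart_at (F q)) (coord (a_ q) q) (radius q) (manifold_bump q).
Proof.
move=> p; have [Dp|nDp] := pselect (D_ q p); last by rewrite /manifold_bump chart_ext0 ?eqxx.
rewrite /manifold_bump chart_extE // => bp; split=> //; rewrite leNgt; apply/negP => far.
by move: bp; rewrite bump_far ?eqxx //; exact: radius_gt0.
Qed.

Lemma finite_bump_cover : exists s : seq S, forall p, 0 < \sum_(q <- s) manifold_bump q p.
Proof.
have : cover_compact [set: S] by rewrite -compact_cover.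
pose W q := [set p | 0 < manifold_bump q p].
have oW q : [set: S] q -> open (W q).
  move=> _; have cb := class_C1_continuous (manifold_bump_class_C1 q).
  rewrite (_ : W q = manifold_bump q @^-1` [set t | 0 < t]) //.
  by move/continuousP: cb; apply; exact: open_gt.
have cW : [set: S] `<=` \bigcup_(q in [set: S]) W q.
  by move=> p _; exists p => //; exact: manifold_bump_center.
move=> /(_ _ [set: S] W oW cW)[D' _ sD']; exists (finmap.enum_fset D') => p.
have [q /= qD Wq] := sD' p I.
rewrite (big_rem q qD) /=; apply: ltr_pwDl => //.
by apply: sumr_ge0 => j _; exact: manifold_bump_ge0.
Qed.

Section partition_of_unity.
Variable s : seq S.
Let total p := \sum_(q <- s) manifold_bump q p.
Hypothesis total_gt0 : forall p, 0 < total p.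

Definition unity_part q p : R := manifold_bump q p / total p.

Lemma unity_part_class_C1 q : class_C1 (unity_part q).
Proof.
apply: class_C1_div; first exact: manifold_bump_class_C1.
  by apply: class_C1_sum => j; exact: manifold_bump_class_C1.
by move=> p; rewrite gt_eqF.
Qed.

Lemma unity_part_supported q :
  supported_in_ball (a_ q) (chart_at (F q)) (coord (a_ q) q) (radius q) (unity_part q).
Proof.
move=> p cp; apply: manifold_bump_supported; apply: contraNneq cp => bp.
by rewrite /unity_part bp mul0r.
Qed.

Lemma unity_part_sum p : \sum_(q <- s) unity_part q p = 1.
Proof. by rewrite -mulr_suml divff // gt_eqF //; exact: total_gt0. Qed.

Lemma unity_part_fin q : (\int[mu]_p (unity_part q p)%:E < +oo)%E.
Proof.
pose u x := bump_ q x / total (param (a_ q) x).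
have uE p : unity_part q p = chart_ext (a_ q) (D_ q) u p.
  have [[ap ip]|nDp] := pselect (D_ q p).
    have Dp : D_ q p by [].
    by rewrite /unity_part /manifold_bump !chart_extE // /u coordK.
  by rewrite /unity_part /manifold_bump !chart_ext0 // mul0r.
under eq_integral do rewrite uE.
apply: (integral_supported_fin (radius_gt0 q) (@radius_ball q)).
- have oU := open_local_dom hF (a := a_ q) (i := chart_at (F q)).
  have UI : U_ q `<=` img (a_ q) by move=> _ [p [ap _] <-]; exists p.
  apply: (class_CM oU (bump_class_C1 q)); apply: (class_CV oU).
    by move=> x _; rewrite gt_eqF.
  apply: (class_C_sub UI).
  exact: (class_C1_sum s manifold_bump_class_C1 (a_ q)).
- by move=> x _ xr; rewrite /u bump_far ?mul0r //; exact: radius_gt0.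
by move=> x _; rewrite divr_ge0 ?bump_ge0 // ltW.
Qed.

(** The constant 1 is a finite sum of functions supported in coordinate
    balls, each with finite integral. *)
Lemma induced_volume_finite_part : (mu setT < +oo)%E.
Proof.
have mE : (mu setT = \int[mu]_p (\sum_(q <- s) (unity_part q p)%:E))%E.
  rewrite -[LHS]mul1e -integral_cst //; apply: eq_integral => p _.
  by rewrite sumEFin unity_part_sum.
rewrite mE ge0_integral_sum //.
- by apply: lte_sum_pinfty => q _; exact: unity_part_fin.
- move=> q; apply/measurable_EFinP.
  exact: continuous_borel_measurable (class_C1_continuous (unity_part_class_C1 q)).
by move=> q p _; rewrite lee_fin divr_ge0 ?manifold_bump_ge0 // ltW.
Qed.

(** The gradient terms of the parts add up to the gradient of the constant 1. *)
Lemma integral_divergence_part : \int[mu]_p div p = 0.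
Proof.
pose f q p := unity_part q p * div p + trace (Grad (unity_part q)) p.
have H q := integral_localized_divergence (radius_gt0 q) (@radius_ball q)
  induced_volume_finite_part (unity_part_class_C1 q) (unity_part_supported (q := q)).
have [_ I2] := Rintegral_sum s (fun q => (H q).1).
transitivity (\int[mu]_p (\sum_(q <- s) f q p)).
  apply: eq_Rintegral => p _; rewrite big_split /= -mulr_suml unity_part_sum mul1r.
  rewrite -(gradient_trace_sum s p unity_part_class_C1).
  rewrite (gradient_trace_local (eta := fun=> 1) openT I); last by move=> q _; exact: unity_part_sum.
  by rewrite gradient_trace_cst addr0.
by apply: etrans I2 _; apply: big1 => q _; exact: (H q).2.
Qed.

End partition_of_unity.

Lemma induced_volume_finite : (mu setT < +oo)%E.
Proof. by have [s s0] := finite_bump_cover; exact: (induced_volume_finite_part s0). Qed.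

Theorem integral_divergence : \int[mu]_p div p = 0.
Proof. by have [s s0] := finite_bump_cover; exact: (integral_divergence_part s0). Qed.

End compact_submanifold.

(** * The integral identity *)

Theorem theorem2p2 (R : realType) (n : nat) (hn : (0 < n)%N)
  (V : manifold R n.+1) (hV : oriented V)
  (g : chart V -> 'rV[R]_n.+1 -> 'M[R]_n.+1)
  (hg : riemannian g \/ lorentzian g)
  (Q : chart V -> 'rV[R]_n.+1 -> 'M[R]_n.+1)
  (hQ : conformal_killing_yano g Q)
  (S : manifold R n.-1) (hSc : compact [set: S]) (hSo : oriented S)
  (F : S -> V) (hF : immersion F) (hsp : spacelike g F)
  (hN : normal_bundle_orientable g F)
  (mu : {measure set (borel S) -> \bar R}) (hmu : induced_volume g F mu)
  (L : chart V -> S -> 'rV[R]_n.+1)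
  (hL : normal_field g F L) (hL0 : null_field g F L) :
  n.-1%:R / n%:R * (\int[mu]_p xi_dot g F Q L p)
  + \int[mu]_p Q_mean_curvature g F Q L p
  + \int[mu]_p Q_normal_derivative g F Q L p = 0.
Proof.
have pg : pseudo_riemannian g by case: hg => -[].
have two : two_form Q by case: hQ.
have muS : (mu setT < +oo)%E := induced_volume_finite pg hF hsp hmu hSc.
pose tr M p := invariant_trace F g M p.
have integrable_trace M : chart_tensor F M -> chart_continuous F M ->
    mu.-integrable setT (EFin \o (tr M : borel S -> R)).
  move=> tM cM; apply: continuous_integrable => //.
  exact: (invariant_trace_continuous pg hF hsp tM cM).
have I1 := integrable_trace _ (nabla_mx_tensor pg two hF hL) (nabla_mx_continuous pg two hF hL).
have I2 := integrable_trace _ (curvature_mx_tensor pg two hF hsp hL)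
  (curvature_mx_continuous pg two hF hsp hL).
have I3 := integrable_trace _ (normal_derivative_mx_tensor pg two hF hsp hL)
  (normal_derivative_mx_continuous pg two hF hsp hL).
pose c : R := n.-1%:R / n%:R.
have xiE : c * (\int[mu]_p xi_dot g F Q L p) = \int[mu]_p tr (nabla_mx F g Q L) p.
  have E p : tr (nabla_mx F g Q L) p = c * xi_dot g F Q L p by exact: nabla_trace.
  (* For n = 1 the factor is zero, and integrability of <xi, L> cannot be read off
     from the trace. *)
  have [c0|c0] := eqVneq c 0.
    rewrite c0 mul0r (eq_Rintegral _ (g := fun=> 0)) => [|p _]; last by rewrite E c0 mul0r.
    by rewrite /Rintegral integral0.
  have xiE p : xi_dot g F Q L p = c^-1 * tr (nabla_mx F g Q L) p by rewrite E mulKf.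
  have -> : \int[mu]_p xi_dot g F Q L p = \int[mu]_p (c^-1 * tr (nabla_mx F g Q L) p).
    by apply: eq_Rintegral => p _.
  by rewrite RintegralZl // mulVKf.
have curE : \int[mu]_p Q_mean_curvature g F Q L p = \int[mu]_p tr (curvature_mx F g Q L) p.
  by apply: eq_Rintegral => p _; exact: Q_mean_curvatureE.
have norE : \int[mu]_p Q_normal_derivative g F Q L p =
    \int[mu]_p tr (normal_derivative_mx F g Q L) p.
  by apply: eq_Rintegral => p _; exact: Q_normal_derivativeE.
rewrite -/c xiE curE norE -RintegralD // -RintegralD //; last exact: (integrableD measurableT I1 I2).
exact: (integral_divergence pg two hF hsp hL hmu hSc).
Qed.
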